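(* Let $m\ge 1$ be a fixed integer and let $p=p_n$ be a sequence of positive integers with $p_n\to\infty$ as $n\to\infty$. For each $n$ let $\mathbf{x}_1,\ldots,\mathbf{x}_p$ be independent and identically distributed $\mathbb{R}^n$-valued random vectors. Let $v,w\in\overline{\mathbb{R}}=\mathbb{R}\cup\{\infty,-\infty\}$ with $v<w$, and for each $n$ let $g_n:\mathbb{R}^{mn}=(\mathbb{R}^n)^m\to(v,w)$ be a measurable and symmetric function. Assume that there exists a function $\mu:(v,w)\to[0,\infty)$ with $\lim_{x\to v}\mu(x)=\infty$ and $\lim_{x\to w}\mu(x)=0$ such that, for every $x\in(v,w)$ and as $n\to\infty$, (A1) $\binom{p}{m}\,\mathbb{P}\big(g_n(\mathbf{x}_1,\mathbf{x}_2,\ldots,\mathbf{x}_m)>x\big)\to\mu(x)$, and (A2) $\mathbb{P}\big(g_n(\mathbf{x}_1,\ldots,\mathbf{x}_m)>x,\ g_n(\mathbf{x}_{m-l+1},\ldots,\mathbf{x}_{2m-l})>x\big)=o\big(p^{-(2m-l)}\big)$ for $l=1,\ldots,m-1$. Then the point processes $$M_n=\sum_{1\le i_1<i_2<\cdots<i_m\le p}\varepsilon_{\left((i_1/p,\ldots,i_m/p),\,g_n(\mathbf{x}_{i_1},\ldots,\mathbf{x}_{i_m})\right)}$$ converge in distribution, as $n\to\infty$, to $M$ in $\mathcal{M}(S)$, where $M$ is a Poisson random measure on $S$ with mean measure $\eta$.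
   Context: $\varepsilon_x$ denotes the Dirac measure at $x$. A function $g_n:(\mathbb{R}^n)^m\to\mathbb{R}$ is symmetric if $g_n(\mathbf{y}_1,\ldots,\mathbf{y}_m)=g_n(\mathbf{y}_{\pi(1)},\ldots,\mathbf{y}_{\pi(m)})$ for all $\mathbf{y}_1,\ldots,\mathbf{y}_m\in\mathbb{R}^n$ and all permutations $\pi$ of $\{1,\ldots,m\}$. The state space is $S=S_1\times(v,w)$ with $S_1=\{(z_1,\ldots,z_m):0<z_1<z_2<\cdots<z_m\le 1\}$. $\mathcal{M}(S)$ is the space of point measures on $S$ endowed with the vague topology, and convergence in distribution of point processes means convergence in distribution of random elements of $\mathcal{M}(S)$. The symbol $\mu$ also denotes the measure on $(v,w)$ with $\mu(a,b):=\mu((a,b)):=\mu(a)-\mu(b)$ for $v<a<b<w$; it is understood that the function $\mu$ is such that this defines a (Borel) measure. The mean measure $\eta$ on $S$ is determined by $$\eta\Big(\prod_{l=1}^{m+1}(r_l,s_l)\Big)=m!\,\lambda_m\Big(\prod_{l=1}^{m}(r_l,s_l)\Big)\,\mu(r_{m+1},s_{m+1})$$ for rectangles contained in $S$, where $\lambda_m$ is Lebesgue measure on $\mathbb{R}^m$. *)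

(* Defs.v *)
From HB Require Import structures.
From mathcomp Require Import all_boot all_order all_algebra.
From mathcomp Require Import all_classical all_reals all_analysis.
From mathcomp Require Import measurable_realfun.

Set Implicit Arguments.
Unset Strict Implicit.
Unset Printing Implicit Defensive.

Import Order.TTheory GRing.Theory Num.Theory.
Import numFieldNormedType.Exports.

Local Open Scope classical_set_scope.
Local Open Scope ring_scope.

Notation borel E := (g_sigma_algebraType (@open E)).

Section point_measures.
Context {R : realType} (E : ptopologicalType).

Definition is_point_measure (N : {measure set (borel E) -> \bar R}) : Prop :=
  (exists (I : countType) (x : I -> borel E), forall A, measurable A ->
     N A = \esum_(i in [set: I]) \d_(x i) A) /\
  (forall K : set E, compact K -> (N K < +oo)%E).

Record point_measure : Type := PointMeasure {
  pm_measure :> {measure set (borel E) -> \bar R} ;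
  pm_axiom : is_point_measure pm_measure }.

Lemma mzero_point_measure :
  is_point_measure (@mzero _ (borel E) R : {measure set (borel E) -> \bar R}).
Proof.
split=> [|K _]; last by rewrite /= /mzero ltry.
exists void, (fun v : void => match v with end) => A _.
by rewrite /= /mzero esum1 // => -[].
Qed.

HB.instance Definition _ := gen_eqMixin point_measure.
HB.instance Definition _ := gen_choiceMixin point_measure.
HB.instance Definition _ := isPointed.Build point_measure
  (PointMeasure mzero_point_measure).

(* $C_K^+(E)$ *)
Record test_function : Type := TestFunction {
  tf_fun :> E -> R ;
  tf_continuous : continuous tf_fun ;
  tf_ge0 : forall x, 0 <= tf_fun x ;
  tf_compact : compact (closure [set x | tf_fun x != 0]) }.

Definition vague_eval (N : point_measure) : {ptws test_function -> R} :=
  fun f => \int[N]_x f x.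

(* The vague topology: the coarsest one making every $N \mapsto \int f dN$,
   $f \in C_K^+(E)$, continuous. *)
HB.instance Definition _ :=
  Topological.copy point_measure (initial_topology vague_eval).

End point_measures.

Arguments point_measure R E : clear implicits.

Section finite_point_measure.
Context {R : realType} {E : ptopologicalType} (I : finType) (x : I -> E).

Definition sum_dirac (A : set (borel E)) : \bar R :=
  (\sum_(i : I) \d_(x i : borel E) A)%E.

Let sum_dirac_msum : sum_dirac =
  msum (fun k => \d_(nth point [seq x i | i <- enum I] k : borel E)) #|I|.
Proof.
apply/funext => A; rewrite /sum_dirac /msum.
rewrite (reindex (@enum_val _ (mem I))) /=; last first.
  exact/onW_bij/enum_val_bij.
apply: eq_bigr => k _; have i0 := enum_val k.
by rewrite (nth_map i0) -?cardE // (enum_val_nth i0).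
Qed.

Let sum_dirac0 : sum_dirac set0 = 0%E.
Proof. by rewrite sum_dirac_msum measure0. Qed.

Let sum_dirac_ge0 A : (0 <= sum_dirac A)%E.
Proof. by rewrite sum_dirac_msum measure_ge0. Qed.

Let sum_dirac_sigma_additive : semi_sigma_additive sum_dirac.
Proof. by rewrite sum_dirac_msum; exact: measure_semi_sigma_additive. Qed.

HB.instance Definition _ := isMeasure.Build _ _ _ sum_dirac
  sum_dirac0 sum_dirac_ge0 sum_dirac_sigma_additive.

Lemma sum_dirac_point_measure :
  is_point_measure (sum_dirac : {measure set (borel E) -> \bar R}).
Proof.
split=> [|K _].
  exists I, x => A _; rewrite /= /sum_dirac esum_fset //; last exact: finite_finset.
  rewrite (fsbigE (index_enum I)) ?index_enum_uniq //; last first.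
    by move=> i _; rewrite mem_index_enum.
  by apply: eq_bigl => i; apply/esym/mem_set.
by rewrite /= /sum_dirac; apply: lte_sum_pinfty => i _; rewrite diracE ltry.
Qed.

Definition sum_dirac_pm : point_measure R E :=
  PointMeasure sum_dirac_point_measure.

End finite_point_measure.

Section probability_notions.
Local Open Scope ereal_scope.
Context {R : realType}.

Definition mutually_independent d (T : measurableType d) (P : probability T R)
    d' (T' : measurableType d') (I : finType) (X : I -> T -> T') : Prop :=
  forall (J : {set I}) (A : I -> set T'), (forall i, measurable (A i)) ->
    P (\bigcap_(i in [set` J]) X i @^-1` A i) =
    \prod_(i in J) P (X i @^-1` A i).

Definition identically_distributed d (T : measurableType d)
    (P : probability T R) d' (T' : measurableType d')
    (I : Type) (X : I -> T -> T') : Prop :=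
  forall i j (A : set T'), measurable A -> P (X i @^-1` A) = P (X j @^-1` A).

Definition cvg_in_distribution (E : ptopologicalType)
    (d : nat -> measure_display) (T : forall n, measurableType (d n))
    (P : forall n, probability (T n) R) (X : forall n, T n -> E)
    d' (T' : measurableType d') (P' : probability T' R) (Y : T' -> E) : Prop :=
  [/\ forall n, measurable_fun setT (X n : T n -> borel E),
      measurable_fun setT (Y : T' -> borel E) &
      forall h : E -> R, continuous h ->
        (exists C : R, forall y, (`|h y| <= C)%R) ->
        'E_(P n)[h \o X n] @[n --> \oo] --> 'E_P'[h \o Y]].

(* With rate 0 the formula gives the unit mass at 0, since 0 ^+ 0 = 1. *)
Definition is_poisson_random_measure (E : ptopologicalType)
    d (T : measurableType d) (P : probability T R) (M : T -> point_measure R E)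
    (eta : {measure set (borel E) -> \bar R}) : Prop :=
  [/\ measurable_fun setT (M : T -> borel (point_measure R E)),
      forall A : set (borel E), measurable A -> eta A < +oo ->
        forall k : nat, P [set w | M w A = k%:R%:E] =
          (expR (- fine (eta A)) * fine (eta A) ^+ k / k`!%:R)%:E,
      forall A : set (borel E), measurable A -> eta A = +oo ->
        P [set w | M w A = +oo] = 1 &
      forall (k : nat) (A : 'I_k -> set (borel E)),
        (forall i, measurable (A i)) -> trivIset setT A ->
        mutually_independent P (fun i w => M w (A i))].

End probability_notions.

Section state_space.
Context (R : realType).

Definition simplex_set m : set 'rV[R]_m :=
  [set z | (forall i, 0 < z ord0 i <= 1) /\
           (forall i j : 'I_m, (i < j)%N -> z ord0 i < z ord0 j)].

Definition S1 m : Type := set_type (@simplex_set m).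

HB.instance Definition _ m := Topological.on (S1 m).

Definition open_itv_set (v w : \bar R) : set R :=
  [set x | (v < x%:E)%E && (x%:E < w)%E].

(* The inequality v < w is an argument of the type so that the type is pointed,
   which the measure library requires of every measurable space. *)
Definition open_itv (v w : \bar R) (vw : (v < w)%E) : Type :=
  set_type (open_itv_set v w).

HB.instance Definition _ v w (vw : (v < w)%E) := Topological.on (open_itv vw).

Section times.
Variables m p : nat.

(* The tuple t encodes 1 <= i_1 < ... < i_m <= p by i_(l+1) = t_l + 1. *)
Definition increasing (t : m.-tuple 'I_p) : bool :=
  [forall i : 'I_m, forall j : 'I_m, (i < j)%N ==> (tnth t i < tnth t j)%N].

Definition inc_index : finType := {t : m.-tuple 'I_p | increasing t}.

Definition times_row (t : inc_index) : 'rV[R]_m :=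
  \row_l ((tnth (val t) l).+1%:R / p%:R).

Lemma times_rowP t : times_row t \in @simplex_set m.
Proof.
have p0 (k : 'I_p) : 0 < p%:R :> R by rewrite ltr0n (leq_ltn_trans _ (ltn_ord k)).
rewrite inE; split=> [i|i j ij]; rewrite !mxE.
  have pi := p0 (tnth (val t) i); apply/andP; split.
    by apply: divr_gt0 => //; rewrite ltr0n.
  by rewrite ler_pdivrMr // mul1r ler_nat.
rewrite ltr_pM2r ?invr_gt0 ?(p0 (tnth (val t) i)) // ltr_nat ltnS.
by have /forallP/(_ i)/forallP/(_ j)/implyP := valP t; exact.
Qed.

Definition times (t : inc_index) : S1 m := exist _ (times_row t) (times_rowP t).

End times.

Lemma inc_index_full m : increasing [tuple i | i < m].
Proof.
by apply/forallP => i; apply/forallP => j; apply/implyP; rewrite !tnth_mktuple.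
Qed.

HB.instance Definition _ m := isPointed.Build (S1 m)
  (times (exist _ [tuple i | i < m] (inc_index_full m))).

Lemma open_itv_nonempty (v w : \bar R) : (v < w)%E ->
  exists x, x \in open_itv_set v w.
Proof.
case: v w => [v||] [w||] //.
- rewrite lte_fin => vw; exists ((v + w) / 2%:R).
  by rewrite inE; apply/andP; rewrite !lte_fin !midf_lt.
- by exists (v + 1); rewrite inE; apply/andP; rewrite lte_fin ltrDl ltr01 ltry.
- by exists (w - 1); rewrite inE; apply/andP; rewrite lte_fin ltrBlDr ltrDl ltr01 ltNyr.
- by exists 0; rewrite inE; apply/andP; rewrite ltry ltNyr.
Qed.

HB.instance Definition _ v w (vw : (v < w)%E) := isPointed.Build (open_itv vw)
  (let: exist x xvw := cid (open_itv_nonempty vw) in exist _ x xvw).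

Definition state_space m v w (vw : (v < w)%E) : Type :=
  (S1 m * open_itv vw)%type.

HB.instance Definition _ m v w (vw : (v < w)%E) :=
  Topological.on (state_space m vw).
HB.instance Definition _ m v w (vw : (v < w)%E) :=
  Pointed.on (state_space m vw).

(* The last condition holds for the product measure $m!\,\lambda_m \otimes \mu$,
   but it does not follow from the values on open rectangles: no open rectangle
   contained in S meets {z_m = 1}. Since 0 < z_1 < ... < z_m <= 1, that set is
   the set of the points with some coordinate z_l equal to 1. *)
Definition is_mean_measure m v w (vw : (v < w)%E)
    (mu_measure : {measure set R -> \bar R})
    (eta : {measure set (borel (state_space m vw)) -> \bar R}) : Prop :=
  (forall (r s : 'rV[R]_m) (a b : R),
     (forall l, r ord0 l < s ord0 l) -> a < b ->
     [set z : 'rV[R]_m | forall l, r ord0 l < z ord0 l < s ord0 l] `<=` @simplex_set m ->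
     `]a, b[%classic `<=` open_itv_set v w ->
     eta [set y : state_space m vw | (forall l, r ord0 l < val y.1 ord0 l < s ord0 l) /\
                  a < val y.2 < b] =
     ((m`!%:R * \prod_(l < m) (s ord0 l - r ord0 l))%:E * mu_measure `]a, b[%classic)%E)
  /\ eta [set y : state_space m vw | exists l, val y.1 ord0 l = 1] = 0%E.

Definition point_process m p v w (vw : (v < w)%E) n
    (g : m.-tuple (n.-tuple R) -> open_itv vw) (x : nat -> n.-tuple R) :
    point_measure R (state_space m vw) :=
  sum_dirac_pm (fun t : inc_index m p =>
    (times t, g [tuple x (tnth (val t) l) | l < m]) : state_space m vw).

End state_space.

Arguments simplex_set {R} m.
Arguments open_itv_set {R} v w.

(* Main.v *)
(* The numbers of points of M_n in finitely many disjoint cells nearly satisfy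
   the Poisson recursion k_j P(W = k) = lam_j P(W = k - e_j): when the index
   tuple a falls in the cell j and no tuple sharing an index with a falls in any
   cell, the remaining counts come from tuples independent of a, and (A1), (A2)
   bound the error.  The first moments control the tails, so the joint counts
   converge in law to independent Poisson variables.

   Vague convergence follows without any compactness criterion.  Given h >= 0
   bounded and continuous, let c_N(k) be the infimum of h over the point measures
   with counts k on the cells of a grid of mesh 1/N.  The liminf of E h(M_n) is at
   least the sum of c_N(k) P(counts of M = k) over finitely many k, and c_N at the
   counts of nu tends to h(nu), because every vague neighbourhood of nu contains
   all the point measures with the same counts on a fine enough grid.  Apply this
   to C + h and to C - h, where C bounds |h|. *)

Require Import Defs.
From HB Require Import structures.
From mathcomp Require Import all_boot all_order all_algebra.
From mathcomp Require Import finmap all_classical all_reals all_analysis.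
From mathcomp Require Import measurable_realfun perm.
From mathcomp Require Import ring lra zify.

Set Implicit Arguments.
Unset Strict Implicit.
Unset Printing Implicit Defensive.

Import Order.TTheory GRing.Theory Num.Theory.
Import numFieldNormedType.Exports.

Local Open Scope classical_set_scope.
Local Open Scope ring_scope.

(** * Poisson limit from an approximate recursion *)

(** The obstacle is the missing boundary of the state space: the hyperplane z_1 = 0, the diagonals
    and the levels v and w do not belong to it, and compact sets stay away from them. Only grid
    cells lying a few mesh steps inside are kept. Their enlargements are compact, which makes all
    counts finite, and for large N they cover any given compact set. The face z_m = 1 does belong to
    the space, and cells may touch it.

    At most p^(2m-l) ordered pairs of tuples have exactly l common indices. For 0 < l < m the
    symmetry of g_n brings such a pair to the form of (A2); the value l = m means that both tuples
    coincide, and this is the added point of the recursion, not an error. The products of two single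
    probabilities are O(p^(-2m)) each and contribute O(p^(-l)) with l >= 1.

    Point measures carry the Borel sets of the vague topology. Count events are measurable because
    counts of cells are limits of vaguely continuous functionals, and M_n is measurable because it
    depends continuously on finitely many real values, its times being deterministic. *)

Section dissociated_recursion.
Context {R : realFieldType} {K J : finType}.
Implicit Types (L : {ffun K -> option J}) (k : {ffun J -> nat}).

(** A labelling [L] is meant to record, for each index tuple, the cell containing its point, with
    [None] for a point in no cell. *)
Definition counts L : {ffun J -> nat} :=
  [ffun j => \sum_(a : K) (L a == Some j)]%N.

Definition counts_off (nb : rel K) (a : K) L : {ffun J -> nat} :=
  [ffun j => \sum_(b | ~~ nb a b) (L b == Some j)]%N.

Definition decr k (j : J) : {ffun J -> nat} := [ffun i => k i - (i == j)]%N.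

Variable q : {ffun K -> option J} -> R.
Hypothesis q_ge0 : forall L, 0 <= q L.

(** Finite sums over labellings keep the recursion purely algebraic; [fpr_labels] turns them back
    into probabilities. *)
Definition fpr (E : pred {ffun K -> option J}) : R := \sum_L q L * (E L)%:R.

(** Union bound: the symmetric difference of [E] and [F] is covered by the events [X i]. *)
Lemma fpr_dist (I : finType) (Q : pred I) (E F : pred {ffun K -> option J})
    (X : I -> pred {ffun K -> option J}) :
  (forall L, (forall i, Q i -> ~~ X i L) -> E L = F L) ->
  `|fpr E - fpr F| <= \sum_(i | Q i) fpr (X i).
Proof.
move=> EF; rewrite /fpr -sumrB exchange_big /= (le_trans (ler_norm_sum _ _ _))//.
apply: ler_sum => L _; rewrite -mulrBr normrM ger0_norm// -mulr_sumr.
apply: ler_wpM2l => //.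
have [/existsP[i /andP[Qi Xi]]|/existsPn noX] :=
    boolP [exists i, Q i && X i L].
  rewrite (bigD1 i)//= Xi (@le_trans _ _ 1)//.
    by case: (E L); case: (F L); rewrite ?subrr ?subr0 ?sub0r ?normrN ?normr1 ?normr0.
  by rewrite lerDl sumr_ge0.
rewrite EF ?subrr ?normr0 ?sumr_ge0// => i Qi.
by have := noX i; rewrite Qi.
Qed.

Lemma counts_off_eq (nb : rel K) a L : nb a a ->
  (forall b, nb a b && (b != a) -> ~~ (L b != None)) ->
  forall i, counts L i = ((L a == Some i) + counts_off nb a L i)%N.
Proof.
move=> nba noL i; rewrite !ffunE (bigD1 a)//=; congr addn.
rewrite (bigID (nb a))/= big1 ?add0n => [|b /andP[ba nbab]].
  apply: eq_bigl => b; rewrite andb_idl// => nbab.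
  by apply: contraNneq nbab => ->.
by have := noL b; rewrite nbab ba => /(_ isT)/negPn/eqP->.
Qed.

(* On [L a = Some j], with no other neighbour of [a] labelled, the counts are
   those of the non-neighbours plus one at [j]; dissociation then factors the
   joint probability. *)
Lemma dissociated_recursion (nb : rel K) k j :
  (forall a, nb a a) ->
  (forall a k, fpr (fun L => (L a == Some j) && (counts_off nb a L == k)) =
     fpr (fun L => L a == Some j) * fpr (fun L => counts_off nb a L == k)) ->
  (0 < k j)%N ->
  `|(k j)%:R * fpr (fun L => counts L == k) -
    (\sum_a fpr (fun L => L a == Some j)) * fpr (fun L => counts L == decr k j)| <=
  \sum_a \sum_(b | nb a b && (b != a)) fpr (fun L => (L a != None) && (L b != None)) +
  \sum_a \sum_(b | nb a b) fpr (fun L => L a != None) * fpr (fun L => L b != None).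
Proof.
move=> nb_refl indep k0.
(* On the event that the counts are [k], the number [k j] is the number of [a] labelled [j], so the
   factor becomes a sum over [a]. *)
have -> : (k j)%:R * fpr (fun L => counts L == k) =
    \sum_a fpr (fun L => (L a == Some j) && (counts L == k)).
  rewrite /fpr mulr_sumr exchange_big/=; apply: eq_bigr => L _.
  rewrite mulrCA -mulr_sumr; congr (_ * _).
  have [<-|_] := eqVneq (counts L) k; last first.
    by rewrite mulr0 big1// => a _; rewrite andbF.
  by rewrite mulr1 ffunE natr_sum; apply: eq_bigr => a _; rewrite andbT.
rewrite mulr_suml -sumrB (le_trans (ler_norm_sum _ _ _))// -big_split/=.
apply: ler_sum => a _.
rewrite -(subrKA (fpr (fun L => (L a == Some j) && (counts_off nb a L == decr k j)))).
rewrite (le_trans (ler_normD _ _))// lerD//.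
  apply: fpr_dist => L noL; have [La|//] := boolP (L a == Some j); rewrite /=.
  have {}noL b : nb a b && (b != a) -> ~~ (L b != None).
    by move=> /noL; rewrite (eqP La).
  apply/eqP/eqP => [<-|koff]; apply/ffunP => i.
    by rewrite [RHS]ffunE (counts_off_eq (nb_refl a) noL) (eqP La)
       (inj_eq Some_inj) eq_sym addKn.
  rewrite (counts_off_eq (nb_refl a) noL) koff ffunE (eqP La) (inj_eq Some_inj) eq_sym.
  by have [->|_] := eqVneq i j; rewrite ?subnKC ?subn0.
have p_ge0 E : 0 <= fpr E by apply: sumr_ge0 => L _; rewrite mulr_ge0.
(* Going back from the counts off the neighbourhood to all counts can fail at any neighbour of [a],
   including [a] itself; hence the second error sum, unlike the first, keeps the diagonal. *)
rewrite indep -mulrBr normrM ger0_norm// -mulr_sumr ler_pM//.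
  apply: ler_sum => L _; rewrite ler_wpM2l// ler_nat.
  by have [->|] := eqVneq (L a) (Some j).
apply: fpr_dist => L noL; congr (_ == _).
have {}noL b : nb a b -> ~~ (L b != None) := noL b.
apply/ffunP => i; rewrite (@counts_off_eq nb a) ?nb_refl// => [|b /andP[/noL//]].
by have := noL a (nb_refl a) => /negPn/eqP->.
Qed.

End dissociated_recursion.

Section poisson_limit.
Context {R : realType} {J : finType}.
Implicit Types k : {ffun J -> nat}.

(** The factor exp(-lam) is left out: the recursion fixes the weights only up to the value at 0, and
    the total mass supplies the normalisation. *)
Definition poisson_weight (lam : J -> R) k : R :=
  \prod_j (lam j ^+ k j / (k j)`!%:R).

Definition natcube N (k : {ffun J -> 'I_N}) : {ffun J -> nat} := [ffun j => k j : nat].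

Lemma natcube_inj N : injective (@natcube N).
Proof.
by move=> k k' /ffunP kk'; apply/ffunP => j; apply/val_inj; have := kk' j; rewrite !ffunE.
Qed.

Variables (w : nat -> {ffun J -> nat} -> R) (lamn : nat -> J -> R) (lam : J -> R).
Variable err : nat -> R.
Hypothesis w_ge0 : forall n k, 0 <= w n k.
Hypothesis err0 : err @ \oo --> 0.
Hypothesis lamn_cvg : forall j, lamn n j @[n --> \oo] --> lam j.
Hypothesis recursion : forall n k j, (0 < k j)%N ->
  `|(k j)%:R * w n k - lamn n j * w n (decr k j)| <= err n.
Hypothesis mass_le1 : forall n N, \sum_(k : {ffun J -> 'I_N}) w n (natcube k) <= 1.
Hypothesis tail : forall n N,
  1 - (\sum_j lamn n j) / N.+1%:R <= \sum_(k : {ffun J -> 'I_N.+1}) w n (natcube k).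

Let k0 : {ffun J -> nat} := [ffun=> 0%N].

Let w_le1 n k : w n k <= 1.
Proof.
pose N := (\max_j k j).+1.
have kN j : (k j < N)%N by rewrite ltnS leq_bigmax.
pose k' : {ffun J -> 'I_N} := [ffun j => Ordinal (kN j)].
have -> : k = natcube k' by apply/ffunP => j; rewrite !ffunE.
by apply: le_trans (mass_le1 n N); rewrite (bigD1 k')//= lerDl sumr_ge0.
Qed.

(** Induction on the total count: the recursion removes one point at a time, until only the weight
    of the empty configuration is left. *)
Let reduce k : (w n k - poisson_weight lam k * w n k0) @[n --> \oo] --> 0.
Proof.
have [s] := ubnP (\sum_j k j)%N; elim: s k => // s IH k; rewrite ltnS => ks.
have [/existsP[j kj]|/existsPn kj0] := boolP [exists j, (0 < k j)%N]; last first.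
  have -> : k = k0 by apply/ffunP => j; rewrite ffunE; apply/eqP; have := kj0 j; rewrite -eqn0Ngt.
  rewrite [X in X @ _](_ : _ = fun=> 0); first exact: cvg_cst.
  apply/funext => n; rewrite /poisson_weight big1 ?mul1r ?subrr// => j _.
  by rewrite ffunE expr0 fact0 divr1.
have kjR : (k j)%:R != 0 :> R by rewrite pnatr_eq0 -lt0n.
have wk : poisson_weight lam k = lam j / (k j)%:R * poisson_weight lam (decr k j).
  rewrite /poisson_weight (bigD1 j)//= [in RHS](bigD1 j)//= ffunE eqxx subn1 mulrA.
  congr (_ * _); last first.
    by apply: eq_bigr => i ij; rewrite ffunE (negPf ij) subn0.
  case: (k j) kj kjR => // i _ iR.
  by rewrite /= exprS factS natrM invfM; ring.
(* The three terms are the error of the recursion, the error of the rate and the induction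
   hypothesis for [decr k j]. *)
have -> : (fun n => w n k - poisson_weight lam k * w n k0) =
  (fun n => (k j)%:R^-1 * ((k j)%:R * w n k - lamn n j * w n (decr k j)) +
     (k j)%:R^-1 * ((lamn n j - lam j) * w n (decr k j)) +
     lam j / (k j)%:R * (w n (decr k j) - poisson_weight lam (decr k j) * w n k0)).
  by apply/funext => n; rewrite wk; field.
rewrite -[X in _ --> X](_ : (k j)%:R^-1 * 0 + (k j)%:R^-1 * 0 + lam j / (k j)%:R * 0 = 0); last first.
  by rewrite !mulr0 !addr0.
apply: cvgD; [apply: cvgD|]; apply: cvgMl_tmp.
- apply: norm_cvg0; apply: (@squeeze_cvgr _ _ _ _ (cst 0) err) => //.
    by apply: nearW => n; rewrite normr_ge0 recursion.
  exact: cvg_cst.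
- apply: norm_cvg0.
  apply: (@squeeze_cvgr _ _ _ _ (cst 0) (fun n => `|lamn n j - lam j|)).
  + apply: nearW => n; rewrite normr_ge0/= normrM ler_piMr// ger0_norm//.
  + exact: cvg_cst.
  + rewrite -(normr0 R); apply: cvg_norm; rewrite -(subrr (lam j)).
    by apply: cvgB => //; exact: cvg_cst.
- apply: IH; rewrite (leq_trans _ ks)//.
  rewrite (bigD1 j)//= [X in (_ < X)%N](bigD1 j)//= ffunE eqxx subn1.
  rewrite -addSn prednK// leq_add2l; apply: leq_sum => i _.
  by rewrite ffunE leq_subr.
Unshelve. all: by end_near. Qed.

Let partial_exp N := \prod_(j : J) \sum_(i < N) (lam j ^+ i / i`!%:R).

Let partial_expE N :
  partial_exp N = \sum_(k : {ffun J -> 'I_N}) poisson_weight lam (natcube k).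
Proof.
rewrite /partial_exp bigA_distr_bigA/=; apply: eq_bigr => k _.
by apply: eq_bigr => j _; rewrite ffunE.
Qed.

Let partial_exp_cvg : partial_exp N @[N --> \oo] --> \prod_j expR (lam j).
Proof.
apply: cvg_big => [|j _]; first exact: mul_continuous.
rewrite /expR.
have -> : (fun N => \sum_(i < N) (lam j ^+ i / i`!%:R)) = series (exp_coeff (lam j)).
  by apply/funext => N; rewrite /series/= big_mkord.
exact: is_cvg_series_exp_coeff.
Qed.

(** By [reduce] the mass of a cube is close to [partial_exp] times the weight of 0, while [mass_le1]
    and [tail] force it to be close to 1. *)
Let mass0_cvg : w n k0 * \prod_j expR (lam j) @[n --> \oo] --> (1 : R).
Proof.
apply/cvgrPdist_le => /= e e0.
pose E := \prod_j expR (lam j).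
have slam : (\sum_j lamn n j) @[n --> \oo] --> \sum_j lam j.
  by apply: cvg_big => [|j _]; [exact: add_continuous|exact: lamn_cvg].
(* The cube is fixed before [n]. The summand 1 leaves room for replacing the limit rates by the
   rates at [n]. *)
have [N [EN LN]] : exists N, `|E - partial_exp N.+1| <= e / 3 /\
    (\sum_j lam j + 1) / N.+1%:R <= e / 3.
  have e3 : 0 < e / 3 by rewrite divr_gt0.
  have H1 : \forall N \near \oo, `|E - partial_exp N.+1| <= e / 3.
    by move: partial_exp_cvg; rewrite -cvg_shiftS => /cvgrPdist_le; exact.
  have H2 : \forall N \near \oo, (\sum_j lam j + 1) / N.+1%:R <= e / 3.
    have : ((\sum_j lam j + 1) * N.+1%:R^-1) @[N --> \oo] --> (\sum_j lam j + 1) * 0.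
      by apply: cvgMl_tmp; exact: cvg_harmonic.
    rewrite mulr0 => /cvgrPdist_le/(_ _ e3); apply: filterS => N.
    by rewrite sub0r normrN; apply: le_trans; exact: ler_norm.
  by near \oo => N; exists N; split; near: N.
have mass_cvg : (\sum_(k : {ffun J -> 'I_N.+1}) w n (natcube k) -
    partial_exp N.+1 * w n k0) @[n --> \oo] --> 0.
  suff: \sum_(k : {ffun J -> 'I_N.+1})
      (w n (natcube k) - poisson_weight lam (natcube k) * w n k0) @[n --> \oo] -->
      \sum_(k : {ffun J -> 'I_N.+1}) (0 : R).
    rewrite big1//; under eq_fun do rewrite sumrB -mulr_suml -partial_expE; exact.
  by apply: cvg_big => [|k _]; [exact: add_continuous|exact: reduce].
near=> n.
have A : `|\sum_(k : {ffun J -> 'I_N.+1}) w n (natcube k) -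
    partial_exp N.+1 * w n k0| <= e / 3.
  rewrite -normrN -sub0r; near: n.
  by move/cvgrPdist_le : mass_cvg; apply; rewrite divr_gt0.
have B : (\sum_j lamn n j) / N.+1%:R <= e / 3.
  apply: le_trans LN; rewrite ler_wpM2r//; near: n.
  move/cvgrPdist_le : slam => /(_ 1 ltr01); apply: filterS => n.
  by rewrite distrC ler_norml lerBlDl => /andP[].
have C : `|partial_exp N.+1 * w n k0 - E * w n k0| <= e / 3.
  rewrite -mulrBl normrM (ger0_norm (w_ge0 _ _)) distrC (le_trans _ EN)//.
  by rewrite ler_piMr.
have := mass_le1 n N.+1; have := tail n N.
move: A B C; rewrite (mulrC (w n k0)) -/E.
set m := \sum_(k : {ffun _ -> _}) _; set u := partial_exp _ * _; set v := E * _; set l := _ / N.+1%:R.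
by rewrite !ler_norml => /andP[? ?] ? /andP[? ?] ? ?; apply/andP; split; lra.
Unshelve. all: by end_near. Qed.

Lemma poisson_limit k :
  w n k @[n --> \oo] --> \prod_j (expR (- lam j) * lam j ^+ k j / (k j)`!%:R).
Proof.
have -> : \prod_j (expR (- lam j) * lam j ^+ k j / (k j)`!%:R) =
    0 + poisson_weight lam k * (1 * (\prod_j expR (lam j))^-1).
  rewrite add0r mul1r -prodfV mulrC /poisson_weight -big_split/=.
  by apply: eq_bigr => j _; rewrite expRN mulrA.
have E0 : \prod_j expR (lam j) != 0.
  by apply/prodf_neq0 => j _; rewrite gt_eqF ?expR_gt0.
have -> : w ^~ k = fun n => (w n k - poisson_weight lam k * w n k0) +
    poisson_weight lam k * (w n k0 * \prod_j expR (lam j) * (\prod_j expR (lam j))^-1).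
  by apply/funext => n; rewrite mulfK// subrK.
apply: cvgD; first exact: reduce.
by apply: cvgMl_tmp; apply: cvgMr_tmp; exact: mass0_cvg.
Qed.

End poisson_limit.
(** * Tuples of independent samples *)

Section tuple_laws.
Local Open Scope ereal_scope.
Context {R : realType} d (S : measurableType d).

Definition box_set k (A : 'I_k -> set S) : set (k.-tuple S) :=
  [set t | forall i, A i (tnth t i)].

Lemma measurable_box_set k (A : 'I_k -> set S) :
  (forall i, measurable (A i)) -> measurable (box_set A).
Proof.
move=> mA; rewrite [X in measurable X](_ : _ =
    \bigcap_(i in [set: 'I_k]) ((@tnth k S ^~ i) @^-1` A i)).
  apply: fin_bigcap_measurable => // i _.
  by rewrite -[X in measurable X]setTI; exact: measurable_tnth.
by rewrite predeqE => t; split=> [At i _|At i]; exact: At.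
Qed.

(** The defining generators, conditions on one coordinate, are boxes whose other sides are full;
    unlike them, boxes are stable under intersection, as uniqueness of measures requires. *)
Lemma measurable_tuple_box_set k :
  @measurable _ (k.-tuple S) = <<s [set X | exists2 A : 'I_k -> set S,
    (forall i, measurable (A i)) & X = box_set A] >>.
Proof.
rewrite eqEsubset; split; last first.
  by apply: smallest_sub; [exact: sigma_algebra_measurable|move=> _ [A mA ->];
    exact: measurable_box_set].
apply: smallest_sub; first exact: smallest_sigma_algebra.
rewrite -bigcup_seq => X [i _ [B mB <-]]; apply: sub_sigma_algebra.
exists (fun j => if j == i then B else setT) => [j|]; first by case: ifP.
rewrite setTI predeqE => t; split=> [Bt j /=|/(_ i)]; last by rewrite eqxx.
by case: eqP => [->|].
Qed.

(** The push-forwards of [m1] and [m2] are measures on tuples that agree on boxes, a generating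
    family stable under intersection which contains the whole space. *)
Lemma eq_tuple_law d1 d2 (T1 : measurableType d1) (T2 : measurableType d2)
    (m1 : {measure set T1 -> \bar R}) (m2 : {measure set T2 -> \bar R}) k
    (Y1 : T1 -> k.-tuple S) (Y2 : T2 -> k.-tuple S) :
  measurable_fun setT Y1 -> measurable_fun setT Y2 -> m1 setT < +oo ->
  (forall A : 'I_k -> set S, (forall i, measurable (A i)) ->
    m1 (Y1 @^-1` box_set A) = m2 (Y2 @^-1` box_set A)) ->
  forall X, measurable X -> m1 (Y1 @^-1` X) = m2 (Y2 @^-1` X).
Proof.
move=> mY1 mY2 m1oo m12 X mX.
pose n1 : {measure set (k.-tuple S) -> \bar R} :=
  measure_function_pushforward__canonical__measure_function_Measure m1 mY1.
pose n2 : {measure set (k.-tuple S) -> \bar R} :=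
  measure_function_pushforward__canonical__measure_function_Measure m2 mY2.
apply: (measure_unique _ (fun=> setT) (@measurable_tuple_box_set k) _ _ _ n1 n2) => //.
- move=> _ _ [A mA ->] [B mB ->].
  exists (fun i => A i `&` B i) => [i|]; first exact: measurableI.
  by rewrite predeqE => t; split=> [[At Bt] i|ABt]; [split|split=> i; have [] := ABt i].
- move=> _; exists (fun=> setT) => //.
  by rewrite predeqE => t; split.
- by rewrite bigcup_const//; exists 0%N.
- by move=> _ [A mA ->]; exact: m12.
Qed.

(** For a fixed event V, the restriction of [P] to V and the multiple of [P] by P(V) are finite
    measures, so [eq_tuple_law] extends independence of V from boxes to all measurable sets. This is
    done once for [Y] and once for [Z]. *)
Lemma indep_tuples d1 (T : measurableType d1) (P : probability T R) k l
    (Y : T -> k.-tuple S) (Z : T -> l.-tuple S) :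
  measurable_fun setT Y -> measurable_fun setT Z ->
  (forall A B, (forall i, measurable (A i)) -> (forall i, measurable (B i)) ->
    P (Y @^-1` box_set A `&` Z @^-1` box_set B) =
    P (Y @^-1` box_set A) * P (Z @^-1` box_set B)) ->
  forall X X', measurable X -> measurable X' ->
    P (Y @^-1` X `&` Z @^-1` X') = P (Y @^-1` X) * P (Z @^-1` X').
Proof.
move=> mY mZ boxes.
have indep_event (k1 : nat) (U : T -> k1.-tuple S) (V : set T) X :
    measurable_fun setT U -> measurable V -> measurable X ->
    (forall A, (forall i, measurable (A i)) ->
      P (U @^-1` box_set A `&` V) = P (U @^-1` box_set A) * P V) ->
    P (U @^-1` X `&` V) = P (U @^-1` X) * P V.
  move=> mU mV mX UV.
  have PV0 : (0 <= fine (P V))%R by exact: fine_ge0.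
  pose m1 : {measure set T -> \bar R} := mrestr P mV.
  pose m2 : {measure set T -> \bar R} := mscale (NngNum PV0) P.
  have PVE : (fine (P V))%:E = P V by rewrite fineK// fin_num_measure.
  transitivity (m2 (U @^-1` X)); last by rewrite /m2/= /mscale/= PVE muleC.
  apply: (@eq_tuple_law _ _ _ _ m1 m2 _ U U) => //.
    by rewrite /m1/= /mrestr setTI ltey_eq fin_num_measure.
  by move=> A mA; rewrite /m1 /m2/= /mrestr/= /mscale/= PVE muleC UV.
have pre (k1 : nat) (U : T -> k1.-tuple S) X : measurable_fun setT U ->
    measurable X -> measurable (U @^-1` X).
  by move=> mU mX; rewrite -[X in measurable X]setTI; exact: mU.
move=> X X' mX mX'; apply: (indep_event) => //; first exact: pre.
move=> A mA; rewrite setIC [RHS]muleC; apply: (indep_event) => //.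
  by apply: pre => //; exact: measurable_box_set.
by move=> B mB; rewrite setIC [RHS]muleC boxes.
Qed.

End tuple_laws.

(** * Increasing index tuples and their overlaps *)

Section index_sets.
Context {m p : nat}.
Implicit Types a b : inc_index m p.

Definition support_set a : {set 'I_p} := [set i in (val a : seq 'I_p)].

Lemma sorted_inc_index a : sorted (fun i j : 'I_p => (i < j)%N) (val a).
Proof.
case: m a => [|k] a; first by rewrite (tuple0 (val a)).
have x0 : 'I_p := tnth (val a) ord0.
apply/(sortedP x0) => i; rewrite size_tuple => ik.
have ik' := ltnW ik.
rewrite -!(tnth_nth x0 (val a) (Ordinal ik)) -!(tnth_nth x0 (val a) (Ordinal ik')).
by have /forallP/(_ (Ordinal ik'))/forallP/(_ (Ordinal ik))/implyP := valP a; apply => /=.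
Qed.

Lemma ltn_ord_trans : transitive (fun i j : 'I_p => (i < j)%N).
Proof. by move=> j i k; exact: ltn_trans. Qed.

Lemma uniq_inc_index a : uniq (val a).
Proof.
apply: (sorted_uniq ltn_ord_trans _ (sorted_inc_index a)) => i; exact: ltnn.
Qed.

(** A strictly increasing list is determined by its set of entries. *)
Lemma support_set_inj : injective support_set.
Proof.
move=> a b /setP ab; apply/val_inj/val_inj => /=.
apply: (irr_sorted_eq ltn_ord_trans) => [i|||i].
- exact: ltnn.
- exact: sorted_inc_index.
- exact: sorted_inc_index.
- by have := ab i; rewrite !inE.
Qed.

Lemma card_support_set a : #|support_set a| = m.
Proof. by rewrite cardsE (card_uniqP (uniq_inc_index a)) size_tuple. Qed.

Definition common a b := #|support_set a :&: support_set b|.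

Definition share : rel (inc_index m p) := fun a b => (0 < common a b)%N.

Lemma common_refl a : common a a = m.
Proof. by rewrite /common finset.setIid card_support_set. Qed.

Lemma common_le a b : (common a b <= m)%N.
Proof. by rewrite -(card_support_set a) subset_leq_card// finset.subsetIl. Qed.

Lemma common_eq a b : (common a b == m) = (a == b).
Proof.
apply/eqP/eqP => [ab|->]; last exact: common_refl.
apply: support_set_inj; apply/eqP; rewrite eqEcard !card_support_set leqnn andbT.
suff /finset.setIidPl : support_set a :&: support_set b = support_set a by [].
by apply/eqP; rewrite eqEcard finset.subsetIl card_support_set -ab leqnn.
Qed.

(* Listing the union with the common indices in the middle displays both index
   sets as blocks of length [m], as in the joint events of hypothesis (A2). *)
Definition union_seq a b : seq 'I_p :=
  enum (support_set a :\: support_set b) ++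
  enum (support_set a :&: support_set b) ++
  enum (support_set b :\: support_set a).

Lemma size_union_seq a b : size (union_seq a b) = (2 * m - common a b)%N.
Proof.
have ba : #|support_set b :&: support_set a| = common a b by rewrite finset.setIC.
rewrite !size_cat -!cardE !cardsD !card_support_set ba -/(common a b).
by have := common_le a b; lia.
Qed.

Lemma uniq_union_seq a b : uniq (union_seq a b).
Proof.
rewrite !cat_uniq !enum_uniq !andbT/= -!all_predC.
apply/andP; split; apply/allP => i /=; rewrite ?mem_cat !mem_enum !inE;
  by case: (i \in val a); case: (i \in val b).
Qed.

Lemma perm_take_union_seq a b : perm_eq (take m (union_seq a b)) (val a).
Proof.
have sA : size (enum (support_set a :\: support_set b) ++
    enum (support_set a :&: support_set b)) = m.
  rewrite size_cat -!cardE cardsD card_support_set -/(common a b).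
  by rewrite subnK// common_le.
rewrite /union_seq catA -{1}sA take_size_cat//.
apply: uniq_perm; last 1 first.
- by move=> i; rewrite mem_cat !mem_enum !inE; case: (i \in val a); case: (i \in val b).
- by have := uniq_union_seq a b; rewrite /union_seq catA cat_uniq => /andP[].
- exact: uniq_inc_index.
Qed.

Lemma perm_drop_union_seq a b :
  perm_eq (drop (m - common a b) (union_seq a b)) (val b).
Proof.
have sA : size (enum (support_set a :\: support_set b)) = (m - common a b)%N.
  by rewrite -!cardE cardsD card_support_set -/(common a b).
rewrite /union_seq -sA drop_size_cat//.
apply: uniq_perm; last 1 first.
- by move=> i; rewrite mem_cat !mem_enum !inE; case: (i \in val a); case: (i \in val b).
- by have := uniq_union_seq a b; rewrite cat_uniq => /and3P[].
- exact: uniq_inc_index.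
Qed.

(** A pair with [l] common indices is recovered from its union list of length 2m - l: the first [m]
    entries give one index set, the entries from position m - l on give the other. *)
Lemma card_common l : (0 < p)%N ->
  (#|[set ab : inc_index m p * inc_index m p | common ab.1 ab.2 == l]%SET| <= p ^ (2 * m - l))%N.
Proof.
move=> p0; pose i0 := Ordinal p0.
(* The constant tuple is a default for pairs whose union list has another length; no counted pair
   reaches it. *)
pose f (ab : inc_index m p * inc_index m p) : (2 * m - l).-tuple 'I_p :=
  insubd [tuple of nseq _ i0] (union_seq ab.1 ab.2).
rewrite -(card_in_imset (f := f)).
  by rewrite (leq_trans (max_card _))// card_tuple card_ord.
move=> [a b] [a' b']; rewrite !inE/= => /eqP abl /eqP abl' /(congr1 val).
rewrite /f !val_insubd/= !size_union_seq abl abl' !eqxx => U.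
congr pair; apply: support_set_inj; apply/setP => i; rewrite !inE.
- by rewrite -(perm_mem (perm_take_union_seq a b)) U (perm_mem (perm_take_union_seq _ _)).
- rewrite -(perm_mem (perm_drop_union_seq a b)) U abl -abl'.
  by rewrite (perm_mem (perm_drop_union_seq _ _)).
Qed.

End index_sets.

Section iid_tuples.
Local Open Scope ereal_scope.
Context {R : realType} {p : nat} {d} {T : measurableType d} (P : probability T R).
Context {dS} {S : measurableType dS} (x : nat -> T -> S).
Hypothesis mx : forall i, measurable_fun setT (x i).
Hypothesis x_indep : mutually_independent P (fun i : 'I_p => x i).
Hypothesis x_ident : identically_distributed P (fun i : 'I_p => x i).

Definition sample k (s : k.-tuple 'I_p) (om : T) : k.-tuple S :=
  [tuple x (tnth s i) om | i < k].

Lemma measurable_sample k (s : k.-tuple 'I_p) : measurable_fun setT (sample s).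
Proof.
apply/measurable_fun_tnthP => i; rewrite (_ : _ \o _ = x (tnth s i))//.
by apply/funext => om /=; rewrite tnth_mktuple.
Qed.

Lemma sample_box k (s : k.-tuple 'I_p) (A : 'I_k -> set S) : uniq s ->
  (forall i, measurable (A i)) ->
  P (sample s @^-1` box_set A) = \prod_i P (x (tnth s i) @^-1` A i).
Proof.
move=> /tuple_uniqP s_inj mA.
pose J := finset.imset (tnth s) (mem [set: 'I_k]%SET).
(* Independence is stated with one event per sample index, so the sides are moved from positions to
   indices; as [s] has no repetition, at most one position contributes to [B j]. *)
pose B j := \bigcap_(i in [set i | tnth s i = j]) A i.
have mB j : measurable (B j) by apply: fin_bigcap_measurable => //; exact: finite_finset.
transitivity (P (\bigcap_(j in [set` J]) x j @^-1` B j)).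
  congr (P _); rewrite predeqE => om; split => [Aom j _ i /= <-|Bom i].
    by have := Aom i; rewrite tnth_mktuple.
  by rewrite tnth_mktuple; apply: (Bom (tnth s i)) => //=; apply/imsetP; exists i.
rewrite x_indep// big_imset/=; last by move=> i j _ _; exact: s_inj.
apply: eq_big => [i|i _]; first by rewrite !inE.
congr (P (_ @^-1` _)); rewrite predeqE => y; split => [|Ay j /= /s_inj->//].
by apply.
Qed.

(** Carries (A1) and (A2), which are stated for the first samples, over to arbitrary distinct
    indices. *)
Lemma sample_law k (s t : k.-tuple 'I_p) (X : set (k.-tuple S)) :
  uniq s -> uniq t -> measurable X -> P (sample s @^-1` X) = P (sample t @^-1` X).
Proof.
move=> us ut; apply: eq_tuple_law => [| | |A mA].
- exact: measurable_sample.
- exact: measurable_sample.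
- by rewrite ltey_eq fin_num_measure.
- transitivity (\prod_i P (x (tnth s i) @^-1` A i)); first exact: sample_box.
  transitivity (\prod_i P (x (tnth t i) @^-1` A i)); last exact/esym/sample_box.
  by apply: eq_bigr => i _; exact: x_ident.
Qed.

Lemma sample_indep k l (s : k.-tuple 'I_p) (t : l.-tuple 'I_p) X Y :
  uniq (s ++ t) -> measurable X -> measurable Y ->
  P (sample s @^-1` X `&` sample t @^-1` Y) =
  P (sample s @^-1` X) * P (sample t @^-1` Y).
Proof.
move=> ust; apply: indep_tuples => [||A B mA mB].
- exact: measurable_sample.
- exact: measurable_sample.
have /and3P[us _ ut] : [&& uniq s, ~~ has (mem s) t & uniq t] by rewrite -cat_uniq.
(* A pair of boxes is one box over the concatenated tuple, whose probability [sample_box] factors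
   over all coordinates at once. *)
pose C (i : 'I_(k + l)) := match fintype.split i with inl j => A j | inr j => B j end.
have CA i : C (lshift l i) = A i.
  rewrite /C; case: fintype.splitP => [j /= /val_inj->//|j /= ij].
  by have := ltn_ord i; rewrite ij ltnNge leq_addr.
have CB i : C (rshift k i) = B i.
  rewrite /C; case: fintype.splitP => [j /= ij|j /= /addnI/val_inj->//].
  by have := ltn_ord j; rewrite -ij ltnNge leq_addr.
transitivity (P (sample [tuple of s ++ t] @^-1` box_set C)).
  congr (P _); rewrite predeqE => om; split => [[Aom Bom] i|Com].
    rewrite tnth_mktuple; case: (fintype.split_ordP i) => j ->.
      by rewrite CA tnth_lshift; have := Aom j; rewrite tnth_mktuple.
    by rewrite CB tnth_rshift; have := Bom j; rewrite tnth_mktuple.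
  split => i.
    by have := Com (lshift l i); rewrite CA !tnth_mktuple tnth_lshift.
  by have := Com (rshift k i); rewrite CB !tnth_mktuple tnth_rshift.
rewrite !sample_box//; last by move=> i; rewrite /C; case: (fintype.split i).
rewrite big_split_ord/=; congr (_ * _); apply: eq_bigr => i _.
  by rewrite CA tnth_lshift.
by rewrite CB tnth_rshift.
Qed.

End iid_tuples.

(** * Random labellings of the index tuples *)

Section finite_labels.
Context {R : realType} {d} {T : measurableType d} (P : probability T R).

Lemma prob_label (F : finType) (X : T -> F) (E : pred F) :
  (forall L, measurable [set om | X om = L]) ->
  P [set om | E (X om)] = (\sum_(L | E L) P [set om | X om = L])%E.
Proof.
move=> mX; rewrite bigfs ?index_enum_uniq//; last first.
  by move=> i _; rewrite mem_index_enum.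
rewrite -measure_fin_bigcup//.
- by congr (P _); rewrite predeqE => om; split => [EX|[L /= EL ->//]]; exists (X om).
- by move=> L L' _ _ [om [/= <- <-]].
Qed.

Lemma measurable_label (F : finType) (X : T -> F) (E : pred F) :
  (forall L, measurable [set om | X om = L]) -> measurable [set om | E (X om)].
Proof.
move=> mX; rewrite [X in measurable X](_ : _ =
    \bigcup_(L in [set` E]) [set om | X om = L]).
  by apply: fin_bigcup_measurable => // L _; exact: mX.
by rewrite predeqE => om; split => [EX|[L /= EL ->//]]; exists (X om).
Qed.

Lemma measurable_ffun_fiber (K F : finType) (X : T -> {ffun K -> F}) :
  (forall a o, measurable [set om | X om a = o]) ->
  forall L, measurable [set om | X om = L].
Proof.
move=> mX L; rewrite [X in measurable X](_ : _ =
    \bigcap_(a in [set: K]) [set om | X om a = L a]).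
  by apply: fin_bigcap_measurable => // L' _; exact: mX.
rewrite predeqE => om; split => [<- a//|XL]; apply/ffunP => a; exact: XL.
Qed.

End finite_labels.

Section labelled_tuples.
Context {R : realType} {m p : nat}.
Context {dS} {S : measurableType dS} (G : m.-tuple S -> R).
Hypothesis mG : measurable_fun setT G.
Context {J : finType} (lab : inc_index m p -> R -> option J).
Hypothesis mlab : forall t o, measurable [set u | lab t u = o].

Lemma measurable_nth_tuple k (s0 : S) (i : nat) :
  measurable_fun setT (fun z : k.-tuple S => nth s0 z i).
Proof.
have [ik|ki] := ltnP i k.
  rewrite (_ : (fun _ => _) = @tnth k S ^~ (Ordinal ik)); first exact: measurable_tnth.
  by apply/funext => z; rewrite (tnth_nth s0).
rewrite (_ : (fun _ => _) = fun=> s0); first exact: measurable_cst.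
by apply/funext => z; rewrite nth_default// size_tuple.
Qed.

(** The family [f] is arbitrary so that the labelling can also be computed from values rebuilt out
    of a shorter tuple, as [labels_dissociated] does. *)
Definition subtuple_lab (f : 'I_p -> S) : {ffun inc_index m p -> option J} :=
  [ffun t => lab t (G [tuple f (tnth (val t) i) | i < m])].

Lemma measurable_subtuple_lab d (T : measurableType d) (f : T -> 'I_p -> S) L :
  (forall i, measurable_fun setT (f ^~ i)) ->
  measurable [set om | subtuple_lab (f om) = L].
Proof.
move=> mf; apply: measurable_ffun_fiber => t o.
rewrite [X in measurable X](_ : _ =
   (fun om => G [tuple f om (tnth (val t) i) | i < m]) @^-1` [set u | lab t u = o]).
  rewrite -[X in measurable X]setTI; apply: measurableT_comp => //.
  apply/measurable_fun_tnthP => i; rewrite (_ : _ \o _ = f ^~ (tnth (val t) i))//.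
  by apply/funext => om /=; rewrite tnth_mktuple.
by rewrite predeqE => om /=; rewrite ffunE.
Qed.

Context {d} {T : measurableType d} (P : probability T R) (x : nat -> T -> S).
Hypothesis mx : forall i, measurable_fun setT (x i).
Hypothesis x_indep : mutually_independent P (fun i : 'I_p => x i).
Hypothesis x_ident : identically_distributed P (fun i : 'I_p => x i).

Definition labels om := subtuple_lab (fun i => x i om).

Lemma labelsE om t : labels om t = lab t (G (sample x (val t) om)).
Proof. by rewrite ffunE. Qed.

Lemma measurable_labels L : measurable [set om | labels om = L].
Proof. by apply: measurable_subtuple_lab => i; exact: mx. Qed.

Definition labels_law L : R := fine (P [set om | labels om = L]).

Lemma labels_law_ge0 L : 0 <= labels_law L.
Proof. exact: fine_ge0. Qed.

Lemma fpr_labels E : fpr labels_law E = fine (P [set om | E (labels om)]).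
Proof.
apply: EFin_inj; rewrite fineK; last first.
  by rewrite fin_num_measure//; exact: (measurable_label E measurable_labels).
rewrite (prob_label _ _ measurable_labels) -EFin_sum_fine => [|L _]; last first.
  by rewrite fin_num_measure//; exact: measurable_labels.
congr EFin; rewrite /fpr [RHS]big_mkcond; apply: eq_bigr => L _.
by case: (E L); rewrite (mulr1, mulr0).
Qed.

(** Tuples sharing no index with [a] read only the samples outside the support of [a], and these are
    independent of the samples on it. *)
Lemma labels_dissociated a (o : option J) k :
  fpr labels_law (fun L => (L a == o) && (counts_off share a L == k)) =
  fpr labels_law (fun L => L a == o) *
  fpr labels_law (fun L => counts_off share a L == k).
Proof.
rewrite !fpr_labels.
pose s := enum_tuple (~: support_set a)%SET.
(* The default [point] fills the indices in the support of [a]; no tuple entering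
   [counts_off share a] reads them. *)
pose ext (z : #|~: support_set a|.-tuple S) (i : 'I_p) := nth point z (index i s).
pose X := [set y : m.-tuple S | lab a (G y) = o].
pose Y := [set z | counts_off share a (subtuple_lab (ext z)) == k].
have mY : measurable Y.
  apply: (measurable_label (X := fun z => subtuple_lab (ext z))
    (fun L => counts_off share a L == k)) => L.
  by apply: measurable_subtuple_lab => i; exact: measurable_nth_tuple.
have mX : measurable X.
  by rewrite -[X in measurable X]setTI; exact: (mG _ (mlab a o)).
have XE om : (sample x (val a) @^-1` X) om <-> labels om a = o by rewrite labelsE.
have YE om : (sample x s @^-1` Y) om <-> counts_off share a (labels om) == k.
  rewrite /Y/=; set L := subtuple_lab _.
  suff -> : counts_off share a L = counts_off share a (labels om) by [].
  apply/ffunP => j; rewrite !ffunE; apply: eq_bigr => b nab; congr (_ == _).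
  rewrite /L /labels !ffunE; congr (lab _ (G _)); apply: eq_from_tnth => i.
  rewrite !tnth_mktuple /ext.
  have bs : tnth (val b) i \in s.
    rewrite mem_enum !inE; apply: contra nab => bia.
    by apply/card_gt0P; exists (tnth (val b) i); rewrite !inE bia mem_tnth.
  have sl : (index (tnth (val b) i) s < #|~: support_set a|%SET)%N.
    by rewrite -[X in (_ < X)%N](size_tuple s) index_mem.
  rewrite -(tnth_nth point (sample x s om) (Ordinal sl)) tnth_mktuple.
  suff -> : tnth s (Ordinal sl) = tnth (val b) i by [].
  by rewrite (tnth_nth (tnth (val b) i) s)/= nth_index.
have st : uniq (val a ++ s).
  rewrite cat_uniq uniq_inc_index enum_uniq andbT/= -all_predC.
  by apply/allP => i /=; rewrite mem_enum !inE.
have := sample_indep mx x_indep st mX mY.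
have -> : sample x (val a) @^-1` X = [set om | labels om a == o].
  by rewrite predeqE => om; rewrite XE; split => /eqP.
have -> : sample x s @^-1` Y = [set om | counts_off share a (labels om) == k].
  by rewrite predeqE => om; rewrite YE.
move=> PXY; rewrite -fineM; last 2 first.
- by rewrite fin_num_measure//; exact: (measurable_label (fun L : {ffun _ -> _} => L a == o) measurable_labels).
- rewrite fin_num_measure//.
  exact: (measurable_label (fun L : {ffun _ -> _} => counts_off share a L == k) measurable_labels).
rewrite -PXY; congr (fine (P _)).
by rewrite predeqE => om /=; split => [/andP|[-> ->]].
Qed.

End labelled_tuples.
(** * Clumps of overlapping tuples *)

Section counts_mass.
Context {R : realType} {K J : finType} (q : {ffun K -> option J} -> R).
Hypothesis q_ge0 : forall L, 0 <= q L.
Hypothesis q_sum1 : \sum_L q L = 1.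

Lemma counts_mass_le1 N :
  \sum_(k : {ffun J -> 'I_N}) fpr q (fun L => counts L == natcube k) <= 1.
Proof.
rewrite /fpr exchange_big/= -[leRHS]q_sum1; apply: ler_sum => L _.
rewrite -mulr_sumr ler_piMr//.
have [/existsP[k /eqP kL]|/existsPn noL] := boolP [exists k : {ffun J -> 'I_N}, counts L == natcube k].
  rewrite (bigD1 k)//= kL eqxx [X in _ + X]big1 ?addr0// => k' k'k.
  by rewrite (inj_eq (@natcube_inj _ _)) eq_sym (negPf k'k).
by rewrite big1// => k _; rewrite (negPf (noL k)).
Qed.

(** Markov's inequality, labelling by labelling: counts outside the cube have a total of at least N
    + 1, which makes the term on the left nonpositive. *)
Lemma counts_tail N :
  1 - (\sum_j \sum_a fpr q (fun L => L a == Some j)) / N.+1%:R <=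
  \sum_(k : {ffun J -> 'I_N.+1}) fpr q (fun L => counts L == natcube k).
Proof.
have -> : \sum_j \sum_a fpr q (fun L => L a == Some j) =
    \sum_L q L * (\sum_j counts L j)%:R.
  rewrite /fpr; under eq_bigr do rewrite exchange_big/=.
  rewrite exchange_big/=; apply: eq_bigr => L _; rewrite natr_sum mulr_sumr.
  apply: eq_bigr => j _; rewrite ffunE natr_sum mulr_sumr; apply: eq_bigr => a _.
  by [].
rewrite /fpr exchange_big/= -[X in X - _]q_sum1 mulr_suml -sumrB; apply: ler_sum => L _.
rewrite -mulr_sumr -mulrA -[X in X - _]mulr1 -mulrBr ler_wpM2l//.
have [/forallP small|/forallPn[j]] := boolP [forall j, (counts L j < N.+1)%N].
  have /eqP Lk : counts L = natcube [ffun j => Ordinal (small j)].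
    by apply/ffunP => j; rewrite [RHS]ffunE [in RHS]ffunE.
  rewrite (bigD1 [ffun j => Ordinal (small j)])//= Lk (@le_trans _ _ 1)//; last by rewrite lerDl sumr_ge0.
rewrite -leqNgt => Nj; apply: (@le_trans _ _ 0); last by apply: sumr_ge0.
rewrite subr_le0 ler_pdivlMr// mul1r ler_nat (leq_trans Nj)//.
by rewrite (bigD1 j)//= leq_addr.
Qed.

End counts_mass.

Section clump_bounds.
Context {R : realType} {m p : nat} (p0 : (0 < p)%N).
Context {dS} {S : measurableType dS} (G : m.-tuple S -> R).
Hypothesis mG : measurable_fun setT G.
Hypothesis G_sym : forall (s : {perm 'I_m}) (y : m.-tuple S),
  G [tuple tnth y (s l) | l < m] = G y.
Context {J : finType} (lab : inc_index m p -> R -> option J) (thr : R).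
Hypothesis mlab : forall t o, measurable [set u | lab t u = o].
Hypothesis lab_thr : forall t u, lab t u != None -> thr < u.
Context {d} {T : measurableType d} (P : probability T R) (x : nat -> T -> S).
Hypothesis mx : forall i, measurable_fun setT (x i).
Hypothesis x_indep : mutually_independent P (fun i : 'I_p => x i).
Hypothesis x_ident : identically_distributed P (fun i : 'I_p => x i).

Let q := labels_law G lab P x.
Let mlabels := measurable_labels mG mlab mx.

Definition prefix_tuple k (kp : (k <= p)%N) : k.-tuple 'I_p :=
  [tuple widen_ord kp i | i < k].

Lemma uniq_prefix_tuple k (kp : (k <= p)%N) : uniq (prefix_tuple kp).
Proof.
apply/tuple_uniqP => i j; rewrite !tnth_mktuple => /(congr1 val)/= ij.
exact/val_inj.
Qed.

Lemma sample_prefix k (kp : (k <= p)%N) om :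
  sample x (prefix_tuple kp) om = [tuple x i om | i < k].
Proof. by apply: eq_from_tnth => i; rewrite !tnth_mktuple. Qed.

Lemma G_perm (s t : m.-tuple 'I_p) om : perm_eq s t ->
  G (sample x s om) = G (sample x t om).
Proof.
move=> /tuple_permP[u su]; rewrite -[RHS](G_sym u); congr G.
apply: eq_from_tnth => i; rewrite !tnth_mktuple; congr (x _ om).
by rewrite (tnth_nth (tnth t (u i))) su -tnth_nth tnth_mktuple.
Qed.

Lemma inc_index_le (a : inc_index m p) : (m <= p)%N.
Proof. by rewrite -(card_support_set a) (leq_trans (max_card _))// card_ord. Qed.

Lemma labels_marginal a (o : option J) :
  fpr q (fun L => L a == o) =
  fine (P [set om | lab a (G [tuple x i om | i < m]) = o]).
Proof.
rewrite /q (fpr_labels mG mlab P mx); congr fine.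
have mX : measurable [set y | lab a (G y) = o].
  by rewrite -[X in measurable X]setTI; exact: (mG _ (mlab a o)).
have := sample_law mx x_indep x_ident (uniq_inc_index a)
  (uniq_prefix_tuple (inc_index_le a)) mX.
set A := (X in P X = _ -> _); set B := (X in _ = P X -> _).
have -> : A = [set om | labels G lab x om a == o].
  by rewrite /A predeqE => om /=; rewrite labelsE; split => /eqP.
have -> // : B = [set om | lab a (G [tuple x i om | i < m]) = o].
by rewrite /B predeqE => om /=; rewrite sample_prefix.
Qed.

Definition tail_prob := fine (P [set om | thr < G [tuple x i om | i < m]]).

(** Samples are numbered from 0, so the second block is the block from m - l + 1 to 2m - l of
    (A2). *)
Definition clump_prob l := fine (P [set om | thr < G [tuple x i om | i < m] /\
  thr < G [tuple x (m - l + i)%N om | i < m]]).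

Let mGx (f : 'I_m -> nat) : measurable_fun setT (fun om => G [tuple x (f i) om | i < m]).
Proof.
apply: measurableT_comp => //; apply/measurable_fun_tnthP => i.
rewrite (_ : _ \o _ = x (f i))//.
by apply/funext => om /=; rewrite tnth_mktuple.
Qed.

Lemma measurable_exceed (f : 'I_m -> nat) : measurable [set om | thr < G [tuple x (f i) om | i < m]].
Proof.
rewrite [X in measurable X](_ : _ = (fun om => G [tuple x (f i) om | i < m]) @^-1` `]thr, +oo[).
  by rewrite -[X in measurable X]setTI; exact: mGx.
by rewrite predeqE => om /=; rewrite in_itv/= andbT.
Qed.

Let fine_prob_le (A B : set T) : measurable A -> measurable B -> A `<=` B ->
  fine (P A) <= fine (P B).
Proof.
move=> mA mB AB; apply: fine_le; rewrite ?fin_num_measure//.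
by apply: le_measure; rewrite ?inE.
Qed.

Lemma labels_tail_le a : fpr q (fun L => L a != None) <= tail_prob.
Proof.
rewrite /q (fpr_labels mG mlab P mx).
have mX : measurable [set y | thr < G y].
  rewrite [X in measurable X](_ : _ = G @^-1` `]thr, +oo[).
    by rewrite -[X in measurable X]setTI; exact: mG.
  by rewrite predeqE => om /=; rewrite in_itv/= andbT.
rewrite /tail_prob.
have := sample_law mx x_indep x_ident (uniq_inc_index a)
  (uniq_prefix_tuple (inc_index_le a)) mX.
set A := (X in P X = _ -> _); set B := (X in _ = P X -> _).
have -> : B = [set om | thr < G [tuple x i om | i < m]].
  by rewrite /B predeqE => om /=; rewrite sample_prefix.
move=> <-; apply: fine_prob_le.
- exact: (measurable_label (fun L : {ffun _ -> _} => L a != None) mlabels).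
- by rewrite -[X in measurable X]setTI; exact: (measurable_sample mx).
- by move=> om /=; rewrite labelsE => /lab_thr.
Qed.

(** The samples along [union_seq a b] have the law of the first 2m - l samples, l being the overlap,
    and the two index sets become the two blocks of [clump_prob]. The order inside a block is
    immaterial by the symmetry of [G]. *)
Lemma labels_clump_le a b :
  fpr q (fun L => (L a != None) && (L b != None)) <= clump_prob (common a b).
Proof.
rewrite /q (fpr_labels mG mlab P mx) /clump_prob.
set l := common a b; set M := (2 * m - l)%N.
have lm : (l <= m)%N := common_le a b.
pose G1 (y : M.-tuple S) := G [tuple nth point y i | i < m].
pose G2 (y : M.-tuple S) := G [tuple nth point y (m - l + i)%N | i < m].
have mgt (f : 'I_m -> nat) :
    measurable [set y : M.-tuple S | thr < G [tuple nth point y (f i) | i < m]].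
  rewrite [X in measurable X](_ : _ =
      (fun y : M.-tuple S => G [tuple nth point y (f i) | i < m]) @^-1` `]thr, +oo[).
    rewrite -[X in measurable X]setTI.
    have : measurable_fun setT (fun y : M.-tuple S => G [tuple nth point y (f i) | i < m]).
      apply: measurableT_comp => //; apply/measurable_fun_tnthP => i.
      rewrite (_ : _ \o _ = fun y : M.-tuple S => nth point y (f i)).
        exact: measurable_nth_tuple.
      by apply/funext => om /=; rewrite tnth_mktuple.
    exact.
  by rewrite predeqE => om /=; rewrite in_itv/= andbT.
have mX : measurable ([set y | thr < G1 y] `&` [set y | thr < G2 y]).
  by apply: measurableI; exact: mgt.
have sU : size (union_seq a b) == M by rewrite size_union_seq.
pose U : M.-tuple 'I_p := Tuple sU.
have Mp : (M <= p)%N.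
  rewrite -(eqP sU) -(card_uniqP (uniq_union_seq a b)).
  by rewrite (leq_trans (max_card _))// card_ord.
have := sample_law mx x_indep x_ident (uniq_union_seq a b : uniq U)
  (uniq_prefix_tuple Mp) mX.
set A := (X in P X = _ -> _); set B := (X in _ = P X -> _).
have nthS (s : M.-tuple 'I_p) om i (iM : (i < M)%N) :
    nth point (sample x s om) i = x (tnth s (Ordinal iM)) om.
  by rewrite -(tnth_nth point (sample x s om) (Ordinal iM)) tnth_mktuple.
have iM (i : 'I_m) : (i < M)%N.
  by rewrite /M; have := ltn_ord i; lia.
have mliM (i : 'I_m) : (m - l + i < M)%N.
  by rewrite /M; have := ltn_ord i; lia.
have -> : B = [set om | thr < G [tuple x i om | i < m] /\
    thr < G [tuple x (m - l + i)%N om | i < m]].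
  rewrite /B predeqE => om /=.
  have -> : G1 (sample x (prefix_tuple Mp) om) = G [tuple x i om | i < m].
    congr G; apply: eq_from_tnth => i; rewrite !tnth_mktuple.
    by rewrite (nthS _ _ _ (iM i)) tnth_mktuple.
  have -> // : G2 (sample x (prefix_tuple Mp) om) = G [tuple x (m - l + i)%N om | i < m].
  congr G; apply: eq_from_tnth => i; rewrite !tnth_mktuple.
  by rewrite (nthS _ _ _ (mliM i)) tnth_mktuple.
move=> <-; apply: fine_prob_le.
- exact: (measurable_label (fun L : {ffun _ -> _} => (L a != None) && (L b != None)) mlabels).
- by rewrite -[X in measurable X]setTI; exact: (measurable_sample mx).
move=> om /= /andP[]; rewrite !labelsE => /lab_thr aG /lab_thr bG; split.
  rewrite /=; suff -> : G1 (sample x U om) = G (sample x (val a) om) by [].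
  have sA : size (take m (union_seq a b)) == m.
    by rewrite (perm_size (perm_take_union_seq a b)) size_tuple.
  rewrite -(@G_perm (Tuple sA)) ?perm_take_union_seq//.
  congr G; apply: eq_from_tnth => i; rewrite !tnth_mktuple (nthS _ _ _ (iM i)).
  have i0 := tnth U (Ordinal (iM i)).
  by rewrite !(tnth_nth i0)/= nth_take.
rewrite /=; suff -> : G2 (sample x U om) = G (sample x (val b) om) by [].
have sA : size (drop (m - l) (union_seq a b)) == m.
  by rewrite (perm_size (perm_drop_union_seq a b)) size_tuple.
rewrite -(@G_perm (Tuple sA)) ?perm_drop_union_seq//.
congr G; apply: eq_from_tnth => i; rewrite !tnth_mktuple (nthS _ _ _ (mliM i)).
have i0 := tnth U (Ordinal (mliM i)).
by rewrite !(tnth_nth i0)/= nth_drop.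
Qed.

(** Pairs are grouped by the number of common indices, and [card_common] bounds each group. *)
Lemma sum_common (D : pred nat) (F : nat -> R) : (forall l, 0 <= F l) ->
  \sum_(ab : inc_index m p * inc_index m p | D (common ab.1 ab.2)) F (common ab.1 ab.2) <=
  \sum_(l < m.+1 | D l) p%:R ^+ (2 * m - l) * F l.
Proof.
move=> F0.
rewrite (partition_big (fun ab => inord (common ab.1 ab.2) : 'I_m.+1) (fun l => D l))/=; last first.
  by move=> ab; rewrite inordK// ltnS common_le.
apply: ler_sum => l _.
rewrite (eq_bigr (fun=> F l)) => [|ab /andP[_ /eqP<-]]; last first.
  by rewrite inordK// ltnS common_le.
rewrite sumr_const -[leLHS]mulr_natl -natrX ler_wpM2r// ler_nat.
rewrite (leq_trans _ (card_common (m := m) l p0))//; apply: subset_leq_card.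
apply/fintype.subsetP => ab; rewrite !inE => /andP[_ /eqP/(congr1 val)/=].
by rewrite inordK ?ltnS ?common_le// => ->.
Qed.

Lemma labels_recursion (k : {ffun J -> nat}) j : (0 < m)%N -> (0 < k j)%N ->
  `|(k j)%:R * fpr q (fun L => counts L == k) -
    (\sum_a fpr q (fun L => L a == Some j)) * fpr q (fun L => counts L == decr k j)| <=
  \sum_(l < m.+1 | (0 < l < m)%N) p%:R ^+ (2 * m - l) * clump_prob l +
  \sum_(l < m.+1 | (0 < l)%N) p%:R ^+ (2 * m - l) * tail_prob ^+ 2.
Proof.
move=> m0 kj.
have q0 L : 0 <= q L by exact: labels_law_ge0.
have c0 l : 0 <= clump_prob l by exact: fine_ge0.
have t0 : 0 <= tail_prob by exact: fine_ge0.
apply: (le_trans (dissociated_recursion (nb := share) q0 _ _ kj)) => [a|a k'|].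
- by rewrite /share common_refl.
- exact: labels_dissociated.
apply: lerD.
- apply: le_trans (sum_common (fun l => 0 < l < m)%N c0).
  rewrite pair_big_dep/=; apply: (@le_trans _ _ (\sum_(ab | share ab.1 ab.2 && (ab.2 != ab.1)) clump_prob (common ab.1 ab.2))).
    by apply: ler_sum => ab _; exact: labels_clump_le.
  (* Two tuples are distinct exactly when they have fewer than [m] common indices. *)
  rewrite le_eqVlt; apply/orP; left; apply/eqP; apply: eq_bigl => -[a b]/=.
  by rewrite eq_sym -common_eq [(_ < m)%N]ltn_neqAle common_le andbT.
- apply: le_trans (sum_common (fun l => 0 < l)%N (fun=> sqr_ge0 tail_prob)).
  rewrite pair_big_dep/=; apply: ler_sum => ab _.
  by rewrite expr2 ler_pM// ?labels_tail_le// sumr_ge0// => L _; rewrite mulr_ge0.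
Qed.

End clump_bounds.

Lemma card_ord_itv p A B : (B <= p)%N ->
  #|[set k : 'I_p | (A <= k < B)%N]%SET| = (B - A)%N.
Proof.
move=> Bp; rewrite -sum1_card.
rewrite (eq_bigl (fun k : 'I_p => (A <= k < B)%N)); last by move=> k; rewrite inE.
rewrite big_mkcond/= -[in RHS](minn_idPr Bp).
elim: {Bp}p => [|p IH]; first by rewrite big_ord0 min0n.
by rewrite big_ord_recr/= IH; case: ifP; lia.
Qed.

(** * Limits as the sample size tends to infinity *)

Section sample_size_limits.
Context {R : realType} (p : nat -> nat).
Hypothesis p_gt0 : forall n, (0 < p n)%N.
Hypothesis p_cvg : p @ \oo --> \oo.

Let pR_gt0 n : 0 < (p n)%:R :> R. Proof. by rewrite ltr0n. Qed.

Lemma inv_size_cvg0 : ((p n)%:R^-1 : R) @[n --> \oo] --> 0.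
Proof.
have h : ((p n)%:R : R) @[n --> \oo] --> +oo by exact: (@cvg_comp _ _ _ p (fun n => n%:R : R) _ _ _ p_cvg (@cvgr_idn R)).
by apply/gtr0_cvgV0 => //; apply: nearW => n.
Qed.

Lemma size_near k : \forall n \near \oo, (k <= p n)%N.
Proof. exact: (p_cvg (nbhs_infty_ge k)). Qed.

Lemma cvg_dist_inv_size (u : nat -> R) (l C : R) :
  (\forall n \near \oo, `|u n - l| <= C * (p n)%:R^-1) -> u @ \oo --> l.
Proof.
move=> ul; apply/subr_cvg0; apply: norm_cvg0; apply: (@squeeze_cvgr _ _ _ _ (cst 0) (fun n => C * (p n)%:R^-1)).
- by apply: filterS ul => n -> /=; rewrite normr_ge0.
- exact: cvg_cst.
- by rewrite -(mulr0 C); apply: cvgMl_tmp; exact: inv_size_cvg0.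
Qed.

(** Rounding down costs less than 1, hence less than 1 / p after the division. *)
Lemma floor_cvg (c N : nat) : (0 < N)%N ->
  ((c * p n %/ N)%:R / (p n)%:R : R) @[n --> \oo] --> (c%:R / N%:R : R).
Proof.
move=> N0; apply: (cvg_dist_inv_size (C := 1)); apply: nearW => n.
have NR : 0 < N%:R :> R by rewrite ltr0n.
rewrite -[X in `|X| <= _](_ : ((c * p n %/ N)%:R - (c * p n)%:R / N%:R) / (p n)%:R = _); last first.
  by rewrite natrM; field; rewrite !gt_eqF.
rewrite normrM [X in _ * X]gtr0_norm ?invr_gt0// ler_wpM2r ?invr_ge0//.
have e := divn_eq (c * p n) N.
have -> : (c * p n)%:R / N%:R = (c * p n %/ N)%:R + (c * p n %% N)%:R / N%:R :> R.
  by rewrite [in LHS]e natrD natrM; field; rewrite gt_eqF.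
rewrite opprD addrA subrr sub0r normrN ger0_norm ?divr_ge0//.
by rewrite ler_pdivrMr// mul1r ler_nat ltnW// ltn_mod.
Qed.

Lemma binomial_cvg m : ('C(p n, m)%:R / (p n)%:R ^+ m : R) @[n --> \oo] --> (m`!%:R^-1 : R).
Proof.
have mf : m`!%:R != 0 :> R by rewrite pnatr_eq0 -lt0n fact_gt0.
suff : (\prod_(i < m) ((p n - i)%:R / (p n)%:R) * m`!%:R^-1 : R) @[n --> \oo] --> (m`!%:R^-1 : R).
  apply: cvg_trans; apply: near_eq_cvg; apply: nearW => n /=.
  rewrite prodf_div -natr_prod -ffact_prod -bin_ffact prodr_const card_ord natrM.
  by field; rewrite mf expf_neq0// gt_eqF.
rewrite -[X in _ --> X]mul1r; apply: cvgMr_tmp.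
rewrite -[X in _ --> X](@big1_eq _ 1 *%R 'I_m (index_enum 'I_m) predT).
apply: cvg_big => [|i _]; first exact: mul_continuous.
apply: (cvg_dist_inv_size (C := i%:R)); near=> n.
have ip : (i <= p n)%N by near: n; exact: size_near.
rewrite natrB// mulrBl divff ?gt_eqF// addrAC subrr sub0r normrN ger0_norm//.
Unshelve. all: by end_near. Qed.

End sample_size_limits.
(** * Counts on the cells of a grid *)

Section grid.
Context {R : realType} (m : nat) (v w : \bar R) (N : nat).

Definition tick (k : nat) : R := k%:R / N%:R.

(** With this shift the [2 * N * N] value indices sweep the heights from -N to N in steps of 1 /
    N. *)
Definition level (i : nat) : R := tick i - N%:R.

(** A time side runs from tick c to tick c + 1, and its enlargement by one step from c - 1 to c + 2.
    Positivity of c - 1 gives the bound 1 < c, and c_l + 2 < c_l' - 1 gives the gap 3. The last two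
    conditions do the same for the value side between v and w. *)
Definition good_cell (ci : {ffun 'I_m -> 'I_N} * 'I_(2 * N * N)) : bool :=
  [&& [forall l, (1 < ci.1 l)%N],
      [forall l : 'I_m, forall l' : 'I_m, (l < l')%N ==> (ci.1 l + 3 < ci.1 l')%N],
      (v < (level ci.2 - N%:R^-1)%:E)%E & ((level ci.2.+2)%:E < w)%E].

(* The gaps required by [good_cell] make a slight enlargement of each cell
   relatively compact in the state space. *)
Definition cell : finType := {ci | good_cell ci}.

Definition corner (j : cell) (l : 'I_m) : nat := (val j).1 l.

Definition value_index (j : cell) : nat := (val j).2.

Definition in_time_cell (j : cell) (z : 'rV[R]_m) : bool :=
  [forall l, tick (corner j l) < z ord0 l <= tick (corner j l).+1].

Definition in_value_cell (j : cell) (u : R) : bool :=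
  level (value_index j) < u <= level (value_index j).+1.

Definition in_cell (j : cell) (z : 'rV[R]_m) (u : R) : bool :=
  in_time_cell j z && in_value_cell j u.

Lemma tick_le k k' : (k <= k')%N -> tick k <= tick k'.
Proof. by move=> kk'; rewrite /tick ler_wpM2r ?invr_ge0// ler_nat. Qed.

Lemma tick_inj k k' x : tick k < x <= tick k.+1 -> tick k' < x <= tick k'.+1 -> k = k'.
Proof.
move=> /andP[kx xk] /andP[k'x xk'].
have [kk'|kk'|//] := ltngtP k k'.
  by have := le_lt_trans (le_trans xk (tick_le kk')) k'x; rewrite ltxx.
by have := le_lt_trans (le_trans xk' (tick_le kk')) kx; rewrite ltxx.
Qed.

Lemma in_cell_inj j j' z u : in_cell j z u -> in_cell j' z u -> j = j'.
Proof.
move=> /andP[/forallP jz ju] /andP[/forallP j'z j'u].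
apply/val_inj; rewrite [LHS]surjective_pairing [RHS]surjective_pairing.
congr pair; first by apply/ffunP => l; apply/val_inj; exact: tick_inj (jz l) (j'z l).
apply/val_inj; apply: (@tick_inj _ _ (u + N%:R)).
  by move: ju; rewrite /in_value_cell /level ltrBlDr lerBrDr.
by move: j'u; rewrite /in_value_cell /level ltrBlDr lerBrDr.
Qed.

Section cell_facts.
Variable j : cell.

Lemma cell_size_gt0 : (0 < N)%N.
Proof.
have : (0 < 2 * N * N)%N by apply: leq_ltn_trans (ltn_ord (val j).2).
by rewrite !muln_gt0 => /andP[].
Qed.

Lemma level_lt i i' : (i < i')%N -> level i < level i'.
Proof.
move=> ii'; rewrite /level ltrD2r /tick ltr_pM2r ?ltr_nat// invr_gt0 ltr0n.
exact: cell_size_gt0.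
Qed.

Lemma corner_lt l : (corner j l < N)%N.
Proof. exact: ltn_ord. Qed.

Lemma corner_gt1 l : (1 < corner j l)%N.
Proof. by have /and4P[/forallP/(_ l)] := valP j. Qed.

Lemma corner_gap (l l' : 'I_m) : (l < l')%N -> (corner j l + 3 < corner j l')%N.
Proof. by have /and4P[_ /forallP/(_ l)/forallP/(_ l')/implyP] := valP j. Qed.

Lemma level_gt_v : (v < (level (value_index j) - N%:R^-1)%:E)%E.
Proof. by have /and4P[] := valP j. Qed.

Lemma level_lt_w i : (i <= 2)%N -> ((level (value_index j + i))%:E < w)%E.
Proof.
move=> i2; have /and4P[_ _ _] := valP j; apply: le_lt_trans.
by rewrite lee_fin lerD2r tick_le// -addn2 leq_add2l.
Qed.

Lemma level_in i : (i <= 2)%N -> open_itv_set v w (level (value_index j + i)).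
Proof.
move=> i2; apply/andP; split; last exact: level_lt_w.
apply: lt_le_trans level_gt_v _; rewrite lee_fin lerBlDr ler_wpDr ?invr_ge0//.
by rewrite lerD2r tick_le// leq_addr.
Qed.

Lemma measurable_in_value_cell : measurable [set u | in_value_cell j u].
Proof.
rewrite [X in measurable X](_ : _ = `]level (value_index j), level (value_index j).+1]%classic).
  exact: measurable_itv.
by rewrite predeqE => u /=; rewrite in_itv.
Qed.

End cell_facts.

(** There are finitely many cells, so the lowest level among them is a single threshold at which
    (A1) and (A2) control all errors. Without cells any point of (v, w) serves. *)
Lemma cells_above : (v < w)%E -> exists thr, open_itv_set v w thr /\
  forall (j : cell) u, in_value_cell j u -> thr < u.
Proof.
move=> vw; have [/existsP[j0 _]|/existsPn noj] := boolP [exists j : cell, true]; last first.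
  have [x] := open_itv_nonempty vw; rewrite inE => xvw.
  by exists x; split=> // j; have := noj j.
exists (level (value_index [arg min_(j < j0) value_index j])); split.
  by rewrite -[X in level X]addn0; exact: level_in.
move=> j u /andP[+ _]; apply: le_lt_trans; rewrite lerD2r tick_le//.
by case: arg_minnP => // i _; exact.
Qed.

Definition cell_label p (t : inc_index m p) (u : R) : option cell :=
  [pick j | in_cell j (times_row R t) u].

Lemma cell_labelE p (t : inc_index m p) u j :
  (cell_label t u == Some j) = in_cell j (times_row R t) u.
Proof.
rewrite /cell_label; case: pickP => [j' j'tu|noj]; last by rewrite noj.
apply/eqP/idP => [[<-]//|jtu]; congr Some; exact: in_cell_inj j'tu jtu.
Qed.

Lemma measurable_cell_label p (t : inc_index m p) o :
  measurable [set u | cell_label t u = o].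
Proof.
have mS j : measurable [set u | cell_label t u = Some j].
  rewrite [X in measurable X](_ : _ =
      if in_time_cell j (times_row R t) then [set u | in_value_cell j u] else set0).
    by case: ifP => // _; exact: measurable_in_value_cell.
  rewrite predeqE => u /=; case: ifP => jt.
    split=> [/eqP|ju]; first by rewrite cell_labelE => /andP[].
    by apply/eqP; rewrite cell_labelE /in_cell jt.
  by split=> // /eqP; rewrite cell_labelE /in_cell jt.
case: o => [//|].
rewrite [X in measurable X](_ : _ =
    ~` \bigcup_(j in [set: cell]) [set u | cell_label t u = Some j]).
  by apply: measurableC; apply: fin_bigcup_measurable => // j _; exact: finite_finset.
rewrite predeqE => u /=; split => [uN [j _]|]; first by rewrite /= uN.
case E : (cell_label t u) => [j|//].
by case; exists j.
Qed.

(** The time sides of a cell are disjoint and ordered, so any choice of one index in each side is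
    automatically increasing and the count is a product. *)
Lemma card_cell_ticks p (j : cell) : (0 < p)%N ->
  #|[set t : inc_index m p | in_time_cell j (times_row R t)]%SET| =
  \prod_l ((corner j l).+1 * p %/ N - corner j l * p %/ N)%N.
Proof.
move=> p0; have N0 := cell_size_gt0 j.
(* The index [i], numbered from 0, has time (i + 1) / p, which exceeds k / N exactly when floor(k p
   / N) <= i. *)
have tickE (k : nat) (i : 'I_p) (l : 'I_m) (t : inc_index m p) : tnth (val t) l = i ->
    (tick k < times_row R t ord0 l) = (k * p %/ N <= i)%N /\
    (times_row R t ord0 l <= tick k) = (i < k * p %/ N)%N.
  move=> <-; rewrite mxE /tick; set q := tnth _ _.
  rewrite -[(_ <= q)%N]ltnS ltn_divLR// [(q < _)%N]leq_divRL//.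
  have pR : 0 < p%:R :> R by rewrite ltr0n.
  have NR : 0 < N%:R :> R by rewrite ltr0n.
  rewrite ltr_pdivlMr// ler_pdivrMr// mulrAC ltr_pdivrMr// ler_pdivlMr//.
  by rewrite -!natrM ltr_nat ler_nat.
pose F l := [pred i : 'I_p | (corner j l * p %/ N <= i < (corner j l).+1 * p %/ N)%N].
pose f (t : inc_index m p) : {ffun 'I_m -> 'I_p} := [ffun l => tnth (val t) l].
have f_inj : injective f.
  by move=> t t' /ffunP tt'; apply/val_inj/eq_from_tnth => l; have := tt' l; rewrite !ffunE.
rewrite -(card_imset _ f_inj).
have -> : #|finset.imset f (mem [set t | in_time_cell j (times_row R t)]%SET)| =
    #|(family F : {pred {ffun 'I_m -> 'I_p}})|.
  apply: eq_card => h; apply/imsetP/familyP => [[t + -> l]|hF].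
    rewrite inE => /forallP/(_ l); rewrite ffunE !inE.
    by have [<- _] := tickE (corner j l) _ l t erefl; have [_ <-] := tickE (corner j l).+1 _ l t erefl.
  have inc : increasing [tuple h l | l < m].
    apply/forallP => l; apply/forallP => l'; apply/implyP => ll'.
    rewrite !tnth_mktuple; have /andP[_ hl] := hF l; have /andP[hl' _] := hF l'.
    rewrite (leq_trans hl)// (leq_trans _ hl')// leq_div2r// leq_mul2r.
    by have := corner_gap j ll'; lia.
  pose t : inc_index m p := exist _ [tuple h l | l < m] inc.
  have E l : tnth (val t) l = h l by rewrite tnth_mktuple.
  exists t.
    rewrite inE; apply/forallP => l; have := hF l.
    by have [-> _] := tickE (corner j l) _ l _ (E l); have [_ ->] := tickE (corner j l).+1 _ l _ (E l).
  by apply/ffunP => l; rewrite ffunE E.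
rewrite card_family foldrE big_map big_enum/=; apply: eq_bigr => l _.
rewrite -(@card_ord_itv p); last first.
  by rewrite -[leqRHS](mulKn _ N0) leq_div2r// leq_mul2r corner_lt orbT.
by apply: eq_card => i; rewrite !inE.
Qed.

End grid.

(** * Poisson limit of the cell counts *)

Section cell_counts.
#[local] Unset Implicit Arguments.
Context {R : realType} (m : nat) (hm : (1 <= m)%N).
Context (p : nat -> nat) (p_gt0 : forall n, (0 < p n)%N) (p_cvg : p @ \oo --> \oo).
Context (d : nat -> measure_display) (T : forall n, measurableType (d n)).
Context (P : forall n, probability (T n) R).
Context (dS : nat -> measure_display) (S : forall n, measurableType (dS n)).
Context (x : forall n, nat -> T n -> S n).
Hypothesis mx : forall n i, measurable_fun setT (x n i).
Hypothesis x_indep : forall n, mutually_independent (P n) (fun i : 'I_(p n) => x n i).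
Hypothesis x_ident : forall n, identically_distributed (P n) (fun i : 'I_(p n) => x n i).
Context (v w : \bar R) (vw : (v < w)%E).
Context (G : forall n, m.-tuple (S n) -> R).
Hypothesis mG : forall n, measurable_fun setT (G n).
Hypothesis G_sym : forall n (s : {perm 'I_m}) (y : m.-tuple (S n)),
  G n [tuple tnth y (s l) | l < m] = G n y.
Context (mu : R -> R).
Hypothesis A1 : forall t, open_itv_set v w t ->
  'C(p n, m)%:R * tail_prob (G n) t (P n) (x n) @[n --> \oo] --> mu t.
Hypothesis A2 : forall t, open_itv_set v w t -> forall l, (1 <= l <= m - 1)%N ->
  (p n)%:R ^+ (2 * m - l) * clump_prob (G n) t (P n) (x n) l @[n --> \oo] --> (0 : R).
Context (N : nat).
#[local] Set Implicit Arguments.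
Local Notation cell := (cell m v w N).

(** This is the mean measure of the cell, as [eta_cell_box] proves; here it appears as the limit of
    the expected counts. *)
Definition cell_mass (j : cell) : R := m`!%:R * \prod_(l < m) (N%:R^-1 : R) *
  (mu (level N (value_index j)) - mu (level N (value_index j).+1)).

Let pR n : 0 < (p n)%:R :> R. Proof. by rewrite ltr0n. Qed.

(** Since the binomial coefficient is asymptotic to p^m / m!, this restates (A1). It is the origin
    of the factor m! in the mean measure. *)
Let tail_cvg t : open_itv_set v w t ->
  (p n)%:R ^+ m * tail_prob (G n) t (P n) (x n) @[n --> \oo] --> m`!%:R * mu t.
Proof.
move=> tvw.
have mf : m`!%:R != 0 :> R by rewrite pnatr_eq0 -lt0n fact_gt0.
have : ('C(p n, m)%:R / (p n)%:R ^+ m)^-1 * ('C(p n, m)%:R * tail_prob (G n) t (P n) (x n))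
    @[n --> \oo] --> (m`!%:R^-1)^-1 * mu t.
  apply: cvgM; last exact: A1.
  by apply: cvgV; [rewrite invr_eq0|exact: binomial_cvg].
rewrite invrK; apply: cvg_trans; apply: near_eq_cvg; near=> n.
have mp : (m <= p n)%N by near: n; exact: size_near.
have C0 : 'C(p n, m)%:R != 0 :> R by rewrite pnatr_eq0 -lt0n bin_gt0.
by rewrite /= invf_div; field.
Unshelve. all: by end_near. Qed.

Let value_prob n (j : cell) :
  fine (P n [set om | in_value_cell j (G n [tuple x n i om | i < m])]) =
  tail_prob (G n) (level N (value_index j)) (P n) (x n) -
  tail_prob (G n) (level N (value_index j).+1) (P n) (x n).
Proof.
have mgt t : measurable [set om | t < G n [tuple x n i om | i < m]] :=
  measurable_exceed (mG n) t (mx n) (@nat_of_ord m).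
rewrite /tail_prob -fineB; last 2 first.
- by rewrite fin_num_measure//; exact: mgt.
- by rewrite fin_num_measure//; exact: mgt.
congr fine.
have lt_level := level_lt j (ltnSn (value_index j)).
set B := [set om | level N (value_index j).+1 < _].
set A := [set om | level N (value_index j) < _].
have AB : A `&` B = B by rewrite setIidr// => om; exact: lt_trans.
have -> : P n B = P n (A `&` B) by rewrite AB.
have mA : measurable A := mgt _; have mB : measurable B := mgt _.
rewrite -measureD//; last by rewrite ltey_eq fin_num_measure.
  congr (P n _); rewrite predeqE => om /=; split => [/andP[? le]|[lo /negP]].
    by split => //; apply/negP; rewrite -leNgt.
  by rewrite -leNgt => up; apply/andP.
Qed.

Let law n := labels_law (G n) (@cell_label R m v w N (p n)) (P n) (x n).

Arguments law : clear implicits.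

Let mlab n := @measurable_cell_label R m v w N (p n).

Let rate n (j : cell) : R := \sum_a fpr (law n) (fun L => L a == Some j).

(** The number of tuples in the time cell times the common probability of the value cell; a factor
    p^m is moved from the first to the second so that both have limits. *)
Let rateE n j : rate n j =
  \prod_l (((corner j l).+1 * p n %/ N)%:R / (p n)%:R - (corner j l * p n %/ N)%:R / (p n)%:R) *
  ((p n)%:R ^+ m * tail_prob (G n) (level N (value_index j)) (P n) (x n) -
   (p n)%:R ^+ m * tail_prob (G n) (level N (value_index j).+1) (P n) (x n)).
Proof.
rewrite -mulrBr -value_prob mulrA.
have -> : \prod_l (((corner j l).+1 * p n %/ N)%:R / (p n)%:R - (corner j l * p n %/ N)%:R / (p n)%:R) * (p n)%:R ^+ m =
    #|[set t : inc_index m (p n) | in_time_cell j (times_row R t)]%SET|%:R :> R.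
  rewrite card_cell_ticks// natr_prod -[X in _ ^+ X](card_ord m) -prodr_const -big_split/=.
  apply: eq_bigr => l _; rewrite natrB ?leq_div2r ?leq_mul2r ?leqnSn ?orbT//.
  by rewrite -mulrBl mulfVK// gt_eqF.
rewrite -sum1_card natr_sum mulr_suml /rate [RHS]big_mkcond/=; apply: eq_bigr => a _.
rewrite labels_marginal// inE mul1r; case: ifP => aj.
  congr (fine (P n _)); rewrite predeqE => om /=.
  by split => [/eqP|inj]; [|apply/eqP]; rewrite cell_labelE /in_cell aj.
rewrite [X in P n X](_ : _ = set0) ?measure0// predeqE => om /=; split => // /eqP.
by rewrite cell_labelE /in_cell aj.
Qed.

Let rate_cvg j : rate n j @[n --> \oo] --> cell_mass j.
Proof.
under eq_fun do rewrite rateE.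
rewrite /cell_mass [m`!%:R * _]mulrC -mulrA; apply: cvgM.
  apply: cvg_big => [|l _]; first exact: mul_continuous.
  have -> : N%:R^-1 = (corner j l).+1%:R / N%:R - (corner j l)%:R / N%:R :> R.
    by rewrite -mulrBl -addn1 natrD addrAC subrr add0r mul1r.
  by apply: cvgB; apply: floor_cvg => //; exact: cell_size_gt0 j.
rewrite mulrBr; apply: cvgB; apply: tail_cvg.
  by rewrite -[value_index j]addn0; exact: level_in.
by rewrite -addn1; exact: level_in.
Qed.

Lemma cell_counts_cvg (k : {ffun cell -> nat}) :
  fpr (law n) (fun L => counts L == k) @[n --> \oo] -->
  \prod_j (expR (- cell_mass j) * cell_mass j ^+ k j / (k j)`!%:R).
Proof.
have [thr [thr_in thrP]] := cells_above m N vw.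
have law0 n L : 0 <= law n L by exact: labels_law_ge0.
have law1 n : \sum_L law n L = 1.
  transitivity (fpr (law n) predT); first by apply: eq_bigr => L _; rewrite mulr1.
  by rewrite fpr_labels// [X in P n X](_ : _ = setT) ?probability_setT// predeqE.
pose err n := \sum_(l < m.+1 | (0 < l < m)%N) (p n)%:R ^+ (2 * m - l) * clump_prob (G n) thr (P n) (x n) l +
  \sum_(l < m.+1 | (0 < l)%N) (p n)%:R ^+ (2 * m - l) * tail_prob (G n) thr (P n) (x n) ^+ 2.
apply: (@poisson_limit R _ (fun n k => fpr (law n) (fun L => counts L == k)) rate _ err).
- by move=> n k'; apply: sumr_ge0 => L _; rewrite mulr_ge0.
- rewrite /err -[X in _ --> X]addr0; apply: cvgD.
    rewrite -[X in _ --> X](@big1_eq _ 0 +%R 'I_m.+1 (index_enum 'I_m.+1) (fun l => 0 < l < m)%N).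
    apply: cvg_big => [|l lm]; first exact: add_continuous.
    by apply: A2 => //; move: lm; lia.
  rewrite -[X in _ --> X](@big1_eq _ 0 +%R 'I_m.+1 (index_enum 'I_m.+1) (fun l => 0 < l)%N).
  apply: cvg_big => [|l l0]; first exact: add_continuous.
  have lm : (l <= m)%N by rewrite -ltnS.
  (* The square stays bounded by [tail_cvg], and l > 0 leaves a vanishing power of 1 / p. *)
  suff : ((p n)%:R ^+ m * tail_prob (G n) thr (P n) (x n)) ^+ 2 * (p n)%:R^-1 ^+ l @[n --> \oo] -->
      (m`!%:R * mu thr) ^+ 2 * 0.
    rewrite mulr0; apply: cvg_trans; apply: near_eq_cvg; apply: nearW => n.
    rewrite exprMn mulrAC exprVn -exprM mulnC -exprB ?(leq_trans lm) ?leq_pmull//.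
    by rewrite unitfE gt_eqF.
  apply: cvgM; first by rewrite expr2; apply: cvgM; exact: tail_cvg.
  move: l0; case: l {lm} => [[//|l] lm] _.
  rewrite -[X in _ --> X](mul0r (0 ^+ l)); under eq_fun do rewrite exprS.
  apply: cvgM; first exact: inv_size_cvg0.
  elim: l {lm} => [|l IH]; first by rewrite expr0; under eq_fun do rewrite expr0; exact: cvg_cst.
  rewrite exprS; under eq_fun do rewrite exprS.
  by apply: cvgM => //; exact: inv_size_cvg0.
- exact: rate_cvg.
- move=> n k' j kj; apply: labels_recursion => //.
  move=> t u; case E : (cell_label _ _ _ t u) => [j'|//] _.
  by move/eqP : E; rewrite cell_labelE => /andP[_]; exact: thrP.
- by move=> n N'; exact: counts_mass_le1.
- by move=> n N'; exact: counts_tail.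
Qed.

End cell_counts.
(** * Topology of the state space *)

Lemma nbhs_set_type (X : topologicalType) (A : set X) (x : set_type A) (U : set (set_type A)) :
  nbhs x U <-> exists2 V : set X, nbhs (val x) V & (fun y : set_type A => V (val y)) `<=` U.
Proof.
rewrite nbhsE; split=> [[W [] [V oV VW] Wx WU]|[V]].
  exists V; last by move=> y Vy; apply: WU; rewrite -VW/= set_valE.
  by exists V => //; split => //; move: Wx; rewrite -VW/= set_valE.
move=> [W [] oW Wx WV VU]; rewrite nbhsE.
exists (fun y : set_type A => W (val y)); last by move=> y /WV/VU.
by split => //; exists W => //; apply/funext => y /=; rewrite set_valE.
Qed.

Section state_topology.
Context {R : realType} (m : nat) (v w : \bar R) (vw : (v < w)%E).
Local Notation E := (state_space m vw).
Implicit Types y : E.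

Definition coord y (l : 'I_m) : R := val y.1 ord0 l.

Definition height y : R := val y.2.

(** The state space is only declared as a topological space, so uniform estimates use this explicit
    sup-distance; [nbhs_close] ties it to the topology. *)
Definition close (e : R) y y' : Prop :=
  (forall l, `|coord y l - coord y' l| < e) /\ `|height y - height y'| < e.

Lemma coord_gt0 y l : 0 < coord y l.
Proof. by have := valP y.1; rewrite inE => -[/(_ l)/andP[]]. Qed.

Lemma coord_le1 y l : coord y l <= 1.
Proof. by have := valP y.1; rewrite inE => -[/(_ l)/andP[]]. Qed.

Lemma coord_lt y (l l' : 'I_m) : (l < l')%N -> coord y l < coord y l'.
Proof. by have := valP y.1; rewrite inE => -[_]; exact. Qed.

Lemma height_in y : open_itv_set v w (height y).
Proof. by have := valP y.2; rewrite inE. Qed.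

Lemma nbhs_close y (U : set E) :
  nbhs y U <-> exists2 e : R, 0 < e & forall y', close e y y' -> U y'.
Proof.
split=> [[[A B] [/= /nbhs_set_type[A' yA' AA'] /nbhs_set_type[B' yB' BB']] ABU]|[e e0 eU]].
  move: yA' => /nbhs_ballP[e1 /= e10 eA]; move: yB' => /nbhs_ballP[e2 /= e20 eB].
  exists (Num.min e1 e2) => [|[z u] [/= yz yu]]; first by rewrite lt_min e10 e20.
  apply: ABU; split => /=.
    apply: AA'; apply: eA; split=> // i l /=; rewrite ord1 /ball/=.
    by have := yz l; rewrite lt_min => /andP[].
  by apply: BB'; apply: eB; rewrite /ball/=; move: yu; rewrite lt_min => /andP[].
exists ([set z : S1 R m | forall l, `|coord y l - val z ord0 l| < e],
        [set u : open_itv vw | `|height y - val u| < e]) => /=; last first.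
  by move=> [z u] [/= yz yu]; apply: eU.
split; apply/nbhs_set_type.
  exists (ball (val y.1) e); first exact: nbhsx_ballx.
  by move=> z [_ yz] l; exact: yz.
exists (ball (val y.2) e) => //; exact: nbhsx_ballx.
Qed.

Lemma near_close y (e : R) : 0 < e -> \forall y' \near y, close e y y'.
Proof. by move=> e0; apply/nbhs_close; exists e. Qed.

Lemma coord_continuous l : continuous (coord ^~ l).
Proof.
move=> y U /nbhs_ballP[e /= e0 eU]; apply/nbhs_close; exists e => // y' [yy' _].
by apply: eU; exact: yy'.
Qed.

Lemma height_continuous : continuous height.
Proof.
move=> y U /nbhs_ballP[e /= e0 eU]; apply/nbhs_close; exists e => // y' [_ yy'].
by apply: eU; exact: yy'.
Qed.

Definition closed_box (r s : 'I_m -> R) (a b : R) : set E :=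
  [set y | (forall l, r l <= coord y l <= s l) /\ a <= height y <= b].

(** A filter on the box is pushed into the ambient vector space, where a product of segments is
    compact. The cluster point found there lies in the state space: [0 < r l] and [s l < r l'] keep
    the strict inequalities in the limit, and capping the sides at 1 keeps the upper bound. *)
Lemma compact_closed_box r s a b :
  (forall l, 0 < r l) -> (forall l l' : 'I_m, (l < l')%N -> s l < r l') ->
  (v < a%:E)%E -> (b%:E < w)%E -> compact (closed_box r s a b).
Proof.
move=> r0 sr va bw F FF FB.
pose emb y : 'rV[R]_m * R := (val y.1, val y.2).
pose C : set ('rV[R]_m * R) :=
  [set z : 'rV[R]_m | forall l, `[r l, Num.min (s l) 1]%classic (z ord0 l)] `*` `[a, b]%classic.
have cC : compact C.
  apply: compact_setX; last exact: segment_compact.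
  by apply: (@rV_compact R m (fun l => `[r l, Num.min (s l) 1]%classic)) => l; exact: segment_compact.
have FC : (emb @ F) C.
  apply: (@filterS _ F _ (closed_box r s a b)) => // y [yrs yab]; split => //= l.
  by rewrite in_itv/= le_min coord_le1 andbT; exact: yrs.
have [[z u] [[/= zC uC] clz]] := cC _ (fmap_proper_filter emb FF) FC.
have zS : z \in @simplex_set R m.
  rewrite inE; split => [l|l l' ll'].
    have := zC l; rewrite in_itv/= le_min => /and3P[rz _ ->]; rewrite andbT.
    exact: lt_le_trans rz.
  have := zC l; rewrite in_itv/= le_min => /and3P[_ zs _].
  have := zC l'; rewrite in_itv/= => /andP[rz _].
  by apply: le_lt_trans zs _; apply: lt_le_trans rz; exact: sr.
have uS : u \in open_itv_set v w.
  rewrite inE; move: uC; rewrite /= in_itv/= => /andP[au ub]; apply/andP; split.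
    by apply: lt_le_trans va _; rewrite lee_fin.
  by apply: le_lt_trans bw; rewrite lee_fin.
pose y0 : E := (exist _ z zS, exist _ u uS).
exists y0; split.
  split => [l|]; last by move: uC; rewrite /= in_itv.
  by have := zC l; rewrite in_itv/= le_min => /and3P[-> ->].
move=> A U FA /nbhs_close[e e0 eU].
have nC : nbhs ((z, u) : 'rV[R]_m * R) (ball z e `*` ball u e).
  by exists (ball z e, ball u e) => //=; split; exact: nbhsx_ballx.
have [_ [[y Ay <-] [/= zy uy]]] : (emb @` A) `&` (ball z e `*` ball u e) !=set0.
  by apply: clz => //; apply: (@filterS _ F _ A) => // y Ay; exists y.
exists y; split => //; apply: eU; split => [l|]; last exact: uy.
by have [_ /(_ ord0 l)] := zy.
Qed.

End state_topology.

Lemma ex_nat_ceil {R : realType} (t : R) : 0 < t -> exists n : nat, n%:R < t <= n.+1%:R.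
Proof.
move=> t0; have exn : exists n : nat, t <= n%:R.
  by exists (Num.bound t); rewrite ltW// -(gtr0_norm t0) archi_boundP.
case: (ex_minnP exn) => -[|n] tn nmin; first by move: tn; rewrite leNgt t0.
exists n; rewrite tn andbT ltNge; apply/negP => /nmin.
by rewrite ltnn.
Qed.

Lemma near_lt_subr {R : realType} (v : \bar R) (h : R) :
  (v < h%:E)%E -> \forall e \near 0^'+, (v < (h - e)%:E)%E.
Proof.
case: v => [r||]//= vh; last by apply: nearW => e; exact: ltNyr.
near=> e; rewrite lte_fin ltrBrDr addrC -ltrBrDr; near: e.
by apply: nbhs_right_lt; rewrite subr_gt0 -lte_fin.
Unshelve. all: by end_near. Qed.

Lemma near_addr_lt {R : realType} (w : \bar R) (h : R) :
  (h%:E < w)%E -> \forall e \near 0^'+, ((h + e)%:E < w)%E.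
Proof.
case: w => [r||]//= hw; last by apply: nearW => e; exact: ltry.
near=> e; rewrite lte_fin addrC -ltrBrDr; near: e.
by apply: nbhs_right_lt; rewrite subr_gt0 -lte_fin.
Unshelve. all: by end_near. Qed.

Section cell_topology.
Context {R : realType} (m : nat) (v w : \bar R) (vw : (v < w)%E).
Local Notation E := (state_space m vw).
Implicit Types y : E.

(** Distance at least [e] from every missing part of the boundary, and from infinity in the last
    clause. Nothing is asked near coordinates equal to 1, which belong to the space. *)
Definition margin (e : R) y : Prop :=
  [/\ forall l, e < coord y l,
      forall l l' : 'I_m, (l < l')%N -> coord y l + e < coord y l',
      (v < (height y - e)%:E)%E, ((height y + e)%:E < w)%E &
      `|height y| < e^-1].

Lemma near_margin y : \forall e \near 0^'+, margin e y.
Proof.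
have near_lt (c : R) : 0 < c -> \forall e \near 0^'+, e < c by exact: nbhs_right_lt.
have [vh hw] : (v < (height y)%:E)%E /\ ((height y)%:E < w)%E by exact/andP/height_in.
near=> e; have e0 : 0 < e by near: e; exact: nbhs_right_gt.
split.
- by near: e; apply: filter_forall => l; apply: near_lt; exact: coord_gt0.
- near: e; apply: filter_forall => l; apply: filter_forall => l'.
  have [ll'|_] := boolP (l < l')%N; last exact: nearW.
  apply: filterS (near_lt (coord y l' - coord y l) _) => [e ell' _|].
    by rewrite addrC -ltrBrDr.
  by rewrite subr_gt0 coord_lt.
- by near: e; exact: near_lt_subr.
- by near: e; exact: near_addr_lt.
- rewrite (@lt_le_trans _ _ (`|height y| + 1)) ?ltrDl//.
  rewrite -[leLHS]invrK lef_pV2 ?posrE ?invr_gt0 ?ltr_wpDl//.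
  by apply/ltW; near: e; apply: near_lt; rewrite invr_gt0 ltr_wpDl.
Unshelve. all: by end_near. Qed.

(** A gap between two coordinates loses less than two quarters of [e] and has to keep one. The
    height bound is e^-1 + e / 4 <= 4 / e, where [e <= 1] enters. *)
Lemma margin_close e y y' : 0 < e -> e <= 1 -> margin e y -> close (e / 4) y y' ->
  margin (e / 4) y'.
Proof.
move=> e0 e1 [ye yd vy yw yM] [cy hy].
have hy' := hy; move: hy'; rewrite ltr_norml => /andP[hy1 hy2].
have cy' l : - (e / 4) < coord y l - coord y' l < e / 4 by rewrite -ltr_norml.
split.
- by move=> l; have := ye l; have /andP[] := cy' l; lra.
- by move=> l l' ll'; have := yd _ _ ll'; have /andP[] := cy' l; have /andP[] := cy' l'; lra.
- by apply: lt_trans vy _; rewrite lte_fin; lra.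
- by apply: lt_trans yw; rewrite lte_fin; lra.
- have -> : height y' = height y - (height y - height y') by rewrite opprB addrC subrK.
  rewrite (le_lt_trans (ler_normB _ _))// invf_div (@lt_le_trans _ _ (e^-1 + e / 4)) ?ltrD//.
  have ei : 1 <= e^-1 by rewrite invf_ge1.
  by rewrite mulrC; lra.
Qed.

(** Each point has a margin, its neighbours keep a quarter of it, and smaller margins are weaker
    conditions; the near-covering form of compactness makes the margin uniform. *)
Lemma compact_margin (K : set E) : compact K ->
  exists2 e : R, 0 < e & forall y, K y -> margin e y.
Proof.
move=> /compact_near_coveringP cK.
have mono (e e' : R) y : 0 < e' -> e' <= e -> margin e y -> margin e' y.
  move=> e'0 e'e [ye yd vy yw yM]; split.
  - by move=> l; exact: le_lt_trans (ye l).
  - by move=> l l' /yd; apply: le_lt_trans; rewrite lerD2l.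
  - by apply: lt_le_trans vy _; rewrite lee_fin lerD2l lerN2.
  - by apply: le_lt_trans yw; rewrite lee_fin lerD2l.
  - by apply: lt_le_trans yM _; rewrite lef_pV2// posrE (lt_le_trans e'0).
have : \forall e \near 0^'+, K `<=` margin e.
  apply: (cK _ (0^'+ : set_system R) margin) => y Ky.
  have [d [d0 d1 dy]] : exists d : R, [/\ 0 < d, d <= 1 & margin d y].
    near (0 : R)^'+ => d; exists d; split; near: d;
      [exact: nbhs_right_gt|exact: nbhs_right_le|exact: near_margin].
  exists ([set y' | close (d / 4) y y'], [set e | 0 < e <= d / 4]) => /=.
    split; first by apply: near_close; rewrite divr_gt0.
    near=> e; apply/andP; split; near: e; first exact: nbhs_right_gt.
    by apply: nbhs_right_le; rewrite divr_gt0.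
  move=> [y' e]/= [yy' /andP[e0 ed]].
  by apply: mono ed _ => //; exact: margin_close yy'.
move=> Km; near (0 : R)^'+ => e; exists e; near: e => //; exact: nbhs_right_gt.
Unshelve. all: by end_near. Qed.

Section level_cells.
Variable N : nat.
Implicit Type j : cell m v w N.

Definition cell_box j : set E := [set y | in_cell j (val y.1) (height y)].

(** The cell enlarged by one mesh step on each side: compact, so it bounds the counts, and wide
    enough to support continuous approximations of the indicator of the cell. *)
Definition wide_box j : set E :=
  closed_box (fun l => tick N (corner j l).-1) (fun l => tick N (corner j l + 2))
    (level N (value_index j) - N%:R^-1) (level N (value_index j + 2)).

Let tickD k : tick N (k + 1) = tick N k + N%:R^-1 :> R.
Proof. by rewrite /tick natrD mulrDl mul1r. Qed.

Lemma cell_box_trivIset (D : set (cell m v w N)) : trivIset D cell_box.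
Proof. by move=> j j' _ _ [y [/= jy j'y]]; exact: in_cell_inj jy j'y. Qed.

Lemma compact_wide_box j : compact (wide_box j).
Proof.
have NR : 0 < N%:R :> R by rewrite ltr0n; exact: cell_size_gt0 j.
apply: compact_closed_box => [l|l l' ll'||].
- rewrite /tick divr_gt0// ltr0n; have := corner_gt1 j l; lia.
- rewrite /tick ltr_pM2r ?invr_gt0// ltr_nat; have := corner_gap j ll'; lia.
- exact: level_gt_v.
- exact: level_lt_w.
Qed.

Lemma cell_box_close j y y' : cell_box j y -> close N%:R^-1 y y' -> wide_box j y'.
Proof.
move=> /andP[/forallP yj /andP[hj1 hj2]] [cy hy]; split => [l|].
  have /andP[c1 c2] := yj l; have := cy l; rewrite ltr_norml => /andP[d1 d2].
  have E1 : tick N (corner j l) = tick N (corner j l).-1 + N%:R^-1 :> R.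
    by rewrite -tickD addn1 prednK// ltnW// corner_gt1.
  have E2 : tick N (corner j l + 2) = tick N (corner j l).+1 + N%:R^-1 :> R.
    by rewrite -tickD addn1 addn2.
  move: c1 c2; rewrite -/(coord y l) E1 E2 => c1 c2; lra.
have E2 : level N (value_index j + 2) = level N (value_index j).+1 + N%:R^-1 :> R.
  by rewrite /level -[in RHS]addrAC -tickD addn1 addn2.
move: hj2 hy; rewrite -/(height y) E2 ltr_norml => hj2 /andP[d1 d2]; lra.
Qed.

Lemma cell_box_wide j : cell_box j `<=` wide_box j.
Proof.
have NR : 0 < N%:R^-1 :> R by rewrite invr_gt0 ltr0n; exact: cell_size_gt0 j.
move=> y jy; apply: (cell_box_close jy).
by split => [l|]; rewrite subrr normr0.
Qed.

Lemma cell_box_diam j y y' (e : R) : N%:R^-1 < e ->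
  cell_box j y -> cell_box j y' -> close e y y'.
Proof.
move=> Ne /andP[/forallP yj /andP[h1 h2]] /andP[/forallP y'j /andP[h'1 h'2]].
split => [l|].
  have := yj l; have := y'j l; rewrite -/(coord y l) -/(coord y' l) -addn1 tickD.
  move=> /andP[? ?] /andP[? ?]; rewrite ltr_norml; lra.
move: h2 h'2; rewrite /level -addn1 tickD => h2 h'2; move: h1 h'1; rewrite /level => h1 h'1.
rewrite ltr_norml; lra.
Qed.

(** A margin of six mesh steps covers the distances asked by [good_cell] together with the rounding;
    [e^-1 <= N] places the height between -N and N, so that its index is in range. *)
Lemma margin_in_cell (e : R) y : 0 < e -> margin e y -> 6 / N%:R < e -> e^-1 <= N%:R ->
  exists j, cell_box j y.
Proof.
move=> e0 [ye yd vy yw yM] Ne eN.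
have NR : 0 < N%:R :> R by rewrite (lt_le_trans _ eN)// invr_gt0.
have N0 : (0 < N)%N by rewrite -(ltr0n R).
have N6 : 6 < e * N%:R by rewrite -ltr_pdivrMr.
have tt l : 0 < N%:R * coord y l by rewrite mulr_gt0// coord_gt0.
(* Cells are open on the left and closed on the right, so the index is the ceiling minus 1. *)
have [c cP] := choice (fun l => ex_nat_ceil (tt l)).
have cN l : (c l < N)%N.
  rewrite -(ltr_nat R); have /andP[+ _] := cP l; move/lt_le_trans; apply.
  by rewrite ler_piMr// coord_le1.
have t0 : 0 < N%:R * (height y + N%:R).
  by rewrite mulr_gt0//; have := lt_le_trans yM eN; rewrite ltr_norml; lra.
have [i iP] := ex_nat_ceil t0.
have iN : (i < 2 * N * N)%N.
  rewrite -(ltr_nat R) !natrM; have /andP[+ _] := iP; move/lt_trans; apply.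
  rewrite [ltRHS]mulrC ltr_pM2l//.
  by have := lt_le_trans yM eN; rewrite ltr_norml; lra.
have tickE (k : nat) (t : R) : (tick N k < t) = (k%:R < N%:R * t) /\ (t <= tick N k) = (N%:R * t <= k%:R).
  by rewrite /tick ltr_pdivrMr// ler_pdivlMr// mulrC.
pose ci := ([ffun l => Ordinal (cN l)], Ordinal iN) : {ffun 'I_m -> 'I_N} * 'I_(2 * N * N).
have ci_good : good_cell v w ci.
  apply/and4P; split.
  - apply/forallP => l; rewrite ffunE/=.
    have /andP[_] := cP l; have : e * N%:R < N%:R * coord y l by rewrite mulrC ltr_pM2l.
    move=> h1 h2; rewrite -(ltr_nat R); move: h2; rewrite -addn1 natrD; lra.
  - apply/forallP => l; apply/forallP => l'; apply/implyP => ll'; rewrite !ffunE/=.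
    have /andP[c1 _] := cP l; have /andP[_ c2] := cP l'.
    have : N%:R * (coord y l + e) < N%:R * coord y l' by rewrite ltr_pM2l// yd.
    rewrite mulrDr => h; rewrite -(ltr_nat R) natrD; move: c2; rewrite -addn1 natrD.
    by move: N6; rewrite mulrC; lra.
  - apply: lt_trans vy _; rewrite lte_fin /=.
    have : height y + N%:R <= tick N i.+1 by rewrite (tickE _ _).2; have /andP[] := iP.
    rewrite /level -addn1 tickD; move: Ne; rewrite mulrC; lra.
  - apply: le_lt_trans yw; rewrite lee_fin /=.
    have : tick N i < height y + N%:R by rewrite (tickE _ _).1; have /andP[] := iP.
    rewrite /level -addn2 -[2%N]/(1 + 1)%N addnA !tickD; move: Ne; rewrite mulrC; lra.
exists (exist _ ci ci_good); apply/andP; split.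
  apply/forallP => l; rewrite /corner/= ffunE/=.
  by rewrite (tickE _ _).1 (tickE _ _).2; exact: cP.
rewrite /in_value_cell /value_index/= /level ltrBlDr lerBrDr.
by rewrite (tickE _ _).1 (tickE _ _).2.
Qed.

End level_cells.

End cell_topology.
(** * Vague neighbourhoods *)

Section borel_measurability.
Context {R : realType} (E : ptopologicalType).

Lemma open_borel (U : set E) : open U -> measurable (U : set (borel E)).
Proof. exact: sub_sigma_algebra. Qed.

Lemma closed_borel (U : set E) : closed U -> measurable (U : set (borel E)).
Proof.
move=> cU; rewrite -[U]setCK; apply: measurableC; apply: open_borel.
by rewrite openC.
Qed.

Lemma continuous_borel (f : E -> R) : continuous f ->
  measurable_fun setT (f : borel E -> R).
Proof.
move=> cf; apply: (measurability _ (RGenOInfty.measurableE R)) => _ [_ [t ->] <-].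
rewrite setTI; apply: open_borel; apply: open_comp => // x _; exact: cf.
Qed.

Lemma continuous_ge_closed (f : E -> R) (t : R) : continuous f -> closed [set x | t <= f x].
Proof. by move=> cf; apply: (@closed_comp _ _ f [set x | t <= x]) => // x _; exact: cf. Qed.

Lemma continuous_le_closed (f : E -> R) (t : R) : continuous f -> closed [set x | f x <= t].
Proof. by move=> cf; apply: (@closed_comp _ _ f [set x | x <= t]) => // x _; exact: cf. Qed.

Lemma continuous_gt_borel (f : E -> R) (t : R) : continuous f ->
  measurable ([set x | t < f x] : set (borel E)).
Proof.
by move=> cf; apply: open_borel; apply: (@open_comp _ _ f [set x | t < x]) => // x _; exact: cf.
Qed.

Lemma continuous_lt_borel (f : E -> R) (t : R) : continuous f ->
  measurable ([set x | f x < t] : set (borel E)).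
Proof.
by move=> cf; apply: open_borel; apply: (@open_comp _ _ f [set x | x < t]) => // x _; exact: cf.
Qed.

Lemma continuous_le_borel (f : E -> R) (t : R) : continuous f ->
  measurable ([set x | f x <= t] : set (borel E)).
Proof. by move=> cf; apply: closed_borel; exact: continuous_le_closed. Qed.

End borel_measurability.

Section point_measure_values.
Context {R : realType} (E : ptopologicalType).
Implicit Type N : point_measure R E.

(** The value is the number of atoms in [A], with repetition; infinitely many of them would give
    finite subfamilies of arbitrarily large mass. *)
Lemma point_measure_natural N (A : set (borel E)) : measurable A -> (N A < +oo)%E ->
  exists k : nat, N A = k%:R%:E.
Proof.
move=> mA; have [[I [x xE]] _] := pm_axiom N; rewrite xE// => Noo.
pose F := [set i | A (x i)]; pose a i : \bar R := \d_(x i) A.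
rewrite -/a in Noo *.
have a0 i : (0 <= a i)%E by rewrite /a diracE.
have FE (X : {fset I}) : [set` X] `<=` F ->
    (\sum_(i <- X) a i = ((#|` X|)%:R : R)%:E)%E.
  move=> XF; rewrite big_seq (eq_bigr (fun=> 1%:E)) => [|i iX]; last first.
    by rewrite /a diracE mem_set//; exact: XF.
  by rewrite -big_seq sumEFin big_const_seq count_predT iter_addr_0.
have finF : finite_set F.
  apply: contrapT => /(infinite_set_fset) infF.
  have s0 : (0 <= \esum_(i in [set: I]) a i)%E by exact: esum_ge0.
  case Es : (\esum_(i in [set: I]) a i)%E Noo s0 => [s||]//= _ s0.
  have [X XF Xs] := infF (Num.bound s).
  have : (((#|` X|)%:R : R)%:E <= s%:E)%E.
    rewrite -Es -(FE _ XF); apply: esum_ge; exists [set` X] => //.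
    by rewrite fsbig_finite//= set_fsetK.
  rewrite lee_fin => Xle; have := archi_boundP (s0 : 0 <= s).
  by rewrite ltNge (le_trans _ Xle)// ler_nat.
exists (#|` fset_set F|)%fset; rewrite -FE ?fset_setK//.
rewrite (esumID F)// setTI [X in (_ + X)%E]esum1 ?adde0 => [|i [_ nF]]; last first.
  by rewrite /a diracE memNset.
by rewrite esum_fset// fsbig_finite.
Qed.

Lemma vague_eval_continuous (f : @test_function R E) :
  continuous (fun N : point_measure R E => @vague_eval R E N f).
Proof.
move=> N.
have c1 : {for N, continuous (@vague_eval R E : point_measure R E -> {ptws @test_function R E -> R})}.
  exact: initial_continuous.
have c2 : {for @vague_eval R E N, continuous (fun h : {ptws @test_function R E -> R} => h f)}.
  have /cvg_sup/(_ f) cf : nbhs (@vague_eval R E N : {ptws @test_function R E -> R}) -->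
    (@vague_eval R E N : {ptws @test_function R E -> R}) by exact: cvg_id.
  move=> U fU; apply: cf.
  exact: (@initial_continuous _ _ (fun h : @test_function R E -> R => h f)).
exact: (continuous_comp c1 c2).
Qed.

Lemma cvg_initial (S : choiceType) (T : topologicalType) (f : S -> T)
    (F : set_system S) (s : S) : Filter F ->
  f @ F --> f s -> F --> (s : initial_topology f).
Proof.
move=> FF fF U; rewrite nbhsE => -[W [] [V oV VW] Ws WU].
apply: (@filterS _ F _ W) => //; rewrite -VW; apply: fF; apply: open_nbhs_nbhs.
by split => //; move: Ws; rewrite -VW.
Qed.

(** The vague topology is initial for a map into a product, whose topology is a supremum of initial
    ones; [cvg_initial] is used once for each layer. *)
Lemma vague_cvg (F : set_system (point_measure R E)) N : Filter F ->
  (forall f, @vague_eval R E N' f @[N' --> F] --> @vague_eval R E N f) -> F --> N.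
Proof.
move=> FF fF; apply: (@cvg_initial _ _ (@vague_eval R E : _ -> {ptws @test_function R E -> R})).
apply/cvg_sup => f.
apply: (@cvg_initial _ _ (fun h : @test_function R E -> R => h f)).
exact: fF.
Qed.

End point_measure_values.

(** * Continuous approximation of the cell counts *)

Section bump.
Context {R : realType}.

(** This is [t] clamped to [0, 1]; absolute values make its continuity immediate. *)
Definition ramp (t : R) : R := (`|t| - `|t - 1| + 1) / 2.

Lemma ramp0 t : t <= 0 -> ramp t = 0.
Proof. by move=> t0; rewrite /ramp ler0_norm// ler0_norm; lra. Qed.

Lemma ramp1 t : 1 <= t -> ramp t = 1.
Proof. by move=> t1; rewrite /ramp ger0_norm ?ger0_norm; lra. Qed.

Lemma ramp_itv t : 0 <= ramp t <= 1.
Proof.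
have [t0|t0] := leP t 0; first by rewrite ramp0// lexx ler01.
have [t1|t1] := leP 1 t; first by rewrite ramp1// lexx ler01.
by rewrite /ramp gtr0_norm// ltr0_norm; lra.
Qed.

Lemma ramp_continuous : continuous ramp.
Proof.
move=> t; rewrite /ramp; apply: cvgMr_tmp; apply: cvgD; last exact: cvg_cst.
apply: cvgB; apply: cvg_norm; first exact: cvg_id.
by apply: cvgB; [exact: cvg_id|exact: cvg_cst].
Qed.

(* Continuous approximation of the indicator of [a < t <= b], supported in
   [[a, b + s^-1]]. *)
Definition bump (s a b t : R) : R := ramp (s * (t - a)) * (1 - ramp (s * (t - b))).

Lemma bump_itv s a b t : 0 <= bump s a b t <= 1.
Proof.
have /andP[r0 r1] := ramp_itv (s * (t - a)); have /andP[q0 q1] := ramp_itv (s * (t - b)).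
rewrite /bump mulr_ge0 ?subr_ge0//=.
by rewrite mulr_ile1 ?subr_ge0// gerBl.
Qed.

Lemma bump_support s a b t : 0 < s -> bump s a b t != 0 -> a < t < b + s^-1.
Proof.
move=> s0; apply: contraR; rewrite negb_and -!leNgt => /orP[ta|bt].
  by rewrite /bump ramp0 ?mul0r// pmulr_rle0// subr_le0.
rewrite /bump (@ramp1 (s * (t - b))) ?subrr ?mulr0//.
by rewrite mulrC -ler_pdivrMr// div1r lerBrDl.
Qed.

Lemma bump_continuous s a b : continuous (bump s a b).
Proof.
move=> t; apply: cvgM.
  apply: (@continuous_comp _ _ _ (fun t => s * (t - a)) ramp); last exact: ramp_continuous.
  by apply: cvgMl_tmp; apply: cvgB; [exact: cvg_id|exact: cvg_cst].
apply: cvgB; first exact: cvg_cst.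
apply: (@continuous_comp _ _ _ (fun t => s * (t - b)) ramp); last exact: ramp_continuous.
by apply: cvgMl_tmp; apply: cvgB; [exact: cvg_id|exact: cvg_cst].
Qed.

(** For fixed [t] the sequence is eventually constant. As [ramp] vanishes at 0, the point t = a gets
    0 and t = b gets 1, which produces the half-open interval. *)
Lemma bump_cvg (s : nat -> R) a b t : s @ \oo --> +oo ->
  bump (s k) a b t @[k --> \oo] --> ((a < t <= b)%R%:R : R).
Proof.
move=> soo.
have eventually1 c : 0 < c -> \forall k \near \oo, 1 <= s k * c.
  move=> c0; near=> k; rewrite -ler_pdivrMr//; near: k.
  by move/cvgryPge : soo; exact.
have eventually0 c : c <= 0 -> \forall k \near \oo, s k * c <= 0.
  move=> c0; near=> k; rewrite mulr_ge0_le0//; near: k.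
  by move/cvgryPge : soo; exact.
apply: cvg_near_cst.
have [ta|at_] := lerP t a.
  apply: filterS (eventually0 (t - a) _) => [k sk|]; last by rewrite subr_le0.
  by rewrite /bump ramp0 ?mul0r.
have [tb|bt] := lerP t b.
  near=> k; rewrite /bump ramp1 ?ramp0 ?subr0 ?mulr1//; near: k.
    by apply: eventually0; rewrite subr_le0.
  by apply: eventually1; rewrite subr_gt0.
apply: filterS (eventually1 (t - b) _) => [k sk|]; last by rewrite subr_gt0.
by rewrite /bump (@ramp1 (s k * (t - b)))// subrr mulr0.
Unshelve. all: by end_near. Qed.

End bump.

Section cell_measurability.
Context {R : realType} (m : nat) (v w : \bar R) (vw : (v < w)%E) (N : nat).
Local Notation E := (state_space m vw).
Local Notation cell := (cell m v w N).
Implicit Types (j : cell) (y : E) (nu : point_measure R E).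

Lemma measurable_cell_box j : measurable (cell_box (vw := vw) j : set (borel E)).
Proof.
have -> : cell_box (vw := vw) j =
  (\bigcap_(l in [set: 'I_m]) ([set y | tick N (corner j l) < coord y l] `&`
    [set y | coord y l <= tick N (corner j l).+1])) `&`
  ([set y | level N (value_index j) < height y] `&`
    [set y | height y <= level N (value_index j).+1]).
  rewrite predeqE => y; split=> [/andP[/forallP yj /andP[? ?]]|[yj [h1 h2]]].
    by split => // l _; have /andP[? ?] := yj l.
  apply/andP; split; last exact/andP.
  by apply/forallP => l; have [? ?] := yj l I; apply/andP.
have cc l : continuous (fun y : E => coord y l) by exact: coord_continuous.
have ch : continuous (fun y : E => height y) by exact: height_continuous.
apply: measurableI.
  apply: fin_bigcap_measurable => // l _; apply: measurableI.
    exact: continuous_gt_borel.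
  exact: continuous_le_borel.
apply: measurableI; first exact: continuous_gt_borel.
exact: continuous_le_borel.
Qed.

Lemma closed_wide_box j : closed (wide_box (vw := vw) j).
Proof.
rewrite /wide_box/closed_box.
have -> : [set y : E | (forall l, tick N (corner j l).-1 <= coord y l <= tick N (corner j l + 2)) /\
    level N (value_index j) - N%:R^-1 <= height y <= level N (value_index j + 2)] =
  (\bigcap_(l in [set: 'I_m]) ([set y | tick N (corner j l).-1 <= coord y l] `&`
    [set y | coord y l <= tick N (corner j l + 2)])) `&`
  ([set y | level N (value_index j) - N%:R^-1 <= height y] `&`
    [set y | height y <= level N (value_index j + 2)]).
  rewrite predeqE => y; split=> [[yj /andP[? ?]]|[yj [h1 h2]]].
    by split => // l _; have /andP[? ?] := yj l.
  split; last exact/andP.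
  by move=> l; have [? ?] := yj l I; apply/andP.
have cc l : continuous (fun y : E => coord y l) by exact: coord_continuous.
have ch : continuous (fun y : E => height y) by exact: height_continuous.
apply: closedI.
  apply: closed_bigI => l _; apply: closedI.
    exact: continuous_ge_closed.
  exact: continuous_le_closed.
apply: closedI; first exact: continuous_ge_closed.
exact: continuous_le_closed.
Qed.

Lemma point_measure_wide_box nu j : (nu (wide_box j) < +oo)%E.
Proof. by have [_] := pm_axiom nu; apply; exact: compact_wide_box. Qed.

Lemma measurable_wide_box j : measurable (wide_box (vw := vw) j : set (borel E)).
Proof. by apply: closed_borel; exact: closed_wide_box. Qed.

Lemma cell_box_natural nu j : exists k : nat, nu (cell_box j) = k%:R%:E.
Proof.
apply: point_measure_natural; first exact: measurable_cell_box.
apply: le_lt_trans (point_measure_wide_box nu j).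
apply: le_measure; rewrite ?inE; [exact: measurable_cell_box|exact: measurable_wide_box|].
exact: cell_box_wide.
Qed.

(** The slope [N + k] is at least N, so the support overshoots the cell by at most 1 / N and stays
    in [wide_box j]. *)
Definition cell_bump j (k : nat) y : R :=
  (\prod_l bump (N + k)%:R (tick N (corner j l)) (tick N (corner j l).+1) (coord y l)) *
  bump (N + k)%:R (level N (value_index j)) (level N (value_index j).+1) (height y).

Lemma cell_bump_continuous j k : continuous (cell_bump j k).
Proof.
move=> y; apply: cvgM.
  apply: cvg_big => [|l _]; first exact: mul_continuous.
  apply: (@continuous_comp _ _ _ (fun y : E => coord y l)).
    exact: coord_continuous.
  exact: bump_continuous.
apply: (@continuous_comp _ _ _ (fun y : E => height y)).
  exact: height_continuous.
exact: bump_continuous.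
Qed.

Lemma cell_bump_itv j k y : 0 <= cell_bump j k y <= 1.
Proof.
rewrite /cell_bump; set q := \prod_l _.
have q0 : 0 <= q by apply: prodr_ge0 => l _; have /andP[] := bump_itv (N + k)%:R (tick N (corner j l)) (tick N (corner j l).+1) (coord y l).
have q1 : q <= 1 by apply: prodr_ile1 => l _; exact: bump_itv.
have /andP[h0 h1] := bump_itv (N + k)%:R (level N (value_index j)) (level N (value_index j).+1) (height y).
by rewrite mulr_ge0//= mulr_ile1.
Qed.

Lemma cell_bump_ge0 j k y : 0 <= cell_bump j k y.
Proof. by have /andP[] := cell_bump_itv j k y. Qed.

Lemma cell_bump_support j k : [set y | cell_bump j k y != 0] `<=` wide_box j.
Proof.
have N0 : 0 < N%:R :> R by rewrite ltr0n; exact: cell_size_gt0 j.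
have s0 : 0 < (N + k)%:R :> R by rewrite natrD ltr_wpDr.
have sN : (N + k)%:R^-1 <= N%:R^-1 :> R by rewrite lef_pV2// natrD lerDl.
move=> y; rewrite /= /cell_bump mulf_eq0 negb_or => /andP[/prodf_neq0 yj hj].
have tickS i : tick N i.+1 = tick N i + N%:R^-1 :> R.
  by rewrite /tick -addn1 natrD mulrDl mul1r.
split => [l|].
  have /andP[] := bump_support s0 (yj l isT).
  have -> : (corner j l + 2)%N = (corner j l).+2 by rewrite addn2.
  have := tickS (corner j l).-1; rewrite prednK; last first.
    by have := corner_gt1 j l; lia.
  by rewrite !tickS => -> *; apply/andP; lra.
have /andP[] := bump_support s0 hj.
by rewrite /level addn2 !tickS => *; apply/andP; lra.
Qed.

Lemma cell_bump_compact j k : compact (closure [set y | cell_bump j k y != 0]).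
Proof.
apply: (subclosed_compact _ (@compact_wide_box _ _ _ _ vw _ j)).
  exact: closed_closure.
have /closure_id -> := @closed_wide_box j.
by apply: closureS; exact: cell_bump_support.
Qed.

Definition cell_test j k : @test_function R E :=
  TestFunction (@cell_bump_continuous j k) (@cell_bump_ge0 j k) (@cell_bump_compact j k).

Lemma cell_bump_cvg j y :
  cell_bump j k y @[k --> \oo] --> (\1_(cell_box j) y : R).
Proof.
have Noo : ((N + k)%:R : R) @[k --> \oo] --> +oo.
  apply/cvgryPge => A; near=> k; rewrite natrD ler_wpDl//; near: k.
  by have /cvgryPge := @cvgr_idn R; exact.
have -> : \1_(cell_box (vw := vw) j) y =
    (\prod_l (tick N (corner j l) < coord y l <= tick N (corner j l).+1)%R%:R) *
    (level N (value_index j) < height y <= level N (value_index j).+1)%R%:R :> R.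
  rewrite indicE; have -> : (y \in cell_box j) = in_cell j (val y.1) (height y).
    by apply/idP/idP; rewrite inE.
  rewrite /in_cell -mulnb natrM; congr (_ * _).
  rewrite /in_time_cell; case: forallP => [yj|/forallP/forallPn[l /negPf yl]].
    by rewrite big1// => l _; rewrite -/(coord y l) yj.
  by rewrite (bigD1 l)//= -/(coord y l) yl mul0r.
apply: cvgM; last exact: bump_cvg.
by apply: cvg_big => [|l _]; [exact: mul_continuous|exact: bump_cvg].
Unshelve. all: by end_near. Qed.

(** Dominated convergence, with the indicator of [wide_box j] as the integrable bound. Counts of
    half-open cells thus become limits of vaguely continuous functionals, which yields
    [measurable_count]. *)
Lemma cell_test_cvg nu j :
  @vague_eval R E nu (cell_test j k) @[k --> \oo] --> fine (nu (cell_box j)).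
Proof.
have mB := measurable_cell_box j; have mW := measurable_wide_box j.
have [c cE] := cell_box_natural nu j.
have -> : nu (cell_box j) = (\int[nu]_y (\1_(cell_box (vw := vw) j) y)%:E)%E.
  by rewrite integral_indic// setIT.
apply: fine_cvg; rewrite fineK; last by rewrite integral_indic// setIT cE.
apply: (@dominated_cvg _ _ _ nu setT measurableT _ _ (EFin \o \1_(wide_box j))) => //.
- move=> k; apply/measurable_EFinP; apply: continuous_borel; exact: cell_bump_continuous.
- move=> y _; apply: cvg_EFin; last exact: cell_bump_cvg.
  exact: nearW.
- apply/integrableP; split; first exact/measurable_EFinP/measurable_indic.
  rewrite (eq_integral (fun y : borel E => (\1_(wide_box j) y)%:E)) => [|y _]; last first.
    by rewrite /= ger0_norm.
  by rewrite integral_indic// setIT point_measure_wide_box.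
- move=> k y _; rewrite /= lee_fin ger0_norm ?cell_bump_ge0// indicE.
  have [yW|] := boolP (y \in wide_box j); first by have /andP[] := cell_bump_itv j k y.
  move=> /negP yW; rewrite leNgt; apply/negP => /gt_eqF ky.
  by apply: yW; rewrite inE; apply: (@cell_bump_support j k); rewrite /= ky.
Qed.

Lemma measurable_count d (T : measurableType d) (M : T -> point_measure R E) j (c : \bar R) :
  measurable_fun setT (M : T -> borel (point_measure R E)) ->
  measurable [set om | M om (cell_box j) = c].
Proof.
move=> mM.
have mf : measurable_fun setT (fun om => fine (M om (cell_box j))).
  apply: (measurable_fun_cvg (h := fun k om => @vague_eval R E (M om) (cell_test j k))).
    move=> k; apply: (measurableT_comp (f := (@vague_eval R E)^~ (cell_test j k) : borel (point_measure R E) -> R)) => //.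
    by apply: continuous_borel; exact: vague_eval_continuous.
  by move=> om _; exact: cell_test_cvg.
have -> : [set om | M om (cell_box j) = c] = (fun om => fine (M om (cell_box j))) @^-1` [set r | r%:E = c].
  rewrite predeqE => om /=; have [k kE] := cell_box_natural (M om) j.
  by rewrite kE.
rewrite -[X in measurable X]setTI; apply: mf => //.
case: c => [r||]; last 2 first.
- by rewrite (_ : [set _ | _] = set0)// predeqE.
- by rewrite (_ : [set _ | _] = set0)// predeqE.
rewrite (_ : [set _ | _] = [set r])// predeqE => q /=.
by split => [[->]|->].
Qed.

End cell_measurability.

Lemma integral_step {R : realType} d (T : measurableType d) (mu : {measure set T -> \bar R})
    (I : finType) (A : I -> set T) (b : I -> R) :
  (forall i, measurable (A i)) -> (forall i, (mu (A i) < +oo)%E) ->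
  mu.-integrable setT (EFin \o (fun x => \sum_i b i * \1_(A i) x)) /\
  \int[mu]_x (\sum_i b i * \1_(A i) x) = \sum_i b i * fine (mu (A i)).
Proof.
move=> mA Aoo.
have int1 i : mu.-integrable setT (EFin \o \1_(A i)).
  apply/integrableP; split; first exact/measurable_EFinP/measurable_indic.
  rewrite (eq_integral (fun x => (\1_(A i) x)%:E)) => [|x _]; last first.
    by rewrite /= ger0_norm.
  by rewrite integral_indic// setIT.
elim: (index_enum _) => [|i s [IH1 IH2]].
  split; last by under eq_Rintegral do rewrite big_nil; rewrite big_nil Rintegral_cst// mul0r.
  have -> : EFin \o (fun x => \sum_(i <- [::]) b i * \1_(A i) x) = cst 0%E.
    by apply/funext => x /=; rewrite big_nil.
  exact: integrable0.
have intZ : mu.-integrable setT (EFin \o (fun x => b i * \1_(A i) x)).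
  have := integrableZl measurableT (b i) (int1 i); exact: eq_integrable.
split.
  have := integrableD measurableT intZ IH1; apply: eq_integrable => // x _ /=.
  by rewrite big_cons EFinD.
under eq_Rintegral do rewrite big_cons.
rewrite RintegralD// big_cons IH2; congr (_ + _).
rewrite RintegralZl//; congr (_ * fine _).
by rewrite integral_indic// setIT.
Qed.

Section vague_neighbourhoods.
Context {R : realType} (m : nat) (v w : \bar R) (vw : (v < w)%E).
Local Notation E := (state_space m vw).
Implicit Types (nu : point_measure R E) (y : E).

Section step_functions.
Variable N : nat.
Local Notation cell := (cell m v w N).
Implicit Type b : cell -> R.

Definition cell_step b (y : borel E) : R := \sum_j b j * \1_(cell_box (vw := vw) j) y.

Lemma cell_stepE b y j : cell_box j y -> cell_step b y = b j.
Proof.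
move=> jy; rewrite /cell_step (bigD1 j)//= big1 => [|j' j'j].
  by rewrite indicE mem_set// mulr1 addr0.
rewrite indicE memNset ?mulr0// => j'y; move/eqP : j'j; apply.
by apply: in_cell_inj j'y jy.
Qed.

Lemma cell_step_out b y : (forall j : cell, ~ cell_box j y) -> cell_step b y = 0.
Proof.
by move=> yN; rewrite /cell_step big1// => j _; rewrite indicE memNset ?mulr0.
Qed.

Lemma integral_cell_step nu b :
  nu.-integrable setT (EFin \o cell_step b) /\
  \int[nu]_y cell_step b y = \sum_j b j * fine (nu (cell_box j)).
Proof.
apply: integral_step => j; first exact: measurable_cell_box.
by have [k ->] := cell_box_natural nu j; rewrite ltry.
Qed.

End step_functions.

Definition same_counts N nu nu' : Prop :=
  forall j : cell m v w N, nu' (cell_box j) = nu (cell_box j).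

(** Uniform continuity on a compact support. The radius 2 / N leaves slack over the mesh, since
    [cell_box_diam] needs a strict inequality. *)
Lemma test_function_oscillation (f : @test_function R E) (e : R) : 0 < e ->
  \forall N \near \oo, forall y y', closure [set y | tf_fun f y != 0] y ->
    close (2 / N%:R) y y' -> `|tf_fun f y' - tf_fun f y| <= e.
Proof.
move=> e0; have /compact_near_coveringP cK := @tf_compact R E f.
have : \forall N \near \oo, closure [set y | tf_fun f y != 0] `<=`
    (fun y => forall y', close (2 / N%:R) y y' -> `|tf_fun f y' - tf_fun f y| <= e).
  apply: (cK _ \oo (fun N y => forall y', close (2 / N%:R) y y' -> `|tf_fun f y' - tf_fun f y| <= e)) => y Ky.
  have e2 : 0 < e / 2 by rewrite divr_gt0.
  have /cvgrPdist_le/(_ _ e2) := @tf_continuous R E f y; move=> /nbhs_close[d d0 fd].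
  have d2 : 0 < d / 2 by rewrite divr_gt0.
  exists ([set y' | close (d / 2) y y'], [set N | 2 / N%:R <= d / 2]) => /=.
    split; first exact: near_close.
    near=> N; have N0 : 0 < N%:R :> R by rewrite ltr0n; near: N; exact: nbhs_infty_gt.
    rewrite /= ler_pdivrMr// -ler_pdivrMl//; near: N.
    by have /cvgryPge := @cvgr_idn R; exact.
  move=> [y1 N] [/= [c1 h1] N2] y2 [c2 h2] /=.
  have f1 : `|tf_fun f y - tf_fun f y1| <= e / 2.
    by apply: fd; split => [l|]; [apply: lt_le_trans (c1 l) _|apply: lt_le_trans h1 _]; lra.
  have f2 : `|tf_fun f y - tf_fun f y2| <= e / 2.
    apply: fd; split => [l|].
      rewrite -(subrKA (coord y1 l)) (le_lt_trans (ler_normD _ _))//.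
      by have := c1 l; have := c2 l; lra.
    rewrite -(subrKA (height y1)) (le_lt_trans (ler_normD _ _))//; lra.
  rewrite -(subrKA (tf_fun f y)) (le_trans (ler_normD _ _))// distrC.
  by rewrite [leRHS]splitr lerD.
by apply: filterS => N h y y' Ky; exact: h.
Unshelve. all: by end_near. Qed.

(** The test function lies between two functions constant on cells, whose integrals depend on the
    counts alone and differ by little. *)
Lemma vague_eval_same_counts (f : @test_function R E) nu (e : R) : 0 < e ->
  \forall N \near \oo, forall nu', same_counts N nu nu' ->
    `|@vague_eval R E nu f - @vague_eval R E nu' f| <= e.
Proof.
move=> e0; set K := closure [set y | tf_fun f y != 0].
have [d d0 Kd] := compact_margin (@tf_compact R E f : compact K).
have large A : \forall N \near \oo, A <= N%:R :> R.
  by have /cvgryPge := @cvgr_idn R; exact.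
have fine_level : \forall N \near \oo, 6 / N%:R < d /\ d^-1 <= N%:R.
  near=> N; split; last by near: N; exact: large.
  have N0 : 0 < N%:R :> R by rewrite ltr0n; near: N; exact: nbhs_infty_gt.
  rewrite ltr_pdivrMr// mulrC -ltr_pdivrMr// (@lt_le_trans _ _ (6 / d + 1)) ?ltrDl//.
  by near: N; exact: large.
(* A fixed coarse grid: the mass of its wide boxes bounds that of the fine cells meeting the
   support, uniformly in [N], so [eps] can be chosen before [N]. *)
have [N0 [N0d dN0]] : exists N0 : nat, 6 / N0%:R < d /\ d^-1 <= N0%:R.
  by near \oo => N; exists N; near: N.
pose W := \big[setU/set0]_(j : cell m v w N0) wide_box (vw := vw) j.
have mW : measurable (W : set (borel E)).
  by apply: bigsetU_measurable => j _; exact: measurable_wide_box.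
have Woo : (nu W < +oo)%E.
  by have [_] := pm_axiom nu; apply; apply: bigsetU_compact => j _; exact: compact_wide_box.
pose C := fine (nu W).
pose eps := e / (2 * (C + 1)).
have C0 : 0 <= C by exact: fine_ge0.
have eps0 : 0 < eps by rewrite divr_gt0// mulr_gt0// ltr_wpDl.
near=> N => nu' same.
have [Nd dN] : 6 / N%:R < d /\ d^-1 <= N%:R by near: N.
have NN0 : N0%:R < N%:R :> R.
  by rewrite ltr_nat; near: N; exact: nbhs_infty_gt.
have NR0 : 0 < N0%:R :> R by rewrite (lt_le_trans _ dN0)// invr_gt0.
have NR : 0 < N%:R :> R by rewrite (lt_trans _ NN0).
have osc y y' : K y -> close (2 / N%:R) y y' -> `|tf_fun f y' - tf_fun f y| <= eps.
  by move: y y'; near: N; exact: test_function_oscillation.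
pose JK (j : cell m v w N) := `[< exists y, K y /\ cell_box j y >].
pose a (j : cell m v w N) := tf_fun f (xget point [set y | K y /\ cell_box j y]).
have cell_near j y : JK j -> cell_box j y -> `|tf_fun f y - a j| <= eps.
  move=> /asboolP[y0 Ky0] jy.
  have [Kx jx] : [set y | K y /\ cell_box j y] (xget point [set y | K y /\ cell_box j y]).
    by apply: xgetPex; exists y0.
  apply: osc Kx _; apply: cell_box_diam jx jy.
  by rewrite -[ltLHS]mul1r ltr_pM2r ?invr_gt0// ltr1n.
(* On cells that miss the support [K] the test function vanishes, so the value 0 is exact there and
   these cells add nothing to the gap. *)
pose lo := cell_step (fun j => if JK j then a j - eps else 0).
pose hi := cell_step (fun j => if JK j then a j + eps else 0).
have bounds y : lo y <= tf_fun f y <= hi y.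
  have [[j jy]|noj] := pselect (exists j : cell m v w N, cell_box j y).
    rewrite /lo /hi !(cell_stepE _ jy); case: ifP => Jj.
      by have := cell_near j y Jj jy; rewrite ler_norml; lra.
    have [->|fy] := eqVneq (tf_fun f y) 0; first by rewrite lexx.
    move/negP : Jj; case; apply/asboolP; exists y; split => //.
    exact: subset_closure.
  rewrite /lo /hi !cell_step_out => [|j jy|j jy]; [|by apply: noj; exists j..].
  have [->|fy] := eqVneq (tf_fun f y) 0; first by rewrite lexx.
  exfalso; apply: noj; apply: (margin_in_cell d0) => //.
  by apply: Kd; exact: subset_closure.
have mf : measurable_fun setT (EFin \o tf_fun f : borel E -> \bar R).
  by apply/measurable_EFinP; apply: continuous_borel; exact: (@tf_continuous R E f).
have intf nu1 : nu1.-integrable setT (EFin \o tf_fun f : borel E -> \bar R).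
  have [ilo _] := integral_cell_step nu1 (fun j => if JK j then a j - eps else 0).
  have [ihi _] := integral_cell_step nu1 (fun j => if JK j then a j + eps else 0).
  have := integrableD measurableT (integrable_abse ilo) (integrable_abse ihi).
  apply: le_integrable => // y _ /=.
  rewrite lee_fin [leRHS]ger0_norm ?addr_ge0// -/(lo y) -/(hi y).
  have /andP[lf fh] := bounds y; rewrite ler_norml.
  have := ler_norm (hi y); have := ler_norm (- lo y); rewrite normrN.
  have := normr_ge0 (hi y); have := normr_ge0 (lo y); lra.
have cells_mass : \sum_(j | JK j) fine (nu (cell_box j)) <= C.
  rewrite -lee_fin -sumEFin /C fineK ?ge0_fin_numE//.
  rewrite (eq_bigr (fun j => nu (cell_box j))) => [|j _]; last first.
    by have [k ->] := cell_box_natural nu j.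
  rewrite bigfs ?index_enum_uniq//; last by move=> j _; rewrite mem_index_enum.
  rewrite -measure_fin_bigcup//; [|exact: cell_box_trivIset|by move=> j _; exact: measurable_cell_box].
  apply: le_measure; rewrite ?inE//.
    by apply: fin_bigcup_measurable => // j _; exact: measurable_cell_box.
  (* The fine cell of [y] contains a point [y0] of the support, [y0] lies in a coarse cell, and [y]
     is within 1 / N0 of [y0], hence in the wide box of that coarse cell. *)
  move=> y [j /= /asboolP[y0 [Ky0 jy0]] jy].
  have [j0 j0y0] : exists j0 : cell m v w N0, cell_box j0 y0.
    by apply: (margin_in_cell d0) => //; exact: Kd.
  rewrite /W -bigcup_seq; exists j0; first by rewrite /= mem_index_enum.
  apply: (cell_box_close j0y0); apply: cell_box_diam jy0 jy.
  by rewrite ltf_pV2.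
have between nu1 : same_counts N nu nu1 ->
    \sum_(j | JK j) (a j - eps) * fine (nu (cell_box j)) <= \int[nu1]_y tf_fun f y /\
    \int[nu1]_y tf_fun f y <= \sum_(j | JK j) (a j + eps) * fine (nu (cell_box j)).
  move=> same1.
  have [ilo Elo] := integral_cell_step nu1 (fun j => if JK j then a j - eps else 0).
  have [ihi Ehi] := integral_cell_step nu1 (fun j => if JK j then a j + eps else 0).
  have [lof fhi] : \int[nu1]_y lo y <= \int[nu1]_y tf_fun f y /\
      \int[nu1]_y tf_fun f y <= \int[nu1]_y hi y.
    split; apply: le_Rintegral => //; try exact: intf.
      by move=> y _; have /andP[] := bounds y.
    by move=> y _; have /andP[] := bounds y.
  move: lof fhi; rewrite /lo /hi Elo Ehi.
  rewrite ![\sum_(j | JK j) _]big_mkcond.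
  rewrite (eq_bigr (fun j => if JK j then (a j - eps) * fine (nu (cell_box j)) else 0)) => [|j _]; last first.
    by rewrite same1; case: ifP => // _; rewrite mul0r.
  rewrite [X in _ -> _ <= X -> _](eq_bigr (fun j => if JK j then (a j + eps) * fine (nu (cell_box j)) else 0)) => [//|j _].
  by rewrite same1; case: ifP => // _; rewrite mul0r.
have [l1 h1] := between nu (fun=> erefl); have [l2 h2] := between nu' same.
have gap : \sum_(j | JK j) (a j + eps) * fine (nu (cell_box j)) -
    \sum_(j | JK j) (a j - eps) * fine (nu (cell_box j)) <= e.
  rewrite -sumrB (eq_bigr (fun j => 2 * eps * fine (nu (cell_box j)))) => [|j _]; last first.
    by ring.
  rewrite -mulr_sumr (@le_trans _ _ (2 * eps * C))//.
    by rewrite ler_wpM2l// mulr_ge0// ltW.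
  have C1 : 0 < C + 1 by rewrite ltr_wpDl.
  have -> : 2 * eps * C = e * (C / (C + 1)) by rewrite /eps; field; rewrite gt_eqF.
  by rewrite -[leRHS]mulr1 ler_wpM2l ?ltW// ltr_pdivrMr// mul1r ltrDl.
rewrite /vague_eval ler_norml; lra.
Unshelve. all: by end_near. Qed.

(** The sets [U] with this property form a filter, and [vague_cvg] proves its convergence to [nu]
    one test function at a time. *)
Lemma atoms_nbhs nu (U : set (point_measure R E)) : nbhs nu U ->
  \forall N \near \oo, forall nu', same_counts N nu nu' -> U nu'.
Proof.
pose F : set_system (point_measure R E) :=
  [set A | \forall N \near \oo, forall nu', same_counts N nu nu' -> A nu'].
have FF : Filter F.
  split; first exact: nearW.
    move=> A B FA FB; apply: (@filterS2 _ \oo _ _ _ _ _ FA FB) => N NA NB nu' same.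
    by split; [exact: NA|exact: NB].
  by move=> A B AB; apply: (@filterS _ \oo) => N NA nu' /NA/AB.
suff : F --> nu by apply.
apply: vague_cvg => f; apply/cvgrPdist_le => e e0.
exact: vague_eval_same_counts.
Unshelve. all: by end_near. Qed.

End vague_neighbourhoods.

(** * Measurability of the point processes *)

Section sum_dirac_facts.
Context {R : realType} (E : ptopologicalType) (I : finType) (x : I -> E).

Lemma vague_eval_sum_dirac (f : @test_function R E) :
  @vague_eval R E (sum_dirac_pm x) f = \sum_i tf_fun f (x i).
Proof.
pose m_ k : {measure set (borel E) -> \bar R} :=
  \d_(nth point [seq x i | i <- enum I] k : borel E).
have sumE A : sum_dirac x A = msum m_ #|I| A.
  rewrite /sum_dirac /msum (reindex (@enum_val _ (mem I))) /=; last exact/onW_bij/enum_val_bij.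
  apply: eq_bigr => k _; have i0 := enum_val k.
  by rewrite /m_ (nth_map i0) -?cardE // (enum_val_nth i0).
have mf : measurable_fun setT (EFin \o tf_fun f : borel E -> \bar R).
  by apply/measurable_EFinP; apply: continuous_borel; exact: (@tf_continuous R E f).
rewrite /vague_eval /Rintegral.
rewrite (@eq_measure_integral _ _ _ _ (msum m_ #|I|)); last by move=> A _ _; exact: sumE.
rewrite ge0_integral_measure_sum//; last by move=> y _; rewrite lee_fin tf_ge0.
under eq_bigr => k _ do rewrite integral_dirac// diracT mul1e.
rewrite sumEFin/= [RHS](reindex (@enum_val _ (mem I))) /=; last exact/onW_bij/enum_val_bij.
apply: eq_bigr => k _; have i0 := enum_val k.
by rewrite (nth_map i0) -?cardE // (enum_val_nth i0).
Qed.

End sum_dirac_facts.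

Section marked_measurability.
Context {R : realType} (m : nat) (v w : \bar R) (vw : (v < w)%E) (I : finType).
Local Notation E := (state_space m vw).
Variable t : I -> S1 R m.

Definition marked (u : I -> open_itv vw) : point_measure R E :=
  sum_dirac_pm (fun i => (t i, u i) : E).

Lemma marked_continuous u (U : set (point_measure R E)) : nbhs (marked u) U ->
  \forall d \near (0 : R)^'+, forall u', (forall i, `|val (u i) - val (u' i)| < d) -> U (marked u').
Proof.
pose F : set_system (point_measure R E) := [set A | \forall d \near (0 : R)^'+,
  forall u', (forall i, `|val (u i) - val (u' i)| < d) -> A (marked u')].
have FF : Filter F.
  split; first exact: nearW.
    move=> A B FA FB; apply: (@filterS2 _ (0 : R)^'+ _ _ _ _ _ FA FB) => d dA dB u' uu'.
    by split; [exact: dA|exact: dB].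
  by move=> A B AB; apply: (@filterS _ (0 : R)^'+) => d dA u' /dA/AB.
suff : F --> marked u by apply.
apply: vague_cvg => f.
apply/cvgrPdist_le => e e0.
pose e' := e / (#|I|%:R + 1).
have e'0 : 0 < e' by rewrite divr_gt0// ltr_wpDl.
have : \forall d \near (0 : R)^'+, forall i (z : open_itv vw), `|val (u i) - val z| < d ->
    `|tf_fun f ((t i, u i) : E) - tf_fun f ((t i, z) : E)| <= e'.
  apply: filter_forall => i.
  have /cvgrPdist_le/(_ _ e'0)/nbhs_close[d d0 fd] := @tf_continuous R E f (t i, u i).
  near=> d' => z uz; apply: fd; split => [l|].
    by rewrite /coord/= subrr normr0.
  by rewrite /height/= (lt_le_trans uz)//; near: d'; exact: nbhs_right_le.
apply: filterS => d fd u' uu'; rewrite !vague_eval_sum_dirac -sumrB.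
rewrite (le_trans (ler_norm_sum _ _ _))// (@le_trans _ _ (\sum_(i : I) e'))//.
  by apply: ler_sum => i _; exact: fd.
rewrite sumr_const -mulr_natl /e' mulrCA -[leRHS]mulr1 ler_wpM2l ?ltW//.
by rewrite ltr_pdivrMr ?ltr_wpDl// mul1r ltrDl.
Unshelve. all: by end_near. Qed.

(** With the times fixed, [marked] is continuous in finitely many real values, so the preimage of a
    vaguely open set is a countable union over rational boxes of values. *)
Lemma measurable_marked d (T : measurableType d) (u : T -> I -> open_itv vw) :
  (forall i, measurable_fun setT (fun om => val (u om i) : R)) ->
  measurable_fun setT ((fun om => marked (u om)) : T -> borel (point_measure R E)).
Proof.
move=> mu; apply: (@measurability _ _ _ (borel (point_measure R E)) _ _ (@open (point_measure R E))) => // _ [U oU <-]; rewrite setTI.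
pose box (b : {ffun I -> rat * rat}) (z : I -> open_itv vw) :=
  forall i, ratr (b i).1 < val (z i) < ratr (b i).2.
have -> : (fun om => marked (u om)) @^-1` U =
    \bigcup_(b in [set: {ffun I -> rat * rat}])
      [set om | box b (u om) /\ forall z, box b z -> U (marked z)].
  rewrite predeqE => om; split=> [Uom|[b _ [bom]]]; last exact.
  have : nbhs (marked (u om)) U by apply: open_nbhs_nbhs.
  move=> /marked_continuous nU; near (0 : R)^'+ => r.
  have r0 : 0 < r by near: r; exact: nbhs_right_gt.
  have lr i : exists q : rat * rat, [/\ val (u om i) - r / 2 < ratr q.1 < val (u om i) &
      val (u om i) < ratr q.2 < val (u om i) + r / 2].
    have [q1] := @rat_in_itvoo R (val (u om i) - r / 2) (val (u om i)) ltac:(lra).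
    have [q2] := @rat_in_itvoo R (val (u om i)) (val (u om i) + r / 2) ltac:(lra).
    by rewrite !in_itv/= => h2 h1; exists (q1, q2).
  have [q qP] := choice lr.
  exists [ffun i => q i] => //; split => [i|z bz].
    by rewrite ffunE; have [/andP[_ ->] /andP[->]] := qP i.
  have : forall z, (forall i, `|val (u om i) - val (z i)| < r) -> U (marked z).
    by near: r.
  apply => i; have := bz i; rewrite ffunE ltr_norml.
  by have [/andP[? ?] /andP[? ?]] := qP i => /andP[? ?]; apply/andP; split; lra.
apply: countable_bigcupT_measurable => [|b]; first exact: countableP.
have [bU|nbU] := pselect (forall z, box b z -> U (marked z)); last first.
  by rewrite (_ : [set _ | _] = set0)// predeqE => om; split => // -[].
rewrite [X in measurable X](_ : _ = \bigcap_(i in [set: I])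
    ((fun om => val (u om i)) @^-1` `]ratr (b i).1, ratr (b i).2[%classic)).
  apply: fin_bigcap_measurable => // i _; rewrite -[X in measurable X]setTI.
  by apply: mu => //; exact: measurable_itv.
rewrite predeqE => om; split => [[bom _] i _ /=|bom]; first by rewrite in_itv/=; exact: bom.
by split => // i; have := bom i Logic.I; rewrite /= in_itv.
Unshelve. all: by end_near. Qed.

End marked_measurability.
(** * Mean measure of a cell *)

Section nonatomic.
Context {R : realType} (v w : \bar R) (mu : R -> R) (mu_measure : {measure set R -> \bar R}).
Hypothesis mu_measureE : forall a b : R, (v < a%:E)%E -> a < b -> (b%:E < w)%E ->
  mu_measure `]a, b[%classic = (mu a - mu b)%:E.

(** Cutting the open interval from [a] to [c] at [b] determines the half-open piece by subtraction.
    Compared with the open interval from [a] to [b], it shows that [b] is no atom. *)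
Lemma mu_measure_oc (a b c : R) : (v < a%:E)%E -> a < b -> b < c -> (c%:E < w)%E ->
  mu_measure `]a, b]%classic = (mu a - mu b)%:E.
Proof.
move=> va ab bc cw.
have bw : (b%:E < w)%E by apply: lt_trans cw; rewrite lte_fin.
have vb : (v < b%:E)%E by apply: lt_trans va _; rewrite lte_fin.
have ac := lt_trans ab bc.
have E1 : mu_measure `]a, c[%classic = (mu_measure `]a, b]%classic + mu_measure `]b, c[%classic)%E.
  rewrite -measureU//.
    by congr (mu_measure _); rewrite predeqE => x; rewrite /= !in_itv/=; split=> [|[]]; [|lra..];
      have [xb|bx] := leP x b; [left|right]; lra.
  by rewrite predeqE => x; split => //; rewrite /= !in_itv/= => -[]; lra.
move: E1; rewrite !mu_measureE//.
have : (0 <= mu_measure `]a, b]%classic)%E by [].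
case: (mu_measure `]a, b]%classic) => [r||]// _ [E1].
by congr EFin; lra.
Qed.

End nonatomic.

Section cell_intensity.
Context {R : realType} (m : nat) (v w : \bar R) (vw : (v < w)%E) (mu : R -> R).
Context (mu_measure : {measure set R -> \bar R}).
Hypothesis mu_measureE : forall a b : R, (v < a%:E)%E -> a < b -> (b%:E < w)%E ->
  mu_measure `]a, b[%classic = (mu a - mu b)%:E.
Context (eta : {measure set (borel (state_space m vw)) -> \bar R}).
Hypothesis eta_mean : is_mean_measure mu_measure eta.
Context (N : nat) (j : cell m v w N).
Local Notation E := (state_space m vw).

Let a := level N (value_index j) : R.
Let b := level N (value_index j).+1 : R.
Let NR : 0 < N%:R :> R. Proof. by rewrite ltr0n; exact: cell_size_gt0 j. Qed.
(** The shift to [k.+2] keeps this strictly below one mesh step already at k = 0, so the enlarged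
    sides stay ordered and below w. *)
Let shrink k : R := N%:R^-1 * k.+2%:R^-1.
(** The cap at 1 keeps the open rectangle inside the simplex, at the price of losing the points of
    [face]. *)
Let upper k l : R := Num.min (tick N (corner j l).+1 + shrink k) 1.
Let rect k : set E := [set y : E | (forall l, tick N (corner j l) < val y.1 ord0 l < upper k l) /\
  a < val y.2 < b + shrink k].
Let face : set E := [set y : E | exists l, val y.1 ord0 l = 1].

Let shrink_gt0 k : 0 < shrink k.
Proof. by rewrite mulr_gt0 ?invr_gt0. Qed.

Let shrink_le k : shrink k < N%:R^-1.
Proof. by rewrite /shrink gtr_pMr ?invr_gt0// invf_lt1// ltr1n. Qed.

Let shrink_cvg : shrink k @[k --> \oo] --> 0.
Proof.
rewrite -[X in _ --> X](mulr0 N%:R^-1); apply: cvgMl_tmp.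
have := @cvg_harmonic R; rewrite -cvg_shiftS; exact.
Qed.

Let le_shrink (c x : R) : (forall k, x < c + shrink k) -> x <= c.
Proof.
move=> xc; rewrite leNgt; apply/negP => cx.
have : \forall k \near \oo, shrink k < x - c.
  by move/cvgr_lt : shrink_cvg; apply; rewrite subr_gt0.
move=> [k _ /(_ k (leqnn k))/= kx]; have := xc k; lra.
Qed.

Let tickS k : tick N k.+1 = tick N k + N%:R^-1 :> R.
Proof. by rewrite /tick -addn1 natrD mulrDl mul1r. Qed.

Let bE : b = a + N%:R^-1. Proof. by rewrite /b /a /level tickS addrAC. Qed.

Let cE : level N (value_index j + 2) = b + N%:R^-1 :> R.
Proof. by rewrite /b /level addn2 tickS addrAC. Qed.

Let va : (v < a%:E)%E.
Proof.
apply: lt_trans (@level_gt_v _ _ _ _ _ j) _.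
by rewrite lte_fin ltrBlDr ltrDl invr_gt0.
Qed.

Let bkw k : ((b + shrink k)%:E < w)%E.
Proof.
apply: lt_trans (@level_lt_w _ _ _ _ _ j 2 isT); rewrite lte_fin cE ltrD2l; exact: shrink_le.
Qed.

Let tick_le1 l : tick N (corner j l).+1 <= 1 :> R.
Proof. by rewrite /tick ler_pdivrMr// mul1r ler_nat; exact: corner_lt. Qed.

Let tick_lt1 l : tick N (corner j l) < 1 :> R.
Proof. by rewrite /tick ltr_pdivrMr// mul1r ltr_nat; exact: corner_lt. Qed.

Let eta_rect k : eta (rect k) =
  ((m`!%:R * \prod_(l < m) (upper k l - tick N (corner j l)))%:E *
   mu_measure `]a, (b + shrink k)%R[%classic)%E.
Proof.
have [etaE _] := eta_mean.
pose r : 'rV[R]_m := \row_l tick N (corner j l); pose s : 'rV[R]_m := \row_l upper k l.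
have ab : a < b + shrink k by rewrite bE -addrA ltrDl addr_gt0// invr_gt0.
have := etaE r s a (b + shrink k) _ ab.
have -> : [set y : E | (forall l, r ord0 l < val y.1 ord0 l < s ord0 l) /\ a < val y.2 < b + shrink k] = rect k.
  by rewrite predeqE => y; split=> -[yl ?]; split => // l; have := yl l; rewrite !mxE.
move=> -> //; first by congr ((_ * _)%R%:E * _)%E; apply: eq_bigr => l _; rewrite !mxE.
- move=> l; rewrite !mxE lt_min tick_lt1 andbT tickS -addrA ltrDl addr_gt0// invr_gt0//.
- move=> z /= zl; split => [l|l l' ll'].
    have := zl l; rewrite !mxE lt_min => /and3P[tz _ z1]; rewrite (ltW z1) andbT.
    by apply: le_lt_trans tz; rewrite /tick divr_ge0.
  have := zl l; have := zl l'; rewrite !mxE !lt_min => /andP[tz _] /and3P[_ zt _].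
  apply: lt_trans zt _; apply: le_lt_trans tz.
  apply: (@le_trans _ _ (tick N (corner j l).+2)).
    by rewrite [leRHS]tickS lerD2l ltW.
  by apply: tick_le; have := corner_gap j ll'; lia.
- move=> u /=; rewrite in_itv/= => /andP[au ub]; apply/andP; split.
    by apply: lt_trans va _; rewrite lte_fin.
  by apply: lt_trans (bkw k); rewrite lte_fin.
Qed.

Let cc l : continuous (fun y : E => coord y l).
Proof. exact: coord_continuous. Qed.

Let ch : continuous (fun y : E => height y).
Proof. exact: height_continuous. Qed.

Let measurable_rect k : measurable (rect k : set (borel E)).
Proof.
have -> : rect k = (\bigcap_(l in [set: 'I_m]) ([set y | tick N (corner j l) < coord y l] `&`
    [set y | coord y l < upper k l])) `&`
  ([set y | a < height y] `&` [set y | height y < b + shrink k]).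
  rewrite predeqE => y; split=> [[yj /andP[? ?]]|[yj [h1 h2]]].
    by split => // l _; have /andP[? ?] := yj l.
  by split => [l|]; apply/andP => //; have [] := yj l Logic.I.
apply: measurableI.
  apply: fin_bigcap_measurable => // l _; apply: measurableI.
    exact: continuous_gt_borel.
  exact: continuous_lt_borel.
by apply: measurableI; [exact: continuous_gt_borel|exact: continuous_lt_borel].
Qed.

Let shrink_noninc k k' : (k <= k')%N -> shrink k' <= shrink k.
Proof.
by move=> kk'; rewrite /shrink ler_pM2l ?invr_gt0// lef_pV2 ?posrE// ler_nat.
Qed.

Let rect_cap : \bigcap_k rect k = cell_box j `\` face.
Proof.
rewrite predeqE => y; split => [yr|[/andP[/forallP yl /andP[ay yb]] nface] k _].
  split.
    apply/andP; split.
      apply/forallP => l; apply/andP; split; first by have [/(_ l)/andP[]] := yr 0%N Logic.I.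
      apply: le_shrink => k; have [/(_ l)] := yr k Logic.I.
      by rewrite lt_min => /and3P[].
    apply/andP; split; first by have [_ /andP[]] := yr 0%N Logic.I.
    by apply: le_shrink => k; have [_ /andP[]] := yr k Logic.I.
  move=> [l yl1]; have [/(_ l)] := yr 0%N Logic.I.
  by rewrite yl1 !lt_min ltxx !andbF.
split => [l|].
  have /andP[-> yt] := yl l; rewrite /= lt_min.
  rewrite (le_lt_trans yt) ?ltrDl//= lt_neqAle; apply/andP; split.
    by apply/eqP => y1; apply: nface; exists l.
  exact: coord_le1.
by rewrite ay/= (le_lt_trans yb)// ltrDl.
Qed.

Let measurable_face : measurable (face : set (borel E)).
Proof.
have -> : face = \bigcup_(l in [set: 'I_m]) [set y | 1 <= coord y l].
  rewrite predeqE => y; split=> [[l yl]|[l _ /= yl]]; exists l => //=.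
    by rewrite /coord yl.
  by apply/eqP; rewrite eq_le yl andbT; exact: coord_le1.
apply: fin_bigcup_measurable => // l _.
by apply: closed_borel; exact: continuous_ge_closed.
Qed.

(** The face is null by the second clause of [is_mean_measure]. The rest of the cell is a decreasing
    intersection of open rectangles, where [eta] is prescribed, and continuity from above applies to
    [eta] and to [mu_measure]. *)
Lemma eta_cell_box : eta (cell_box j) = (cell_mass mu j)%:E.
Proof.
have mB := @measurable_cell_box R m v w vw N j.
rewrite (measureDI eta mB measurable_face).
rewrite [X in (_ + X)%E](_ : _ = 0%E) ?adde0; last first.
  have mBf : measurable (cell_box (vw := vw) j `&` face : set (borel E)) by exact: measurableI.
  by apply: (subset_measure0 mBf measurable_face) => //; case: eta_mean.
have value_lim : mu_measure `]a, (b + shrink k)%R[%classic @[k --> \oo] --> mu_measure `]a, b]%classic.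
  have -> : `]a, b]%classic = \bigcap_k `]a, (b + shrink k)%R[%classic.
    rewrite predeqE => x /=; rewrite in_itv/=; split=> [/andP[ax xb] k _|xk].
      by rewrite /= in_itv/= ax/= (le_lt_trans xb)// ltrDl.
    apply/andP; split; first by have := xk 0%N Logic.I; rewrite /= in_itv/= => /andP[].
    by apply: le_shrink => k; have := xk k Logic.I; rewrite /= in_itv/= => /andP[].
  apply: nonincreasing_cvg_mu.
  - rewrite mu_measureE ?ltry// bE -addrA ltrDl addr_gt0// invr_gt0//.
  - by move=> k; exact: measurable_itv.
  - by apply: bigcap_measurable => // k _; exact: measurable_itv.
  - move=> k k' kk'; apply/subsetPset => x; rewrite /= !in_itv/= => /andP[-> /lt_le_trans]; apply.
    by rewrite lerD2l shrink_noninc.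
have eta_lim : eta (rect k) @[k --> \oo] --> eta (cell_box j `\` face).
  rewrite -rect_cap; apply: nonincreasing_cvg_mu => //.
  - rewrite eta_rect mu_measureE -?EFinM ?ltry//.
    by rewrite bE -addrA ltrDl addr_gt0// invr_gt0.
  - by apply: bigcap_measurable.
  - move=> k k' kk'; apply/subsetPset => y [yl /andP[ay yb]]; split => [l|].
      have /andP[-> +] := yl l; rewrite !lt_min /= => /andP[yt ->]; rewrite andbT.
      by apply: lt_le_trans yt _; rewrite lerD2l shrink_noninc.
    by rewrite ay/= (lt_le_trans yb)// lerD2l shrink_noninc.
have upper_cvg : (m`!%:R * \prod_(l < m) (upper k l - tick N (corner j l)))%:E @[k --> \oo] -->
    (m`!%:R * \prod_(l < m) (N%:R^-1 : R))%:E.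
  apply: cvg_EFin; first exact: nearW.
  apply: cvgMl_tmp; apply: cvg_big => [|l _]; first exact: mul_continuous.
  have -> : N%:R^-1 = Num.min (tick N (corner j l).+1 + 0) 1 - tick N (corner j l) :> R.
    by rewrite addr0 min_l// tickS addrC addKr.
  apply: cvgB; last exact: cvg_cst.
  rewrite /upper minr_absE; under eq_fun do rewrite minr_absE.
  have tick_cvg : tick N (corner j l).+1 + shrink k @[k --> \oo] --> tick N (corner j l).+1 + 0.
    by apply: cvgD; [exact: cvg_cst|exact: shrink_cvg].
  apply: cvgMr_tmp; apply: cvgB.
    by apply: cvgD => //; exact: cvg_cst.
  by apply: cvg_norm; apply: cvgB => //; exact: cvg_cst.
have ab : a < b by rewrite bE ltrDl invr_gt0.
have oc : mu_measure `]a, b]%classic = (mu a - mu b)%:E.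
  by apply: (mu_measure_oc mu_measureE va ab _ (bkw 0)); rewrite ltrDl.
have : eta (rect k) @[k --> \oo] --> (cell_mass mu j)%:E.
  under eq_fun do rewrite eta_rect.
  rewrite /cell_mass EFinM -oc; apply: cvgeM => //.
  by rewrite oc.
by move=> /(cvg_unique _ eta_lim); apply.
Qed.

End cell_intensity.
(** * Convergence in distribution *)

Section bounded_expectation.
Context {R : realType} d (T : measurableType d) (P : probability T R).

Lemma integrable_bounded (f : T -> R) (C : R) : measurable_fun setT f ->
  (forall x, `|f x| <= C) -> P.-integrable setT (EFin \o f).
Proof.
move=> mf fC; apply: (@le_integrable _ _ _ P _ measurableT _ (EFin \o cst C)).
- exact/measurable_EFinP.
- by move=> x _ /=; rewrite lee_fin (le_trans (fC x))// ler_norm.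
- by apply: finite_measure_integrable_cst.
Qed.

Lemma bounded_cvg (f_ : nat -> T -> R) (f : T -> R) (C : R) :
  (forall k, measurable_fun setT (f_ k)) -> (forall k x, `|f_ k x| <= C) ->
  (forall x, f_ k x @[k --> \oo] --> f x) ->
  \int[P]_x f_ k x @[k --> \oo] --> \int[P]_x f x.
Proof.
move=> mf fC ff.
have mlim : measurable_fun setT f by apply: (measurable_fun_cvg mf) => x _; exact: ff.
have fC' x : `|f x| <= C.
  have nf : `|f_ k x| @[k --> \oo] --> `|f x| by apply: cvg_norm; exact: ff.
  rewrite -(cvg_lim _ nf)//; apply: limr_le; first by apply/cvg_ex; exists `|f x|.
  by apply: nearW => k; exact: fC.
apply: fine_cvg; rewrite fineK; last first.
  exact: integrable_fin_num (integrable_bounded mlim fC').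
apply: (@dominated_cvg _ _ _ P setT measurableT _ _ (EFin \o cst C)) => //.
- by move=> k; exact/measurable_EFinP.
- by move=> x _; apply: cvg_EFin; [exact: nearW|exact: ff].
- by apply: finite_measure_integrable_cst.
- by move=> k x _; rewrite /= lee_fin; exact: fC.
Qed.

Lemma bounded_expectationE (f : T -> R) (C : R) : measurable_fun setT f ->
  (forall x, `|f x| <= C) -> ('E_P[f] = (\int[P]_x f x)%R%:E)%E.
Proof.
move=> mf fC; rewrite unlock /Rintegral fineK//.
exact: integrable_fin_num (integrable_bounded mf fC).
Qed.

End bounded_expectation.

Section count_atoms.
Context {R : realType} (m : nat) (v w : \bar R) (vw : (v < w)%E).
Local Notation E := (state_space m vw).
Local Notation PM := (point_measure R E).
Local Notation cell N := (cell m v w N).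
Implicit Types nu : PM.

Definition count_atom N (k : {ffun cell N -> nat}) : set PM :=
  [set nu | forall j, nu (cell_box j) = (k j)%:R%:E].

Definition cell_count N nu : {ffun cell N -> nat} :=
  [ffun j => projT1 (cid (cell_box_natural nu j))].

Lemma cell_countP N nu : count_atom (cell_count N nu) nu.
Proof. by move=> j; rewrite ffunE; case: cid. Qed.

Lemma count_atom_eq N nu k : count_atom k nu <-> k = cell_count N nu.
Proof.
split=> [ka|->]; last exact: cell_countP.
apply/ffunP => j; apply/eqP; rewrite -(eqr_nat R) -eqe; apply/eqP.
by rewrite -ka (@cell_countP N nu).
Qed.

Lemma measurable_count_atom d (T : measurableType d) (M : T -> PM) N (k : {ffun cell N -> nat}) :
  measurable_fun setT (M : T -> borel PM) -> measurable (M @^-1` count_atom k).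
Proof.
move=> mM; rewrite [X in measurable X](_ : _ =
    \bigcap_(j in [set: cell N]) [set om | M om (cell_box j) = (k j)%:R%:E]).
  by apply: fin_bigcap_measurable => // j _; exact: measurable_count.
by rewrite predeqE => om; split => [h j _|h j]; exact: h.
Qed.

Variables (h : PM -> R) (C : R).
Hypothesis h_cont : continuous h.
Hypothesis h_ge0 : forall nu, 0 <= h nu.
Hypothesis h_le : forall nu, h nu <= C.

(** Counts that no point measure attains give the infimum of the empty set, which is 0 here and so
    respects [lower_ge0]. *)
Definition lower N (k : {ffun cell N -> nat}) : R := inf (h @` count_atom k).

Lemma lower_ge0 N (k : {ffun cell N -> nat}) : 0 <= lower k.
Proof.
rewrite /lower; have [->|/set0P ne] := eqVneq (h @` count_atom k) set0.
  by rewrite inf0.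
by apply: lb_le_inf => // _ [nu _ <-].
Qed.

Lemma lower_le N nu : lower (cell_count N nu) <= h nu.
Proof.
apply: ge_inf; first by exists 0 => _ [nu' _ <-].
by exists nu => //; exact: cell_countP.
Qed.

Lemma lower_cvg nu : lower (cell_count N nu) @[N --> \oo] --> h nu.
Proof.
apply/cvgrPdist_le => e e0.
have /atoms_nbhs : nbhs nu [set nu' | `|h nu - h nu'| <= e].
  by have /cvgrPdist_le := h_cont (x := nu); exact.
apply: filterS => N near_h; rewrite ger0_norm ?subr_ge0 ?lower_le// lerBlDr -lerBlDl.
apply: lb_le_inf; first by exists (h nu); exists nu => //; exact: cell_countP.
move=> _ [nu' nu'k <-].
have : same_counts N nu nu' by move=> j; rewrite nu'k (@cell_countP N nu).
by move=> /near_h/=; rewrite ler_norml => /andP[_]; rewrite lerBlDr -lerBlDl.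
Qed.

(** Counts are cut off at [L] to leave a finite sum, whose expectation involves finitely many count
    probabilities. The dropped terms are nonnegative, so it stays below [h]. *)
Definition lower_step N L nu : R :=
  \sum_(k : {ffun cell N -> 'I_L}) lower (natcube k) * \1_(count_atom (natcube k)) nu.

Lemma lower_stepE N L nu : lower_step N L nu =
  if [forall j, (cell_count N nu j < L)%N] then lower (cell_count N nu) else 0.
Proof.
rewrite /lower_step; case: forallP => [small|large].
  pose k0 := [ffun j => Ordinal (small j)].
  have k0E : natcube k0 = cell_count N nu.
    by apply/ffunP => j; rewrite [LHS]ffunE [k0 j]ffunE.
  rewrite (bigD1 k0)//= big1 ?addr0 => [|k kk0].
    by rewrite k0E indicE mem_set ?mulr1//; exact: cell_countP.
  rewrite indicE memNset ?mulr0// => /count_atom_eq; rewrite -k0E => /natcube_inj/eqP.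
  by rewrite (negPf kk0).
rewrite big1// => k _; rewrite indicE memNset ?mulr0// => /count_atom_eq kE.
by apply: large => j; rewrite -kE ffunE.
Qed.

Lemma lower_step_itv N L nu : 0 <= lower_step N L nu <= h nu.
Proof.
by rewrite lower_stepE; case: ifP => _; rewrite ?lower_ge0 ?lower_le ?lexx ?h_ge0.
Qed.

Lemma lower_step_cvg N nu : lower_step N L nu @[L --> \oo] --> lower (cell_count N nu).
Proof.
apply: cvg_near_cst; exists (\max_j cell_count N nu j).+1 => // L /= ltL.
rewrite lower_stepE; case: forallP => // -[] j.
by rewrite (leq_trans _ ltL)// ltnS leq_bigmax.
Qed.

Lemma measurable_lower_step d (T : measurableType d) (M : T -> PM) N L :
  measurable_fun setT (M : T -> borel PM) -> measurable_fun setT (lower_step N L \o M).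
Proof.
move=> mM; rewrite /lower_step.
have -> : (fun nu => \sum_(k : {ffun cell N -> 'I_L}) lower (natcube k) * \1_(count_atom (natcube k)) nu) \o M =
    (fun om => \sum_(k : {ffun cell N -> 'I_L}) lower (natcube k) * \1_(M @^-1` count_atom (natcube k)) om).
  by apply/funext => om /=.
apply: measurable_sum => k; apply: measurable_funM; first exact: measurable_cst.
by apply: measurable_indic; exact: measurable_count_atom.
Qed.

Lemma integral_lower_step d (T : measurableType d) (P : probability T R) (M : T -> PM) N L :
  measurable_fun setT (M : T -> borel PM) ->
  \int[P]_om lower_step N L (M om) = \sum_(k : {ffun cell N -> 'I_L})
    lower (natcube k) * fine (P (M @^-1` count_atom (natcube k))).
Proof.
move=> mM; have mA (k : {ffun cell N -> 'I_L}) := measurable_count_atom (natcube k) mM.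
have Aoo (k : {ffun cell N -> 'I_L}) : (P (M @^-1` count_atom (natcube k)) < +oo)%E.
  by rewrite ltey_eq fin_num_measure.
by have [_ <-] := integral_step (fun k => lower (natcube k)) mA Aoo.
Qed.

(** Bounded convergence twice, each time at a cost of e / 2: in [L] for fixed [N], which also gives
    measurability of the limit, and in [N]. *)
Lemma approx_from_below d (T : measurableType d) (P : probability T R) (M : T -> PM) (e : R) :
  measurable_fun setT (M : T -> borel PM) -> 0 < e ->
  exists N L, \int[P]_om h (M om) - e <= \int[P]_om lower_step N L (M om).
Proof.
move=> mM e0; have e2 : 0 < e / 2 by rewrite divr_gt0.
have C0 : 0 <= C := le_trans (h_ge0 point) (h_le point).
have bnd (q : R) nu : 0 <= q <= h nu -> `|q| <= C.
  by move=> /andP[q0 qh]; rewrite ger0_norm// (le_trans qh).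
have step_bnd N L om : `|lower_step N L (M om)| <= C by apply: bnd; exact: lower_step_itv.
have lower_bnd N om : `|lower (cell_count N (M om))| <= C.
  by apply: bnd (M om) _; rewrite lower_ge0 lower_le.
have cvgL N : \int[P]_om lower_step N L (M om) @[L --> \oo] -->
    \int[P]_om lower (cell_count N (M om)).
  apply: (bounded_cvg (C := C)) => [L|L om|om]; first exact: measurable_lower_step.
    exact: step_bnd.
  exact: lower_step_cvg.
have cvgN : \int[P]_om lower (cell_count N (M om)) @[N --> \oo] --> \int[P]_om h (M om).
  apply: (bounded_cvg (C := C)) => [N|N om|om].
  - apply: (measurable_fun_cvg (h := fun L => lower_step N L \o M)).
      by move=> L; exact: measurable_lower_step.
    by move=> om _; exact: lower_step_cvg.
  - exact: lower_bnd.
  - exact: lower_cvg.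
have [N hN] : exists N, \int[P]_om h (M om) - e / 2 <= \int[P]_om lower (cell_count N (M om)).
  near \oo => N; exists N; near: N.
  move/cvgrPdist_le : cvgN => /(_ _ e2); apply: filterS => N.
  by rewrite ler_norml => /andP[_]; rewrite !lerBlDr addrC.
exists N.
have [L hL] : exists L, \int[P]_om lower (cell_count N (M om)) - e / 2 <= \int[P]_om lower_step N L (M om).
  near \oo => L; exists L; near: L.
  move/cvgrPdist_le : (cvgL N) => /(_ _ e2); apply: filterS => L.
  by rewrite ler_norml => /andP[_]; rewrite !lerBlDr addrC.
by exists L; lra.
Unshelve. all: by end_near. Qed.

End count_atoms.

Section count_convergence.
Context {R : realType} (m : nat) (v w : \bar R) (vw : (v < w)%E).
Local Notation PM := (point_measure R (state_space m vw)).
Context (d : nat -> measure_display) (T : forall n, measurableType (d n)).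
Context (P : forall n, probability (T n) R).
Context d' (T' : measurableType d') (P' : probability T' R) (M : T' -> PM).
#[local] Unset Implicit Arguments.
Context (X : forall n, T n -> PM).
Hypothesis mX : forall n, measurable_fun setT (X n : T n -> borel PM).
Hypothesis mM : measurable_fun setT (M : T' -> borel PM).
Hypothesis counts_cvg : forall N (k : {ffun cell m v w N -> nat}),
  fine (P n (X n @^-1` count_atom k)) @[n --> \oo] --> fine (P' (M @^-1` count_atom k)).

Lemma liminf_expectation (h : PM -> R) (C e : R) : continuous h ->
  (forall nu, 0 <= h nu) -> (forall nu, h nu <= C) -> 0 < e ->
  \forall n \near \oo, \int[P']_om h (M om) - e <= \int[P n]_om h (X n om).
Proof.
move=> ch h0 hC e0; have e2 : 0 < e / 2 by rewrite divr_gt0.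
(* The grid and the cut-off depend on the limit [M] alone, so only finitely many count probabilities
   have to converge. *)
have [N [L NL]] := approx_from_below ch h0 hC P' mM e2.
have mh : measurable_fun setT (h : borel PM -> R) by exact: continuous_borel.
have hnorm nu : `|h nu| <= C by rewrite ger0_norm.
have : \int[P n]_om lower_step h N L (X n om) @[n --> \oo] --> \int[P']_om lower_step h N L (M om).
  rewrite integral_lower_step//; under eq_fun do rewrite integral_lower_step//.
  apply: cvg_big => [|k _]; first exact: add_continuous.
  by apply: cvgMl_tmp; exact: counts_cvg.
move=> /cvgrPdist_le/(_ _ e2); apply: filterS => n; rewrite ler_norml => /andP[_ near_n].
apply: (@le_trans _ _ (\int[P n]_om lower_step h N L (X n om))).
  by move: NL near_n; lra.
have step_le nu : 0 <= lower_step h N L nu <= h nu by exact: lower_step_itv.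
apply: le_Rintegral => //.
- apply: (@integrable_bounded _ _ _ (P n) _ C); first exact: measurable_lower_step.
  by move=> om; have /andP[q0 qh] := step_le (X n om); rewrite ger0_norm// (le_trans qh).
- apply: (@integrable_bounded _ _ _ (P n) _ C) => //.
  exact: (measurableT_comp mh (mX n)).
- by move=> om _; have /andP[] := step_le (X n om).
Qed.

Lemma expectation_cvg (h : PM -> R) (C : R) : continuous h ->
  (forall nu, `|h nu| <= C) -> ('E_(P n)[h \o X n])%E @[n --> \oo] --> ('E_P'[h \o M])%E.
Proof.
move=> ch hC.
have mh : measurable_fun setT (h : borel PM -> R) by exact: continuous_borel.
have mhX n : measurable_fun setT (h \o X n) by exact: (measurableT_comp mh (mX n)).
have mhM : measurable_fun setT (h \o M) by exact: (measurableT_comp mh mM).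
rewrite (bounded_expectationE P' mhM (fun om => hC (M om))).
rewrite (_ : (fun n => _) = fun n => (\int[P n]_om h (X n om))%:E); last first.
  by apply/funext => n; exact: (bounded_expectationE (P n) (mhX n) (fun om => hC (X n om))).
apply: cvg_EFin; first exact: nearW.
have intX n := integrable_bounded (P n) (mhX n) (fun om => hC (X n om)).
have intM := integrable_bounded P' mhM (fun om => hC (M om)).
apply/cvgrPdist_le => e e0.
have cstC d0 (T0 : measurableType d0) (P0 : probability T0 R) : \int[P0]_om C = C.
  have P01 : fine (P0 setT) = 1 by rewrite probability_setT.
  by rewrite Rintegral_cst// -[RHS]mulr1; congr (_ * _).
have intC d0 (T0 : measurableType d0) (P0 : probability T0 R) : P0.-integrable setT (EFin \o cst C).
  exact: finite_measure_integrable_cst.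
have hC2 nu : - C <= h nu <= C by rewrite -ler_norml.
have up : \forall n \near \oo, \int[P']_om (C + h (M om)) - e <= \int[P n]_om (C + h (X n om)).
  apply: (liminf_expectation (fun nu => C + h nu) (2 * C)) => // [nu|nu|nu].
  - by apply: (@continuousD _ _ _ (fun=> C) h); [exact: cst_continuous|exact: ch].
  - by have := hC2 nu; lra.
  - by have := hC2 nu; lra.
have down : \forall n \near \oo, \int[P']_om (C - h (M om)) - e <= \int[P n]_om (C - h (X n om)).
  apply: (liminf_expectation (fun nu => C - h nu) (2 * C)) => // [nu|nu|nu].
  - by apply: (@continuousB _ _ _ (fun=> C) h); [exact: cst_continuous|exact: ch].
  - by have := hC2 nu; lra.
  - by have := hC2 nu; lra.
near=> n.
have : \int[P']_om (C + h (M om)) - e <= \int[P n]_om (C + h (X n om)) by near: n.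
have : \int[P']_om (C - h (M om)) - e <= \int[P n]_om (C - h (X n om)) by near: n.
rewrite (RintegralB measurableT (intC _ _ _) intM) (RintegralB measurableT (intC _ _ _) (intX n)).
rewrite (RintegralD measurableT (intC _ _ _) intM) (RintegralD measurableT (intC _ _ _) (intX n)).
rewrite !cstC ler_norml/=; lra.
Unshelve. all: by end_near. Qed.

End count_convergence.

(** * Application to the point processes of the statement *)

Theorem theorem2p1 (R : realType) (m : nat) (hm : (1 <= m)%N)
  (p : nat -> nat) (p_gt0 : forall n, (0 < p n)%N) (p_cvg : p @ \oo --> \oo)
  (d : nat -> measure_display) (T : forall n, measurableType (d n))
  (P : forall n, probability (T n) R)
  (x : forall n, nat -> {RV (P n) >-> n.-tuple R})
  (x_indep : forall n, mutually_independent (P n)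
     (fun i : 'I_(p n) => x n i : T n -> n.-tuple R))
  (x_ident : forall n, identically_distributed (P n)
     (fun i : 'I_(p n) => x n i : T n -> n.-tuple R))
  (v w : \bar R) (vw : (v < w)%E)
  (g : forall n, m.-tuple (n.-tuple R) -> open_itv vw)
  (g_meas : forall n, measurable_fun setT (fun y => val (g n y)))
  (g_sym : forall n (s : {perm 'I_m}) (y : m.-tuple (n.-tuple R)),
     g n [tuple tnth y (s l) | l < m] = g n y)
  (mu : R -> R)
  (mu_ge0 : forall t, open_itv_set v w t -> 0 <= mu t)
  (mu_v : mu (fine t) @[t --> within [set t | (v < t < w)%E] (nbhs v)] --> +oo)
  (mu_w : mu (fine t) @[t --> within [set t | (v < t < w)%E] (nbhs w)] --> 0)
  (mu_measure : {measure set R -> \bar R})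
  (mu_measureE : forall a b : R, (v < a%:E)%E -> a < b -> (b%:E < w)%E ->
     mu_measure `]a, b[%classic = (mu a - mu b)%:E)
  (A1 : forall t, open_itv_set v w t ->
     ('C(p n, m)%:R%:E *
       P n [set om | (t < val (g n [tuple x n l om | l < m]))%R])%E
     @[n --> \oo] --> (mu t)%:E)
  (A2 : forall t, open_itv_set v w t -> forall l, (1 <= l <= m - 1)%N ->
     (fun n => fine (P n
       [set om | t < val (g n [tuple x n i om | i < m]) /\
                 t < val (g n [tuple x n (m - l + i)%N om | i < m])]) : R^o)
     =o_\oo (fun n => (p n)%:R ^- (2 * m - l) : R^o))
  (eta : {measure set (borel (state_space m vw)) -> \bar R})
  (eta_mean : is_mean_measure mu_measure eta)
  (d' : measure_display) (T' : measurableType d') (P' : probability T' R)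
  (M : T' -> point_measure R (state_space m vw))
  (M_poisson : is_poisson_random_measure P' M eta) :
  cvg_in_distribution P
    (fun n om => point_process (p n) (g n) (fun i => x n i om)) P' M.
Proof.
set X := fun n om => point_process (p n) (g n) (fun i => x n i om).
pose G n (y : m.-tuple (n.-tuple R)) : R := val (g n y).
have mG n : measurable_fun setT (G n) := g_meas n.
have mx n i : measurable_fun setT (x n i : T n -> n.-tuple R) by exact: measurable_funPT.
have mX n : measurable_fun setT (X n : T n -> borel (point_measure R (state_space m vw))).
  apply: (@measurable_marked R m v w vw _ (@times R m (p n)) _ _
    (fun om t => g n [tuple x n (tnth (val t) l) om | l < m])) => t.
  exact: (measurableT_comp (g_meas n) (measurable_sample (mx n) (val t))).
have [mM M_count _ M_indep] := M_poisson.
split => // h h_cont [C hC].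
apply: (@expectation_cvg R m v w vw _ _ P _ _ P' M X mX mM _ h C) => // N k.
have cellE n om (j : cell m v w N) : X n om (cell_box j) =
    (counts (labels (G n) (@cell_label R m v w N (p n)) (fun i => x n i) om) j)%:R%:E.
  rewrite ffunE natr_sum -sumEFin; apply: eq_bigr => t _.
  rewrite labelsE cell_labelE diracE; congr ((_ : bool)%:R%:E).
  by apply/idP/idP; rewrite inE.
have countsE n : fine (P n (X n @^-1` count_atom k)) =
    fpr (labels_law (G n) (@cell_label R m v w N (p n)) (P n) (fun i => x n i))
      (fun L => counts L == k).
  rewrite (fpr_labels (mG n) (@measurable_cell_label R m v w N (p n)) (P n) (mx n)).
  congr (fine (P n _)); rewrite predeqE => om; split=> [Xk|/eqP Lk j].
    apply/eqP/ffunP => j; apply/eqP; rewrite -(eqr_nat R) -eqe -cellE.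
    by rewrite (Xk j).
  by rewrite cellE Lk.
rewrite (funext countsE).
have massE (j : cell m v w N) : eta (cell_box j) = (cell_mass mu j)%:E.
  exact: (eta_cell_box mu_measureE eta_mean).
have -> : fine (P' (M @^-1` count_atom k)) =
    \prod_j (expR (- cell_mass mu j) * cell_mass mu j ^+ k j / (k j)`!%:R).
  (* Independence of a Poisson random measure is stated for families indexed by ordinals, so the
     cells are enumerated; the events used are singletons of counts. *)
  pose B (i : 'I_#|{: cell m v w N}|) : set (borel (state_space m vw)) := cell_box (enum_val i).
  have mB i : measurable (B i) by exact: measurable_cell_box.
  have B_triv : trivIset setT B.
    move=> i i' _ _ [y [iy i'y]]; apply: enum_val_inj; exact: in_cell_inj iy i'y.
  have M_atom : M @^-1` count_atom k =
      \bigcap_(i in [set` [set: 'I_#|{: cell m v w N}|]%SET]) (fun om => M om (B i)) @^-1` [set (k (enum_val i))%:R%:E].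
    rewrite predeqE => om; split => [Mk i _|Mk j]; first exact: Mk.
    have := Mk (enum_rank j); rewrite /B /= enum_rankK; apply.
    by rewrite inE.
  rewrite M_atom (M_indep _ _ mB B_triv) => [|i]; last exact: emeasurable_set1.
  rewrite (eq_bigr (fun i => (expR (- cell_mass mu (enum_val i)) *
      cell_mass mu (enum_val i) ^+ k (enum_val i) / (k (enum_val i))`!%:R)%:E)) => [|i _]; last first.
    have := M_count (B i) (mB i) _ (k (enum_val i)); rewrite /B massE ltry => -> //.
  rewrite -(big_morph EFin (@EFinM R) erefl)/=.
  rewrite (eq_bigl predT) => [|i]; last by rewrite inE.
  by rewrite [RHS](reindex (@enum_val _ (mem {: cell m v w N})))//=; exact/onW_bij/enum_val_bij.
have G_sym n (s : {perm 'I_m}) (y : m.-tuple (n.-tuple R)) :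
  G n [tuple tnth y (s l) | l < m] = G n y by rewrite /G g_sym.
apply: (@cell_counts_cvg R m hm p p_gt0 p_cvg d T P _ _ (fun n i => x n i) mx x_indep x_ident
  v w vw G mG G_sym).
- move=> t tvw; have /fine_cvgP[_] := A1 t tvw.
  apply: cvg_trans; apply: near_eq_cvg; apply: nearW => n /=.
  rewrite fineM// fin_num_measure//.
  exact: (measurable_exceed (mG n) t (mx n) (@nat_of_ord m)).
(* Multiplying the little-o bound by p^(2m-l) turns it into convergence to 0. *)
- move=> t tvw l l1; have /eqoP A2l := A2 t tvw l l1.
  apply/cvgrPdist_le => e e0; have := A2l e e0; apply: filterS => n.
  have pR : 0 < (p n)%:R ^+ (2 * m - l) :> R by rewrite exprn_gt0 ?ltr0n.
  rewrite sub0r normrN normrM normfV !(gtr0_norm pR) -ler_pdivlMl// mulrC.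
  exact.
Qed.
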